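(* Let $0<q<1$, let $a,b,c,d$ be nonzero complex numbers with $\max(|a|,|b|,|c|,|q/d|)<1$, let $\alpha=q^{\alpha_0}$ with $0<\operatorname{Re}\alpha_0<1/2$, and let $\nu\in\mathbb{C}$. Assume that the parameters are such that the denominators on the right-hand side below do not vanish (i.e. $a/b$ and $cd$ are not integer powers of $q$). With $v_\nu(x;a,b,c;d)$ as defined in the context, the integral $$d_\nu^2=\int_0^{\pi}\frac{v_\nu^2(\cos\theta;a,b,c;d)\,(e^{2i\theta},e^{-2i\theta};q)_\infty}{(ae^{i\theta},ae^{-i\theta},be^{i\theta},be^{-i\theta},ce^{i\theta},ce^{-i\theta},qe^{i\theta}/d,qe^{-i\theta}/d;q)_\infty\,(\alpha e^{i\theta},\alpha e^{-i\theta},qe^{i\theta}/\alpha,qe^{-i\theta}/\alpha;q)_\infty}\,d\theta$$ equals $T_1+T_2+T_3+T_4$, where $$T_1=\frac{2\pi}{(1-ac)\,(q,ab;q)_\infty^2}\,\frac{(qa/d,abq^\nu,bcq^\nu,q^{1-\nu}/(ad),q^{1-\nu}/(cd);q)_\infty}{(bc,b/a,q/(cd),\alpha a,qa/\alpha,\alpha c,qc/\alpha;q)_\infty}\sum_{n=0}^\infty q^n\frac{(q^{-\nu},abcdq^{\nu-1},\alpha c,qc/\alpha;q)_n}{(q,acq,bc,cd;q)_n}\;{}_5\varphi_4\!\left(\begin{matrix}acq^n,acq^\nu,q^{1-\nu}/(bd),\alpha a,qa/\alpha\\ acq^{n+1},ac,qa/b,qa/d\end{matrix};q,q\right),$$ $$T_2=\frac{2\pi}{(1-bc)\,(q,ab;q)_\infty^2}\,\frac{(qb/d,abq^\nu,acq^\nu,q^{1-\nu}/(bd),q^{1-\nu}/(cd);q)_\infty}{(ac,a/b,q/(cd),\alpha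 b,qb/\alpha,\alpha c,qc/\alpha;q)_\infty}\sum_{n=0}^\infty q^n\frac{(q^{-\nu},abcdq^{\nu-1},\alpha c,qc/\alpha;q)_n}{(q,bcq,ac,cd;q)_n}\;{}_5\varphi_4\!\left(\begin{matrix}bcq^n,bcq^\nu,q^{1-\nu}/(ad),\alpha b,qb/\alpha\\ bcq^{n+1},bc,qb/a,qb/d\end{matrix};q,q\right),$$ $$T_3=\frac{2\pi\,(qa/d;q)_\infty^2}{(1-qa/d)\,(q,ab,bc;q)_\infty^2}\,\frac{(q^{-\nu},abcdq^{\nu-1},q^{1-\nu}/(ad),bcq^\nu,qb/d;q)_\infty}{(ac,b/a,cd/q,\alpha a,qa/\alpha,q\alpha/d,q^2/(\alpha d);q)_\infty}\sum_{n=0}^\infty q^n\frac{(abq^\nu,q^{1-\nu}/(cd),q\alpha/d,q^2/(\alpha d);q)_n}{(q,qb/d,q^2a/d,q^2/(cd);q)_n}\;{}_5\varphi_4\!\left(\begin{matrix}aq^{n+1}/d,acq^\nu,q^{1-\nu}/(bd),\alpha a,qa/\alpha\\ aq^{n+2}/d,ac,qa/b,qa/d\end{matrix};q,q\right),$$ $$T_4=\frac{2\pi\,(qb/d;q)_\infty^2}{(1-qb/d)\,(q,ab,ac;q)_\infty^2}\,\frac{(q^{-\nu},abcdq^{\nu-1},q^{1-\nu}/(bd),acq^\nu,qa/d;q)_\infty}{(bc,a/b,cd/q,\alpha b,qb/\alpha,q\alpha/d,q^2/(\alpha d);q)_\infty}\sum_{n=0}^\infty q^n\frac{(abq^\nu,q^{1-\nu}/(cd),q\alpha/d,q^2/(\alpha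 d);q)_n}{(q,qa/d,q^2b/d,q^2/(cd);q)_n}\;{}_5\varphi_4\!\left(\begin{matrix}bq^{n+1}/d,bcq^\nu,q^{1-\nu}/(ad),\alpha b,qb/\alpha\\ bq^{n+2}/d,bc,qb/a,qb/d\end{matrix};q,q\right).$$
   Context: Notation: $(a;q)_n=\prod_{k=1}^n(1-aq^{k-1})$, $(a;q)_\infty=\prod_{k\ge1}(1-aq^{k-1})$, $(a_1,\dots,a_r;q)_n=\prod_{j=1}^r(a_j;q)_n$ for $n=0,1,2,\dots$ or $n=\infty$, $(a_1,\dots,a_r;q)_\infty^2$ is the square of $(a_1,\dots,a_r;q)_\infty$, and $${}_{s+1}\varphi_s\!\left(\begin{matrix}a_1,\dots,a_{s+1}\\ b_1,\dots,b_s\end{matrix};q,t\right)=\sum_{n=0}^\infty\frac{(a_1,\dots,a_{s+1};q)_n}{(q,b_1,\dots,b_s;q)_n}t^n .$$ For complex $\nu$ and $x=\tfrac12(q^z+q^{-z})$ (so $x=\cos\theta$ when $q^z=e^{i\theta}$), define $$v_\nu(x;a,b,c;d)=\frac{(bcq^\nu,\,q^{1-\nu}/(ad),\,q^{1+z}/d,\,q^{1-z}/d;q)_\infty}{(bc,\,q/(ad);q)_\infty}\;{}_4\varphi_3\!\left(\begin{matrix}q^{-\nu},abcdq^{\nu-1},aq^z,aq^{-z}\\ ab,ac,ad\end{matrix};q,q\right)$$ $$+\frac{(q^{-\nu},\,abcdq^{\nu-1},\,qb/d,\,qc/d,\,aq^z,\,aq^{-z};q)_\infty}{(ab,\,ac,\,bc,\,ad/q;q)_\infty}\;{}_4\varphi_3\!\left(\begin{matrix}q^{1-\nu}/(ad),\,bcq^\nu,\,q^{1+z}/d,\,q^{1-z}/d\\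 qb/d,\,qc/d,\,q^2/(ad)\end{matrix};q,q\right).$$ When $ad$ is an integer power of $q$ the individual terms are singular but the singularity of the sum is removable, and the value is taken by continuity in the parameters. (When $|bcq^\nu|<1$, $v_\nu$ is a multiple of a very-well-poised ${}_8\varphi_7$-series; $v_\nu$ is symmetric in $a,b,c$.) *)

(* Defs.v *)
From Stdlib Require Export Reals List ZArith.
From Stdlib Require Import ClassicalEpsilon.
From Coquelicot Require Export Coquelicot.
Export ListNotations.
Open Scope C_scope.

Definition Cexp (z : C) : C :=
  ((exp (Re z) * cos (Im z))%R, (exp (Re z) * sin (Im z))%R).

(* q^s for a positive real base and a complex exponent (principal value). *)
Definition cpow (q : R) (s : C) : C := Cexp (s * ln q).

Definition Cseries (u : nat -> C) : C :=
  (Series (fun n => Re (u n)), Series (fun n => Im (u n))).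

Definition Cseq_lim (u : nat -> C) : C :=
  (real (Lim_seq (fun n => Re (u n))), real (Lim_seq (fun n => Im (u n)))).

Fixpoint qpoch (a : C) (q : R) (n : nat) : C :=
  match n with
  | O => 1
  | S k => qpoch a q k * (1 - a * q ^ k)
  end.

Definition qpoch_inf (a : C) (q : R) : C := Cseq_lim (qpoch a q).

(* (a_1, ..., a_r; q)_n and (a_1, ..., a_r; q)_oo *)
Definition qpochs (l : list C) (q : R) (n : nat) : C :=
  fold_right (fun a p => qpoch a q n * p) 1 l.

Definition qpochs_inf (l : list C) (q : R) : C :=
  fold_right (fun a p => qpoch_inf a q * p) 1 l.

(* The basic hypergeometric series with upper parameters [num] and lower
   parameters [den]; it is used with [length num = S (length den)]. *)
Definition qhyp (num den : list C) (q : R) (t : C) : C :=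
  Cseries (fun n => qpochs num q n / qpochs (RtoC q :: den) q n * t ^ n).

(* The two-term expression for v_nu(x; a, b, c; d), with w = q^z, so that
   x = (w + 1/w)/2.  It is meaningful when ad is not an integer power of q.
   Exchanging w and 1/w only permutes parameters, so it depends on x alone. *)
Definition v_formula (q : R) (nu w a b c d : C) : C :=
  qpochs_inf [b * c * cpow q nu; cpow q (1 - nu) / (a * d);
              q * w / d; q / w / d] q
  / qpochs_inf [b * c; q / (a * d)] q
  * qhyp [cpow q (- nu); a * b * c * d * cpow q (nu - 1); a * w; a / w]
         [a * b; a * c; a * d] q q
  +
  qpochs_inf [cpow q (- nu); a * b * c * d * cpow q (nu - 1);
              q * b / d; q * c / d; a * w; a / w] q
  / qpochs_inf [a * b; a * c; b * c; a * d / q] q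
  * qhyp [cpow q (1 - nu) / (a * d); b * c * cpow q nu; q * w / d; q / w / d]
         [q * b / d; q * c / d; q ^ 2 / (a * d)] q q.

Definition is_q_power (q : R) (x : C) : Prop :=
  exists m : Z, x = RtoC (powerRZ q m).

(* When ad is an integer power of q, the removable singularity is filled in by
   the limit over the parameter d ([C_lim] does not use the value at d). *)
Definition v_fun (q : R) (nu w a b c d : C) : C :=
  if excluded_middle_informative (is_q_power q (a * d))
  then C_lim (fun d' => v_formula q nu w a b c d') d
  else v_formula q nu w a b c d.

Definition integrand (q : R) (nu alpha a b c d : C) (theta : R) : C :=
  let e := Cexp (Ci * theta) in
  let e' := Cexp (- (Ci * theta)) in
  (v_fun q nu e a b c d) ^ 2
  * qpochs_inf [Cexp (2 * Ci * theta); Cexp (- (2 * Ci * theta))] q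
  / (qpochs_inf [a * e; a * e'; b * e; b * e'; c * e; c * e';
                 q * e / d; q * e' / d] q
     * qpochs_inf [alpha * e; alpha * e'; q * e / alpha; q * e' / alpha] q).

(* Main.v *)
Require Import Defs.
From Stdlib Require Import Lra Lia ClassicalEpsilon.
Open Scope C_scope.

(** Write [e = q/d]. The proof rests on the fact that [v] is, up to the factor
    [1/(ab, ac, bc)_oo], symmetric in the four parameters [a, b, c, e].
    The formula defining [v] is a combination of two balanced 4phi3 series
    attached to the pair [{a, e}]; there is a combination [two_sides] of the
    same shape for each of the six pairs, and [two_sides_omega] says that,
    where they are defined, they are all equal to one function [omega], whose
    symmetry is visible. To see this, the products in the general term of
    a 4phi3 series are written as a nonterminating q-Saalschuetz sum
    ([q_saalschuetz]) over the points [w q^k] and [q^k/w]; after exchanging the summations, the sum over the points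
    of the pair is again a q-Saalschuetz sum, and what remains is [omega].
    As [omega] is continuous in [d], this also covers the removable
    singularities of [v] ([v_fun_omega]).

    In the integral one of the two factors [v] is then expanded along [{c, e}]
    and the other one along [{a, b}] ([integrand_expansion]). Each series
    carries a prefactor such as [(e w, e/w)_oo] or [(b w, b/w)_oo], which cancels
    a factor of the weight, and products such as [(c w, c/w)_n (a w, a/w)_k],
    which turn the remaining parameters into [c q^n] and [a q^k]. The termwise
    integrals are Askey-Wilson integrals with parameters
    [c q^n, a q^k, alpha, q/alpha]. Since the product of the last two is [q],
    their values ([aw_integral_theta]) are products of a factor depending on [n],
    a factor depending on [k], and [1/(1 - a c q^(n+k))]; the latter is what
    couples the two summations in the stated double series. The four
    choices of one series from each expansion give the four terms.

    The Askey-Wilson integral itself comes from one contour shift: a suitable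
    half of the weight is odd under [w -> q/w], which on the circle
    [|w| = sqrt q] is complex conjugation, so that its mean vanishes there
    and, by Cauchy's theorem, on [|w| = 1] ([aw_half_mean]). This determines the
    first moment of the weight, hence the effect of [a -> a q] on the integral,
    and iteration leads to the parameters [0, 0, 0, 0]. The functions
    involved are uniform limits of Laurent polynomials, for which Cauchy's
    theorem is elementary. *)

(** A class, so that instance resolution supplies the bounds on [q]. *)
Class base (q : R) : Prop := base_bounds : (0 < q < 1)%R.

Section BasicHypergeometric.
Context {q : R} {hq : base q}.

(** * Limits and dominated series of complex numbers *)

Definition clim (u : nat -> C) (l : C) : Prop :=
  is_lim_seq (fun n => Cmod (u n - l)) 0%R.

Fixpoint psum (u : nat -> C) (n : nat) : C :=
  match n with
  | O => 0
  | S k => psum u k + u k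
  end.

Lemma psum_S (u : nat -> C) (n : nat) : psum u (S n) = psum u n + u n.
Proof. reflexivity. Qed.

Definition csum (u : nat -> C) (l : C) : Prop := clim (psum u) l.

Lemma clim_squeeze (u : nat -> C) (l : C) (e : nat -> R) :
  (forall n, Cmod (u n - l) <= e n)%R -> is_lim_seq e 0%R -> clim u l.
Proof.
  intros H He. unfold clim.
  apply is_lim_seq_le_le with (u := fun _ => 0%R) (w := e); auto.
  - intros n. split; [apply Cmod_ge_0 | apply H].
  - apply is_lim_seq_const.
Qed.

Lemma clim_ext (u v : nat -> C) (l : C) :
  (forall n, u n = v n) -> clim u l -> clim v l.
Proof.
  intros H Hu. unfold clim in *.
  apply is_lim_seq_ext with (2 := Hu). intros n. rewrite H. reflexivity.
Qed.

Lemma clim_const (l : C) : clim (fun _ => l) l.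
Proof.
  unfold clim. apply is_lim_seq_ext with (fun _ => 0%R).
  - intros _. replace (l - l) with (RtoC 0) by ring. rewrite Cmod_0. reflexivity.
  - apply is_lim_seq_const.
Qed.

Lemma clim_plus (u v : nat -> C) (l m : C) :
  clim u l -> clim v m -> clim (fun n => u n + v n) (l + m).
Proof.
  intros Hu Hv.
  apply clim_squeeze with (fun n => Cmod (u n - l) + Cmod (v n - m))%R.
  - intros n. replace (u n + v n - (l + m)) with ((u n - l) + (v n - m)) by ring.
    apply Cmod_triangle.
  - replace (Finite 0) with (Finite (0 + 0)) by (f_equal; ring).
    apply is_lim_seq_plus'; assumption.
Qed.

Lemma clim_mult (u v : nat -> C) (l m : C) :
  clim u l -> clim v m -> clim (fun n => u n * v n) (l * m).
Proof.
  intros Hu Hv.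
  apply clim_squeeze with (fun n => Cmod (u n - l) * Cmod (v n - m)
     + (Cmod l * Cmod (v n - m) + Cmod m * Cmod (u n - l)))%R.
  - intros n.
    replace (u n * v n - l * m)
      with ((u n - l) * (v n - m) + (l * (v n - m) + m * (u n - l))) by ring.
    eapply Rle_trans; [apply Cmod_triangle|].
    rewrite Cmod_mult. apply Rplus_le_compat_l.
    eapply Rle_trans; [apply Cmod_triangle|].
    rewrite !Cmod_mult. apply Rle_refl.
  - replace (Finite 0) with (Finite (0 * 0 + (Cmod l * 0 + Cmod m * 0)))
      by (f_equal; ring).
    apply is_lim_seq_plus'; [apply is_lim_seq_mult'; assumption|].
    apply is_lim_seq_plus'; apply is_lim_seq_mult'; auto; apply is_lim_seq_const.
Qed.

Lemma clim_scal (c : C) (u : nat -> C) (l : C) :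
  clim u l -> clim (fun n => c * u n) (c * l).
Proof. intros H. apply clim_mult; [apply clim_const | exact H]. Qed.

Lemma clim_minus (u v : nat -> C) (l m : C) :
  clim u l -> clim v m -> clim (fun n => u n - v n) (l - m).
Proof.
  intros Hu Hv. replace (l - m) with (l + (-(1)) * m) by ring.
  apply clim_ext with (fun n => u n + (-(1)) * v n).
  - intros n; ring.
  - apply clim_plus; [exact Hu | apply clim_scal; exact Hv].
Qed.

Lemma Cmod_minus_sym (x y : C) : Cmod (x - y) = Cmod (y - x).
Proof. rewrite <- Cmod_opp. f_equal. ring. Qed.

Lemma Cmod_triangle_inv (x y : C) : (Rabs (Cmod x - Cmod y) <= Cmod (x - y))%R.
Proof.
  apply Rabs_le. split.
  - assert (H := Cmod_triangle (y - x) x). replace (y - x + x) with y in H by ring.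
    rewrite Cmod_minus_sym in H. lra.
  - assert (H := Cmod_triangle (x - y) y). replace (x - y + y) with x in H by ring. lra.
Qed.

Lemma clim_Cmod (u : nat -> C) (l : C) :
  clim u l -> is_lim_seq (fun n => Cmod (u n)) (Cmod l).
Proof.
  intros H.
  apply is_lim_seq_ext with (fun n => Cmod l + (Cmod (u n) - Cmod l))%R; [intros; ring|].
  replace (Finite (Cmod l)) with (Finite (Cmod l + 0)) by (f_equal; ring).
  apply is_lim_seq_plus'; [apply is_lim_seq_const|].
  apply is_lim_seq_abs_0.
  apply is_lim_seq_le_le with (u := fun _ => 0%R) (w := fun n => Cmod (u n - l)); auto.
  - intros n; split; [apply Rabs_pos | apply Cmod_triangle_inv].
  - apply is_lim_seq_const.
Qed.

Lemma clim_inv (u : nat -> C) (l : C) :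
  l <> 0 -> (forall n, u n <> 0) -> clim u l -> clim (fun n => / u n) (/ l).
Proof.
  intros Hl Hu H. unfold clim.
  assert (Hm : (Cmod l <> 0)%R) by (intros E; apply Hl, Cmod_eq_0, E).
  apply is_lim_seq_ext with (fun n => Cmod (u n - l) * / (Cmod (u n) * Cmod l))%R.
  - intros n. rewrite <- Cmod_mult, <- Cmod_inv, <- Cmod_mult.
    + rewrite <- (Cmod_opp (/ u n - / l)). f_equal. field. split; auto.
    + apply Cmult_neq_0; auto.
  - replace (Finite 0) with (Finite (0 * / (Cmod l * Cmod l))) by (f_equal; ring).
    apply is_lim_seq_mult'; [exact H|].
    apply is_lim_seq_inv with (l := Finite (Cmod l * Cmod l)).
    + apply is_lim_seq_mult'; [apply clim_Cmod; exact H | apply is_lim_seq_const].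
    + intros E. injection E. intros E'. apply Rmult_integral in E'. tauto.
Qed.

Lemma clim_le (u : nat -> C) (l : C) (M : R) :
  (forall n, Cmod (u n) <= M)%R -> clim u l -> (Cmod l <= M)%R.
Proof.
  intros H Hu. apply clim_Cmod in Hu.
  change (Rbar_le (Cmod l) M).
  eapply is_lim_seq_le with (v := fun _ => M); [exact H | exact Hu | apply is_lim_seq_const].
Qed.

Lemma clim_unique (u : nat -> C) (l m : C) : clim u l -> clim u m -> l = m.
Proof.
  intros Hl Hm.
  assert (H := clim_minus _ _ _ _ Hl Hm).
  assert (E : Cmod (l - m) = 0%R).
  { apply Rle_antisym; [|apply Cmod_ge_0].
    apply clim_le with (2 := H). intros n.
    replace (u n - u n) with (RtoC 0) by ring. rewrite Cmod_0. lra. }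
  apply Cmod_eq_0 in E. replace l with (l - m + m) by ring. rewrite E. ring.
Qed.

Lemma clim_shift (u : nat -> C) (l : C) : clim u l <-> clim (fun n => u (S n)) l.
Proof.
  split; intros H; unfold clim in *.
  - apply (is_lim_seq_incr_1 (fun n => Cmod (u n - l))). exact H.
  - apply (is_lim_seq_incr_1 (fun n => Cmod (u n - l))). exact H.
Qed.

Lemma clim_shift_n (u : nat -> C) (l : C) (N : nat) :
  clim (fun n => u (n + N)%nat) l -> clim u l.
Proof.
  intros H. unfold clim in *.
  apply (is_lim_seq_incr_n (fun n => Cmod (u n - l)) N). exact H.
Qed.

Lemma im_le_Cmod (z : C) : (Rabs (Im z) <= Cmod z)%R.
Proof. eapply Rle_trans; [|apply Rmax_Cmod]. apply Rmax_r. Qed.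

Lemma clim_parts (u : nat -> C) (l : C) :
  clim u l <-> is_lim_seq (fun n => Re (u n)) (Re l) /\ is_lim_seq (fun n => Im (u n)) (Im l).
Proof.
  assert (part : forall f : C -> R,
    (forall z, Rabs (f z) <= Cmod z)%R -> (forall x y : C, f (x - y) = (f x - f y)%R) ->
    clim u l -> is_lim_seq (fun n => f (u n)) (f l)).
  { intros f Hf Hm H.
    apply is_lim_seq_ext with (fun n => f l + f (u n - l)%C)%R; [intros; rewrite Hm; ring|].
    replace (Finite (f l)) with (Finite (f l + 0)) by (f_equal; ring).
    apply is_lim_seq_plus'; [apply is_lim_seq_const|].
    apply is_lim_seq_abs_0.
    apply is_lim_seq_le_le with (u := fun _ => 0%R) (w := fun n => Cmod (u n - l)); auto.
    - intros n; split; [apply Rabs_pos | apply Hf].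
    - apply is_lim_seq_const. }
  split.
  - intros H. split; apply part; auto.
    + intros; apply re_le_Cmod.
    + intros; apply im_le_Cmod.
  - intros [H1 H2].
    apply clim_squeeze with (fun n => Rabs (Re (u n) - Re l) + Rabs (Im (u n) - Im l))%R.
    + intros n. set (z := u n - l).
      replace (Re (u n) - Re l)%R with (Re z) by reflexivity.
      replace (Im (u n) - Im l)%R with (Im z) by reflexivity.
      replace z with (RtoC (Re z) + Ci * RtoC (Im z)) at 1
        by (destruct z; unfold Ci, Cmult, Cplus, RtoC; simpl; f_equal; ring).
      eapply Rle_trans; [apply Cmod_triangle|].
      rewrite Cmod_mult, Cmod_Ci, !Cmod_R. lra.
    + replace (Finite 0) with (Finite (0 + 0)) by (f_equal; ring).
      apply is_lim_seq_plus'.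
      * apply -> is_lim_seq_abs_0. apply is_lim_seq_ext with (fun n => Re (u n) + - Re l)%R.
        { intros; ring. }
        replace (Finite 0) with (Finite (Re l + - Re l)) by (f_equal; ring).
        apply is_lim_seq_plus'; [exact H1 | apply is_lim_seq_const].
      * apply -> is_lim_seq_abs_0. apply is_lim_seq_ext with (fun n => Im (u n) + - Im l)%R.
        { intros; ring. }
        replace (Finite 0) with (Finite (Im l + - Im l)) by (f_equal; ring).
        apply is_lim_seq_plus'; [exact H2 | apply is_lim_seq_const].
Qed.

Lemma Cseq_lim_eq (u : nat -> C) (l : C) : clim u l -> Cseq_lim u = l.
Proof.
  intros H. apply clim_parts in H. destruct H as [H1 H2].
  unfold Cseq_lim. rewrite (is_lim_seq_unique _ _ H1), (is_lim_seq_unique _ _ H2).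
  destruct l; reflexivity.
Qed.

Lemma psum_parts (u : nat -> C) (n : nat) :
  psum u (S n) = (sum_n (fun k => Re (u k)) n, sum_n (fun k => Im (u k)) n).
Proof.
  induction n as [|n IH].
  - rewrite !sum_O. simpl. rewrite Cplus_0_l. destruct (u O); reflexivity.
  - change (psum u (S (S n))) with (psum u (S n) + u (S n)).
    rewrite IH, !sum_Sn. reflexivity.
Qed.

Lemma csum_parts (u : nat -> C) (l : C) :
  csum u l <-> is_series (fun n => Re (u n)) (Re l) /\ is_series (fun n => Im (u n)) (Im l).
Proof.
  unfold csum. rewrite clim_shift, clim_parts. unfold is_series.
  split; intros [H1 H2]; split.
  - apply is_lim_seq_ext with (2 := H1). intros n. rewrite psum_parts. reflexivity.
  - apply is_lim_seq_ext with (2 := H2). intros n. rewrite psum_parts. reflexivity.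
  - apply is_lim_seq_ext with (sum_n (fun k => Re (u k))); [|exact H1].
    intros n. rewrite psum_parts. reflexivity.
  - apply is_lim_seq_ext with (sum_n (fun k => Im (u k))); [|exact H2].
    intros n. rewrite psum_parts. reflexivity.
Qed.

Lemma Cseries_eq (u : nat -> C) (l : C) : csum u l -> Cseries u = l.
Proof.
  intros H. apply csum_parts in H. destruct H as [H1 H2].
  unfold Cseries. rewrite (is_series_unique _ _ H1), (is_series_unique _ _ H2).
  destruct l; reflexivity.
Qed.

Lemma psum_ext (u v : nat -> C) (n : nat) :
  (forall k, (k < n)%nat -> u k = v k) -> psum u n = psum v n.
Proof.
  induction n as [|n IH]; intros H; simpl; [reflexivity|].
  rewrite IH, (H n); auto.
Qed.

Lemma csum_ext (u v : nat -> C) (l : C) :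
  (forall n, u n = v n) -> csum u l -> csum v l.
Proof. intros H. apply clim_ext. intros n. apply psum_ext. auto. Qed.

Lemma Cseries_ext (u v : nat -> C) : (forall n, u n = v n) -> Cseries u = Cseries v.
Proof.
  intros H. unfold Cseries. f_equal; apply Series_ext; intros n; rewrite H; reflexivity.
Qed.

Lemma psum_plus (u v : nat -> C) (n : nat) :
  psum (fun k => u k + v k) n = psum u n + psum v n.
Proof. induction n as [|n IH]; simpl; [|rewrite IH]; ring. Qed.

Lemma psum_scal (c : C) (u : nat -> C) (n : nat) :
  psum (fun k => c * u k) n = c * psum u n.
Proof. induction n as [|n IH]; simpl; [|rewrite IH]; ring. Qed.

Lemma csum_plus (u v : nat -> C) (l m : C) :
  csum u l -> csum v m -> csum (fun k => u k + v k) (l + m).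
Proof.
  intros Hu Hv. apply clim_ext with (fun n => psum u n + psum v n).
  - intros; rewrite psum_plus; reflexivity.
  - apply clim_plus; assumption.
Qed.

Lemma csum_scal (c : C) (u : nat -> C) (l : C) :
  csum u l -> csum (fun k => c * u k) (c * l).
Proof.
  intros H. apply clim_ext with (fun n => c * psum u n).
  - intros; rewrite psum_scal; reflexivity.
  - apply clim_scal, H.
Qed.

(** Every series below carries a factor [q^k], so geometric majorants suffice. *)
Definition dominated (M : R) (u : nat -> C) : Prop :=
  forall k, (Cmod (u k) <= M * q ^ k)%R.

Lemma q_pow_pos (n : nat) : (0 < q ^ n)%R.
Proof. apply pow_lt, hq. Qed.

Lemma q_pow_le_1 (n : nat) : (q ^ n <= 1)%R.
Proof. rewrite <- (pow1 n). apply pow_incr. destruct hq; lra. Qed.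

Lemma q_pow_lim (M : R) : is_lim_seq (fun n => M * q ^ n)%R 0%R.
Proof.
  replace (Finite 0) with (Finite (M * 0)) by (f_equal; ring).
  apply is_lim_seq_mult'; [apply is_lim_seq_const|].
  apply is_lim_seq_geom. destruct hq. rewrite Rabs_pos_eq; lra.
Qed.

Lemma dominated_csum (M : R) (u : nat -> C) : dominated M u -> csum u (Cseries u).
Proof.
  intros H. apply csum_parts. unfold Cseries. simpl.
  assert (G : ex_series (fun k => M * q ^ k)%R).
  { apply (ex_series_scal (V := R_NormedModule) M (fun k => q ^ k)%R).
    apply ex_series_geom. destruct hq. rewrite Rabs_pos_eq; lra. }
  split; apply Series_correct; apply @ex_series_le with (2 := G); intros n.
  - eapply Rle_trans; [apply re_le_Cmod | apply H].
  - eapply Rle_trans; [apply im_le_Cmod | apply H].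
Qed.

Lemma dominated_psum_tail (M : R) (u : nat -> C) (N n : nat) :
  dominated M u -> (0 <= M)%R ->
  (Cmod (psum u (N + n) - psum u N) <= M * q ^ N / (1 - q))%R.
Proof.
  intros H HM. destruct hq as [h0 h1].
  assert (B : (Cmod (psum u (N + n) - psum u N) <= M * q ^ N * (1 - q ^ n) / (1 - q))%R).
  { induction n as [|n IH].
    - rewrite Nat.add_0_r. replace (psum u N - psum u N) with (RtoC 0) by ring.
      rewrite Cmod_0. simpl. apply Req_le. field. lra.
    - rewrite Nat.add_succ_r. simpl psum.
      replace (psum u (N + n) + u (N + n)%nat - psum u N)
        with ((psum u (N + n) - psum u N) + u (N + n)%nat) by ring.
      eapply Rle_trans; [apply Cmod_triangle|].
      eapply Rle_trans; [apply Rplus_le_compat; [exact IH | apply H]|].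
      rewrite pow_add. apply Req_le. simpl. field. lra. }
  eapply Rle_trans; [exact B|].
  unfold Rdiv. apply Rmult_le_compat_r; [left; apply Rinv_0_lt_compat; lra|].
  rewrite <- (Rmult_1_r (M * q ^ N)) at 2.
  apply Rmult_le_compat_l; [apply Rmult_le_pos; [lra | left; apply q_pow_pos]|].
  assert (P := q_pow_pos n). lra.
Qed.

Lemma dominated_nonneg (M : R) (u : nat -> C) : dominated M u -> (0 <= M)%R.
Proof.
  intros H. specialize (H O). simpl in H. assert (P := Cmod_ge_0 (u O)). lra.
Qed.

Lemma dominated_tail (M : R) (u : nat -> C) (N : nat) :
  dominated M u -> (Cmod (Cseries u - psum u N) <= M * q ^ N / (1 - q))%R.
Proof.
  intros H.
  apply clim_le with (fun n => psum u (n + N) - psum u N).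
  - intros n. rewrite Nat.add_comm. apply dominated_psum_tail; auto.
    apply dominated_nonneg with u; auto.
  - apply clim_minus; [|apply clim_const].
    assert (S := dominated_csum M u H). unfold csum, clim in *.
    apply (is_lim_seq_incr_n (fun n => Cmod (psum u n - Cseries u)) N). exact S.
Qed.

Lemma Cseries_bound (M : R) (u : nat -> C) :
  dominated M u -> (Cmod (Cseries u) <= M / (1 - q))%R.
Proof.
  intros H. assert (T := dominated_tail M u O H). simpl in T.
  replace (Cseries u) with (Cseries u - 0) by ring.
  rewrite Rmult_1_r in T. exact T.
Qed.

Lemma clim_psum (u : nat -> nat -> C) (v : nat -> C) (N : nat) :
  (forall k, clim (fun n => u n k) (v k)) -> clim (fun n => psum (u n) N) (psum v N).
Proof.
  intros H. induction N as [|N IH]; simpl; [apply clim_const|].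
  apply clim_plus; auto.
Qed.

(** Tannery's theorem. *)
Lemma Cseries_clim (M : R) (u : nat -> nat -> C) (v : nat -> C) :
  (forall n, dominated M (u n)) -> (forall k, clim (fun n => u n k) (v k)) ->
  clim (fun n => Cseries (u n)) (Cseries v).
Proof.
  intros Hd Hc.
  assert (Hv : dominated M v).
  { intros k. apply clim_le with (2 := Hc k). intros n; apply Hd. }
  destruct hq as [h0 h1].
  unfold clim. apply is_lim_seq_spec. intros eps. simpl.
  assert (T := q_pow_lim (M / (1 - q))). apply is_lim_seq_spec in T.
  assert (e3 : (0 < eps / 3)%R) by (destruct eps; simpl; lra).
  destruct (T (mkposreal _ e3)) as [N HN]. specialize (HN N (Nat.le_refl N)). simpl in HN.
  assert (P := clim_psum u v N Hc). unfold clim in P. apply is_lim_seq_spec in P.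
  destruct (P (mkposreal _ e3)) as [N' HN']. simpl in HN'.
  exists N'. intros n Hn. specialize (HN' n Hn).
  rewrite Rminus_0_r in *. rewrite Rabs_pos_eq in * by apply Cmod_ge_0.
  assert (A1 := dominated_tail M (u n) N (Hd n)).
  assert (A2 := dominated_tail M v N Hv).
  rewrite Rabs_pos_eq in HN.
  2:{ apply Rmult_le_pos; [|left; apply q_pow_pos].
      apply Rmult_le_pos; [apply (dominated_nonneg M v Hv)|].
      left; apply Rinv_0_lt_compat; lra. }
  replace (M / (1 - q) * q ^ N)%R with (M * q ^ N / (1 - q))%R in HN by (field; lra).
  replace (Cseries (u n) - Cseries v)
    with ((Cseries (u n) - psum (u n) N) + ((psum (u n) N - psum v N) + - (Cseries v - psum v N)))
    by ring.
  eapply Rle_lt_trans; [apply Cmod_triangle|].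
  eapply Rle_lt_trans; [apply Rplus_le_compat_l, Cmod_triangle|].
  rewrite Cmod_opp. lra.
Qed.

Lemma Cseries_scal (M : R) (c : C) (u : nat -> C) :
  dominated M u -> Cseries (fun k => c * u k) = c * Cseries u.
Proof. intros Hu. apply Cseries_eq, csum_scal, dominated_csum with M, Hu. Qed.

Lemma dominated_scal (M K : R) (c : C) (u : nat -> C) :
  (Cmod c <= K)%R -> dominated M u -> dominated (K * M) (fun k => c * u k).
Proof.
  intros Hc Hu k. rewrite Cmod_mult, Rmult_assoc.
  apply Rmult_le_compat; auto using Cmod_ge_0.
Qed.

Lemma psum_Cseries (M : R) (u : nat -> nat -> C) (N : nat) :
  (forall j, dominated M (u j)) ->
  csum (fun k => psum (fun j => u j k) N) (psum (fun j => Cseries (u j)) N).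
Proof.
  intros H. induction N as [|N IH]; simpl.
  - apply clim_ext with (fun _ => 0); [|apply clim_const].
    intros n. induction n as [|n IHn]; simpl; [|rewrite <- IHn]; ring.
  - apply (csum_plus _ _ _ _ IH). apply dominated_csum with M, H.
Qed.

(** Interchange of summations: Tannery's theorem applied to the partial sums
    of the outer series. *)
Lemma csum_swap (M : R) (u : nat -> nat -> C) :
  (forall j k, (Cmod (u j k) <= M * q ^ j * q ^ k)%R) ->
  exists l, csum (fun j => Cseries (u j)) l /\ csum (fun k => Cseries (fun j => u j k)) l.
Proof.
  intros H. destruct hq as [h0 h1].
  assert (HM : (0 <= M)%R).
  { specialize (H O O). simpl in H. assert (P := Cmod_ge_0 (u O O)). lra. }
  assert (Hj : forall j, dominated (M * q ^ j) (u j)) by (intros j k; apply H).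
  assert (Hj' : forall j, dominated M (u j)).
  { intros j k. eapply Rle_trans; [apply H|].
    apply Rmult_le_compat_r; [left; apply q_pow_pos|].
    rewrite <- (Rmult_1_r M) at 2. apply Rmult_le_compat_l; [exact HM | apply q_pow_le_1]. }
  assert (Hk : forall k, dominated (M * q ^ k) (fun j => u j k)).
  { intros k j. specialize (H j k). lra. }
  exists (Cseries (fun k => Cseries (fun j => u j k))). split.
  - apply clim_ext with (fun N => Cseries (fun k => psum (fun j => u j k) N)).
    { intros N. apply Cseries_eq, psum_Cseries with M, Hj'. }
    apply Cseries_clim with (M / (1 - q))%R.
    + intros N k.
      assert (T := dominated_psum_tail _ _ O N (Hk k)). simpl in T.
      replace (psum (fun j => u j k) N - 0) with (psum (fun j => u j k) N) in T by ring.
      eapply Rle_trans; [apply T|].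
      * apply Rmult_le_pos; [exact HM | left; apply q_pow_pos].
      * apply Req_le. field. lra.
    + intros k. apply dominated_csum with (M * q ^ k)%R. apply Hk.
  - apply dominated_csum with (M / (1 - q))%R. intros k.
    eapply Rle_trans; [apply (Cseries_bound _ _ (Hk k))|]. apply Req_le. field. lra.
Qed.

(** * q-shifted factorials *)

Lemma Cmod_q_pow (n : nat) : Cmod (q ^ n) = (q ^ n)%R.
Proof. rewrite Cmod_pow, Cmod_R, Rabs_pos_eq; [reflexivity|]. destruct hq; lra. Qed.

Lemma q_neq_0 : RtoC q <> 0.
Proof. intros H. apply RtoC_inj in H. destruct hq; lra. Qed.

Lemma q_pow_neq_0 (n : nat) : q ^ n <> 0.
Proof. apply Cpow_nz, q_neq_0. Qed.

Lemma Cmod_mult_q_pow (a : C) (n : nat) : Cmod (a * q ^ n) = (Cmod a * q ^ n)%R.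
Proof. rewrite Cmod_mult, Cmod_q_pow. reflexivity. Qed.

Lemma Cmod_mult_q_pow_le (a : C) (n : nat) : (Cmod (a * q ^ n) <= Cmod a)%R.
Proof.
  rewrite Cmod_mult_q_pow. rewrite <- (Rmult_1_r (Cmod a)) at 2.
  apply Rmult_le_compat_l; [apply Cmod_ge_0 | apply q_pow_le_1].
Qed.

(** An upper bound of [(-r; q)_oo]. *)
Definition poch_bound (r : R) : R := exp (r / (1 - q)).

Lemma poch_bound_ge_1 (r : R) : (0 <= r)%R -> (1 <= poch_bound r)%R.
Proof.
  intros Hr. unfold poch_bound. destruct hq.
  assert (0 <= r / (1 - q))%R
    by (apply Rmult_le_pos; [lra | left; apply Rinv_0_lt_compat; lra]).
  assert (P := exp_ineq1_le (r / (1 - q))). lra.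
Qed.

(** [(-r; q)_n], as a real number. *)
Fixpoint qpoch_major (r : R) (n : nat) : R :=
  match n with O => 1%R | S k => (qpoch_major r k * (1 + r * q ^ k))%R end.

Lemma qpoch_major_ge_1 (r : R) (n : nat) : (0 <= r)%R -> (1 <= qpoch_major r n)%R.
Proof.
  intros Hr. induction n as [|n IH]; simpl; [lra|].
  assert (P := q_pow_pos n).
  assert (0 <= r * q ^ n)%R by (apply Rmult_le_pos; lra).
  apply Rle_trans with (1 * 1)%R; [lra|]. apply Rmult_le_compat; lra.
Qed.

Lemma qpoch_major_le (r : R) (n : nat) :
  (0 <= r)%R -> (qpoch_major r n <= poch_bound r)%R.
Proof.
  intros Hr. destruct hq as [h0 h1].
  assert (B : (qpoch_major r n <= exp (r * (1 - q ^ n) / (1 - q)))%R).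
  { induction n as [|n IH].
    - simpl. replace (r * (1 - 1) / (1 - q))%R with 0%R by (field; lra).
      rewrite exp_0. lra.
    - simpl. assert (P := q_pow_pos n).
      assert (0 <= r * q ^ n)%R by (apply Rmult_le_pos; lra).
      replace (r * (1 - q * q ^ n) / (1 - q))%R
        with (r * (1 - q ^ n) / (1 - q) + r * q ^ n)%R by (field; lra).
      rewrite exp_plus. apply Rmult_le_compat; try lra.
      + assert (G := qpoch_major_ge_1 r n Hr). lra.
      + apply exp_ineq1_le. }
  eapply Rle_trans; [exact B|]. unfold poch_bound.
  assert (P := q_pow_pos n).
  assert (I : (r * (1 - q ^ n) / (1 - q) <= r / (1 - q))%R).
  { unfold Rdiv. apply Rmult_le_compat_r; [left; apply Rinv_0_lt_compat; lra|].
    rewrite <- (Rmult_1_r r) at 2. apply Rmult_le_compat_l; lra. }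
  destruct I as [I|I]; [left; apply exp_increasing, I | rewrite I; right; reflexivity].
Qed.

Lemma Cmod_qpoch_major (a : C) (r : R) (n : nat) :
  (Cmod a <= r)%R -> (Cmod (qpoch a q n) <= qpoch_major r n)%R.
Proof.
  intros Ha. induction n as [|n IH]; simpl; [rewrite Cmod_1; lra|].
  rewrite Cmod_mult. apply Rmult_le_compat; auto using Cmod_ge_0.
  eapply Rle_trans; [apply Cmod_triangle|].
  rewrite Cmod_1, Cmod_opp, Cmod_mult_q_pow.
  apply Rplus_le_compat_l, Rmult_le_compat_r; [left; apply q_pow_pos | exact Ha].
Qed.

Lemma Cmod_qpoch (a : C) (r : R) (n : nat) :
  (Cmod a <= r)%R -> (Cmod (qpoch a q n) <= poch_bound r)%R.
Proof.
  intros Ha. eapply Rle_trans; [apply Cmod_qpoch_major, Ha|].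
  apply qpoch_major_le. assert (P := Cmod_ge_0 a). lra.
Qed.

Lemma qpoch_lim (a : C) : clim (qpoch a q) (qpoch_inf a q).
Proof.
  set (u := fun k : nat => - a * qpoch a q k * q ^ k).
  assert (E : forall n, 1 + psum u n = qpoch a q n).
  { induction n as [|n IH]; simpl; [ring|]. rewrite <- IH. unfold u at 2. rewrite <- IH. ring. }
  assert (D : dominated (Cmod a * poch_bound (Cmod a)) u).
  { intros k. unfold u. rewrite Cmod_mult_q_pow, Cmod_mult, Cmod_opp.
    apply Rmult_le_compat_r; [left; apply q_pow_pos|].
    apply Rmult_le_compat_l; [apply Cmod_ge_0 | apply Cmod_qpoch, Rle_refl]. }
  assert (L : clim (qpoch a q) (1 + Cseries u)).
  { apply clim_ext with (fun n => 1 + psum u n); [exact E|].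
    apply clim_plus; [apply clim_const | apply dominated_csum with (1 := D)]. }
  unfold qpoch_inf. rewrite (Cseq_lim_eq _ _ L). exact L.
Qed.

Lemma Cmod_qpoch_inf (a : C) (r : R) :
  (Cmod a <= r)%R -> (Cmod (qpoch_inf a q) <= poch_bound r)%R.
Proof.
  intros Ha. apply clim_le with (2 := qpoch_lim a). intros n. apply Cmod_qpoch, Ha.
Qed.

Lemma qpoch_add (a : C) (m n : nat) :
  qpoch a q (m + n) = qpoch a q m * qpoch (a * q ^ m) q n.
Proof.
  induction n as [|n IH].
  - rewrite Nat.add_0_r. simpl. ring.
  - rewrite Nat.add_succ_r. simpl. rewrite IH, Cpow_add_r. ring.
Qed.

Lemma qpoch_succ_l (a : C) (n : nat) : qpoch a q (S n) = (1 - a) * qpoch (a * q) q n.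
Proof.
  change (S n) with (1 + n)%nat. rewrite qpoch_add. simpl.
  replace (a * (q * 1)) with (a * q) by ring. ring.
Qed.

Lemma qpoch_inf_split (a : C) (n : nat) :
  qpoch_inf a q = qpoch a q n * qpoch_inf (a * q ^ n) q.
Proof.
  apply clim_unique with (qpoch a q); [apply qpoch_lim|].
  apply clim_shift_n with n.
  apply clim_ext with (fun m => qpoch a q n * qpoch (a * q ^ n) q m).
  - intros m. rewrite Nat.add_comm, qpoch_add. reflexivity.
  - apply clim_scal, qpoch_lim.
Qed.

Lemma qpoch_inf_step (a : C) : qpoch_inf a q = (1 - a) * qpoch_inf (a * q) q.
Proof.
  rewrite (qpoch_inf_split a 1). simpl.
  replace (a * (q * 1)) with (a * q) by ring. ring.
Qed.

Lemma qpoch_0 (n : nat) : qpoch 0 q n = 1.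
Proof. induction n as [|n IH]; simpl; [|rewrite IH]; ring. Qed.

Lemma qpoch_inf_0 : qpoch_inf 0 q = 1.
Proof.
  apply clim_unique with (qpoch 0 q); [apply qpoch_lim|].
  apply clim_ext with (fun _ => 1); [intros; rewrite qpoch_0; reflexivity | apply clim_const].
Qed.

Lemma qpoch_inf_1 : qpoch_inf 1 q = 0.
Proof. rewrite qpoch_inf_step. ring. Qed.

Lemma qpoch_1 (n : nat) : qpoch 1 q (S n) = 0.
Proof. rewrite qpoch_succ_l. ring. Qed.

Definition poch_lipschitz (r : R) : R := (poch_bound r * poch_bound r / (1 - q))%R.

Lemma poch_lipschitz_pos (r : R) : (0 < poch_lipschitz r)%R.
Proof.
  unfold poch_lipschitz, poch_bound. destruct hq.
  apply Rmult_lt_0_compat; [|apply Rinv_0_lt_compat; lra].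
  apply Rmult_lt_0_compat; apply exp_pos.
Qed.

(** The Lipschitz constant does not depend on [n], so it serves for the infinite
    product too. *)
Lemma qpoch_lipschitz (a b : C) (r : R) (n : nat) :
  (Cmod a <= r)%R -> (Cmod b <= r)%R ->
  (Cmod (qpoch a q n - qpoch b q n) <= poch_lipschitz r * Cmod (a - b))%R.
Proof.
  intros Ha Hb. destruct hq as [h0 h1].
  assert (Hr : (0 <= r)%R) by (assert (P := Cmod_ge_0 a); lra).
  assert (B : (Cmod (qpoch a q n - qpoch b q n)
     <= Cmod (a - b) * poch_bound r * ((1 - q ^ n) / (1 - q)) * qpoch_major r n)%R).
  { induction n as [|n IH].
    - simpl. replace (1 - 1) with (RtoC 0) by ring. rewrite Cmod_0.
      right. field. lra.
    - simpl qpoch.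
      replace (qpoch a q n * (1 - a * q ^ n) - qpoch b q n * (1 - b * q ^ n))
        with ((qpoch a q n - qpoch b q n) * (1 - a * q ^ n)
              + - (qpoch b q n * ((a - b) * q ^ n))) by ring.
      eapply Rle_trans; [apply Cmod_triangle|].
      rewrite Cmod_opp, !Cmod_mult, Cmod_q_pow.
      assert (B1 : (Cmod (1 - a * q ^ n) <= 1 + r * q ^ n)%R).
      { eapply Rle_trans; [apply Cmod_triangle|].
        rewrite Cmod_1, Cmod_opp, Cmod_mult_q_pow.
        apply Rplus_le_compat_l, Rmult_le_compat_r; [left; apply q_pow_pos | exact Ha]. }
      assert (P := q_pow_pos n).
      assert (G := qpoch_major_ge_1 r (S n) Hr).
      set (D := Cmod (a - b)) in *.
      assert (HD : (0 <= D)%R) by apply Cmod_ge_0.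
      assert (Eb := Cmod_qpoch b r n Hb).
      assert (E1 := poch_bound_ge_1 r Hr).
      replace (D * poch_bound r * ((1 - q ^ S n) / (1 - q)) * qpoch_major r (S n))%R
        with (D * poch_bound r * ((1 - q ^ n) / (1 - q)) * qpoch_major r n * (1 + r * q ^ n)
              + D * poch_bound r * q ^ n * qpoch_major r (S n))%R
        by (simpl; field; lra).
      apply Rplus_le_compat.
      + apply Rmult_le_compat; auto using Cmod_ge_0.
      + apply Rle_trans with (D * poch_bound r * q ^ n * 1)%R.
        * apply Rle_trans with (poch_bound r * (D * q ^ n))%R; [|right; ring].
          apply Rmult_le_compat_r; [apply Rmult_le_pos; lra | exact Eb].
        * apply Rmult_le_compat_l; [|exact G].
          apply Rmult_le_pos; [apply Rmult_le_pos|]; lra. }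
  eapply Rle_trans; [exact B|].
  unfold poch_lipschitz.
  assert (HD : (0 <= Cmod (a - b))%R) by apply Cmod_ge_0.
  assert (E1 := poch_bound_ge_1 r Hr).
  assert (G := qpoch_major_ge_1 r n Hr). assert (G' := qpoch_major_le r n Hr).
  assert (P := q_pow_pos n). assert (P' := q_pow_le_1 n).
  apply Rle_trans with (Cmod (a - b) * poch_bound r * (1 / (1 - q)) * poch_bound r)%R.
  - apply Rmult_le_compat; [| lra | | lra].
    + apply Rmult_le_pos; [apply Rmult_le_pos; lra|].
      apply Rmult_le_pos; [lra | left; apply Rinv_0_lt_compat; lra].
    + apply Rmult_le_compat_l; [apply Rmult_le_pos; lra|].
      apply Rmult_le_compat_r; [left; apply Rinv_0_lt_compat; lra | lra].
  - right. field. lra.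
Qed.

Lemma qpoch_inf_lipschitz (a b : C) (r : R) :
  (Cmod a <= r)%R -> (Cmod b <= r)%R ->
  (Cmod (qpoch_inf a q - qpoch_inf b q) <= poch_lipschitz r * Cmod (a - b))%R.
Proof.
  intros Ha Hb.
  apply clim_le with (fun n => qpoch a q n - qpoch b q n).
  - intros n. apply qpoch_lipschitz; assumption.
  - apply clim_minus; apply qpoch_lim.
Qed.

Lemma qpoch_inf_near_1 (a : C) (r : R) :
  (Cmod a <= r)%R -> (Cmod (qpoch_inf a q - 1) <= poch_lipschitz r * Cmod a)%R.
Proof.
  intros Ha. rewrite <- qpoch_inf_0.
  replace (Cmod a) with (Cmod (a - 0)) by (f_equal; ring).
  apply qpoch_inf_lipschitz; [exact Ha|]. rewrite Cmod_0.
  assert (P := Cmod_ge_0 a). lra.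
Qed.

Lemma clim_bounded (u : nat -> C) (l : C) :
  clim u l -> exists N, forall n, (Cmod (u (n + N)%nat) <= Cmod l + 1)%R.
Proof.
  intros H. apply clim_Cmod in H. apply is_lim_seq_spec in H.
  destruct (H (mkposreal 1 Rlt_0_1)) as [N HN]. exists N. intros n.
  assert (A := HN (n + N)%nat ltac:(lia)). simpl in A. apply Rabs_def2 in A. lra.
Qed.

Lemma clim_shift_n_conv (u : nat -> C) (l : C) (N : nat) :
  clim u l -> clim (fun n => u (n + N)%nat) l.
Proof.
  intros H. unfold clim in *.
  apply (is_lim_seq_incr_n (fun n => Cmod (u n - l)) N). exact H.
Qed.

Lemma qpoch_inf_clim (u : nat -> C) (l : C) :
  clim u l -> clim (fun n => qpoch_inf (u n) q) (qpoch_inf l q).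
Proof.
  intros H. destruct (clim_bounded u l H) as [N HN].
  apply clim_shift_n with N.
  apply clim_squeeze with (fun n => poch_lipschitz (Cmod l + 1) * Cmod (u (n + N)%nat - l))%R.
  - intros n. apply qpoch_inf_lipschitz; [apply HN | lra].
  - replace (Finite 0) with (Finite (poch_lipschitz (Cmod l + 1) * 0)) by (f_equal; ring).
    apply is_lim_seq_mult'; [apply is_lim_seq_const|].
    apply (clim_shift_n_conv u l N H).
Qed.

Lemma qpoch_clim (u : nat -> C) (l : C) (k : nat) :
  clim u l -> clim (fun n => qpoch (u n) q k) (qpoch l q k).
Proof.
  intros H. induction k as [|k IH]; simpl; [apply clim_const|].
  apply clim_mult; [exact IH|].
  apply clim_minus; [apply clim_const|].
  apply clim_mult; [exact H | apply clim_const].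
Qed.

Lemma q_pow_clim (c : C) : clim (fun n => c * q ^ n) 0.
Proof.
  apply clim_squeeze with (fun n => Cmod c * q ^ n)%R; [|apply q_pow_lim].
  intros n. replace (c * q ^ n - 0) with (c * q ^ n) by ring.
  rewrite Cmod_mult_q_pow. lra.
Qed.

(** No factor of [(x; q)_oo] vanishes. *)
Definition regular (x : C) : Prop := forall k : nat, x * q ^ k <> 1.

Lemma regular_small (x : C) : (Cmod x < 1)%R -> regular x.
Proof.
  intros H k E. assert (B := Cmod_mult_q_pow_le x k). rewrite E, Cmod_1 in B. lra.
Qed.

Lemma qpoch_neq_0 (x : C) (n : nat) : regular x -> qpoch x q n <> 0.
Proof.
  intros H. induction n as [|n IH]; simpl; [apply C1_nz|].
  apply Cmult_neq_0; [exact IH|].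
  intros E. apply (H n). symmetry. apply Ceq_minus. exact E.
Qed.

(** The tail [(x q^N; q)_oo] is at distance less than [1] from [1] for large [N]. *)
Lemma qpoch_inf_neq_0 (x : C) : regular x -> qpoch_inf x q <> 0.
Proof.
  intros H.
  assert (L := q_pow_lim (poch_lipschitz (Cmod x) * Cmod x)).
  apply is_lim_seq_spec in L.
  destruct (L (mkposreal 1 Rlt_0_1)) as [N HN]. specialize (HN N (Nat.le_refl N)).
  simpl in HN. rewrite Rminus_0_r in HN. apply Rabs_def2 in HN.
  rewrite (qpoch_inf_split x N).
  apply Cmult_neq_0; [apply qpoch_neq_0, H|].
  intros E.
  assert (B := qpoch_inf_near_1 _ _ (Cmod_mult_q_pow_le x N)).
  rewrite E, Cmod_mult_q_pow in B.
  replace (0 - 1) with (- (1)) in B by ring. rewrite Cmod_m1 in B. lra.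
Qed.

(** The reciprocals converge, because the infinite product does not vanish. *)
Lemma qpoch_bounded_below (x : C) : regular x ->
  exists K, (0 < K)%R /\ forall n, (Cmod (/ qpoch x q n) <= K)%R.
Proof.
  intros H.
  assert (L : clim (fun n => / qpoch x q n) (/ qpoch_inf x q)).
  { apply clim_inv; [apply qpoch_inf_neq_0, H | intros; apply qpoch_neq_0, H | apply qpoch_lim]. }
  destruct (clim_bounded _ _ L) as [N HN].
  assert (F : exists K, (0 < K)%R /\ forall n, (n < N)%nat -> (Cmod (/ qpoch x q n) <= K)%R).
  { clear HN. induction N as [|N [K [HK IH]]]; [exists 1%R; split; [lra | intros; lia]|].
    exists (K + Cmod (/ qpoch x q N))%R.
    assert (P := Cmod_ge_0 (/ qpoch x q N)).
    split; [lra|]. intros n Hn.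
    destruct (Nat.eq_dec n N) as [->|Hne]; [lra|].
    assert (A := IH n ltac:(lia)). lra. }
  destruct F as [K [HK HF]].
  exists (K + (Cmod (/ qpoch_inf x q) + 1))%R.
  assert (P := Cmod_ge_0 (/ qpoch_inf x q)).
  split; [lra|]. intros n. destruct (Nat.lt_ge_cases n N) as [Hn|Hn].
  - assert (A := HF n Hn). lra.
  - assert (A := HN (n - N)%nat). replace (n - N + N)%nat with n in A by lia. lra.
Qed.

Lemma qpoch_inf_ge (x : C) (r : R) : (Cmod x <= r)%R -> (r < 1)%R ->
  (Cmod (qpoch_inf r q) <= Cmod (qpoch_inf x q))%R.
Proof.
  intros Hx Hr.
  assert (P0 := Cmod_ge_0 x).
  assert (G : forall n, (Cmod (qpoch r q n) <= Cmod (qpoch x q n))%R).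
  { induction n as [|n IH]; simpl; [apply Rle_refl|].
    rewrite !Cmod_mult. apply Rmult_le_compat; auto using Cmod_ge_0.
    rewrite <- RtoC_pow, <- RtoC_mult, <- RtoC_minus, Cmod_R.
    assert (P := q_pow_pos n). assert (P' := q_pow_le_1 n).
    assert (B : (r * q ^ n <= r)%R).
    { rewrite <- (Rmult_1_r r) at 2. apply Rmult_le_compat_l; lra. }
    rewrite Rabs_pos_eq by lra.
    assert (T := Cmod_triangle (1 - x * q ^ n) (x * q ^ n)).
    replace (1 - x * q ^ n + x * q ^ n) with (RtoC 1) in T by ring.
    rewrite Cmod_1, Cmod_mult_q_pow in T.
    assert (Cmod x * q ^ n <= r * q ^ n)%R by (apply Rmult_le_compat_r; lra). rewrite RtoC_pow. lra. }
  change (Rbar_le (Cmod (qpoch_inf r q)) (Cmod (qpoch_inf x q))).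
  apply is_lim_seq_le with (1 := G); apply clim_Cmod, qpoch_lim.
Qed.

Definition poch_inv_bound (r : R) : R := (/ Cmod (qpoch_inf r q))%R.

Lemma Cmod_real_lt_1 (r : R) : (0 <= r < 1)%R -> (Cmod r < 1)%R.
Proof. intros H. rewrite Cmod_R, Rabs_pos_eq; lra. Qed.

Lemma Cmod_inv_qpoch_inf (x : C) (r : R) : (Cmod x <= r)%R -> (r < 1)%R ->
  (Cmod (/ qpoch_inf x q) <= poch_inv_bound r)%R.
Proof.
  intros Hx Hr. assert (P0 := Cmod_ge_0 x).
  rewrite Cmod_inv.
  - apply Rinv_le_contravar; [|apply qpoch_inf_ge; assumption].
    apply Cmod_gt_0, qpoch_inf_neq_0, regular_small, Cmod_real_lt_1. lra.
  - apply qpoch_inf_neq_0, regular_small. lra.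
Qed.

(** * Boundedness bookkeeping *)

(** Boundedness over an arbitrary index type: the index is a summation index,
    a pair of them, or a summation index together with a point of the circle,
    so that the same closure rules give all the dominations needed below. *)
Definition bdd {I : Type} (u : I -> C) : Prop := exists M, forall i, (Cmod (u i) <= M)%R.

Lemma bdd_const {I : Type} (c : C) : bdd (fun _ : I => c).
Proof. exists (Cmod c). intros; apply Rle_refl. Qed.

Lemma bdd_mult {I : Type} (u v : I -> C) : bdd u -> bdd v -> bdd (fun i => u i * v i).
Proof.
  intros [M H] [N K]. exists (M * N)%R. intros i. rewrite Cmod_mult.
  apply Rmult_le_compat; auto using Cmod_ge_0.
Qed.

Lemma bdd_q_pow {I : Type} (n : I -> nat) : bdd (fun i => q ^ n i).
Proof. exists 1%R. intros i. rewrite Cmod_q_pow. apply q_pow_le_1. Qed.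

Lemma bdd_qpoch {I : Type} (x : I -> C) (n : I -> nat) :
  bdd x -> bdd (fun i => qpoch (x i) q (n i)).
Proof. intros [M H]. exists (poch_bound M). intros i. apply Cmod_qpoch, H. Qed.

Lemma bdd_qpoch_inf {I : Type} (x : I -> C) : bdd x -> bdd (fun i => qpoch_inf (x i) q).
Proof. intros [M H]. exists (poch_bound M). intros i. apply Cmod_qpoch_inf, H. Qed.

Lemma bdd_inv_qpoch {I : Type} (x : C) (n : I -> nat) :
  regular x -> bdd (fun i => / qpoch x q (n i)).
Proof.
  intros H. destruct (qpoch_bounded_below x H) as [K [_ HK]]. exists K. intros i; apply HK.
Qed.

Lemma bdd_dominated {I : Type} (u : I -> nat -> C) :
  bdd (fun p : I * nat => u (fst p) (snd p)) ->
  exists M, forall i, dominated M (fun k => u i k * q ^ k).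
Proof.
  intros [M H]. exists M. intros i k. rewrite Cmod_mult_q_pow.
  apply Rmult_le_compat_r; [left; apply q_pow_pos | apply (H (i, k))].
Qed.

Lemma bdd_dominated1 (u : nat -> C) :
  bdd u -> exists M, dominated M (fun k => u k * q ^ k).
Proof.
  intros [M H]. exists M. intros k. rewrite Cmod_mult_q_pow.
  apply Rmult_le_compat_r; [left; apply q_pow_pos | apply H].
Qed.

Lemma bdd_dominated2 (u : nat -> nat -> C) :
  bdd (fun p : nat * nat => u (fst p) (snd p)) ->
  exists M, forall j k, (Cmod (u j k * q ^ j * q ^ k) <= M * q ^ j * q ^ k)%R.
Proof.
  intros [M H]. exists M. intros j k. rewrite !Cmod_mult_q_pow.
  apply Rmult_le_compat_r; [left; apply q_pow_pos|].
  apply Rmult_le_compat_r; [left; apply q_pow_pos | apply (H (j, k))].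
Qed.

Lemma regular_mult_q (x : C) : regular x -> regular (x * q).
Proof. intros H k E. apply (H (S k)). rewrite <- E. simpl. ring. Qed.

Lemma regular_q : regular (RtoC q).
Proof. apply regular_small, Cmod_real_lt_1. destruct hq; lra. Qed.

Lemma Cmod_mult_lt_1 (x y : C) : (Cmod x < 1)%R -> (Cmod y < 1)%R -> (Cmod (x * y) < 1)%R.
Proof.
  intros Hx Hy. rewrite Cmod_mult.
  assert (Px := Cmod_ge_0 x). assert (Py := Cmod_ge_0 y). nra.
Qed.

Lemma regular_mult (x y : C) : (Cmod x < 1)%R -> (Cmod y < 1)%R -> regular (x * y).
Proof. intros Hx Hy. apply regular_small, Cmod_mult_lt_1; assumption. Qed.

Lemma regular_mult_div (x y : C) :
  (Cmod x < 1)%R -> (Cmod (q / y) < 1)%R -> regular (q * x / y).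
Proof.
  intros Hx Hy. replace (q * x / y) with (q / y * x) by (unfold Cdiv; ring).
  apply regular_mult; assumption.
Qed.

Lemma Cinv_neq_0 (x : C) : x <> 0 -> / x <> 0.
Proof. intros Hx E. apply C1_nz. rewrite <- (Cinv_r x Hx), E. ring. Qed.

Lemma q_div_neq_0 (d : C) : d <> 0 -> q / d <> 0.
Proof. intros Hd. apply Cmult_neq_0; [apply q_neq_0 | apply Cinv_neq_0, Hd]. Qed.

Ltac bdd := unfold Cdiv; repeat first
  [ assumption | apply bdd_const | apply bdd_mult 
  | apply bdd_q_pow | apply bdd_qpoch | apply bdd_qpoch_inf | apply bdd_inv_qpoch
  | apply regular_q | apply regular_mult_q ].

(** * The nonterminating q-Saalschuetz sum *)

(** Up to the factor [(1 - q) b (q, q b/a, a/b)_oo], the sum [saal] below is the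
    q-integral from [a] to [b] of
    [(q t/a, q t/b, a b d e f t)_oo / (d t, e t, f t)_oo], multiplied by the product
    [(a d, a e, a f, b d, b e, b f)_oo]. In this form it makes sense for all complex
    [d], [e], [f]. *)
Definition saal_coef (a b d e f : C) (k : nat) : C :=
  qpoch_inf (a * b * d * e * f * b * q ^ k) q
  * (qpoch (b * d) q k * qpoch (b * e) q k * qpoch (b * f) q k)
  * (/ qpoch q q k * / qpoch (b / a * q) q k).

Definition saal_sum (a b d e f : C) : C :=
  Cseries (fun k => saal_coef a b d e f k * q ^ k).

Definition saal_side (a b d e f : C) : C :=
  qpoch_inf (a * d) q * qpoch_inf (a * e) q * qpoch_inf (a * f) q / qpoch_inf (a / b) q
  * saal_sum a b d e f.

Definition saal (a b d e f : C) : C := saal_side a b d e f + saal_side b a d e f.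

Lemma saal_coef_bdd {I : Type} (a b e f : C) (d : I -> C) (n : I -> nat) :
  regular (b / a) -> bdd d -> bdd (fun i => saal_coef a b (d i) e f (n i)).
Proof.
  intros H Hd. unfold saal_coef.
  assert (H' := regular_mult_q _ H). bdd.
Qed.

(** The series telescopes: the right side is a primitive of the summand. *)
Lemma saal_psum (a b d e f : C) (n : nat) :
  a <> 0 -> regular (b / a) ->
  psum (fun k => (1 - a * b * d * f) * (1 - a * b * d * e)
                   * (saal_coef a b (d * q) e f k * q ^ k)
                 - (1 - a * d) * (saal_coef a b d e f k * q ^ k)) (S n)
  = a * d * qpoch (b * (d * q)) q n * qpoch (b * e) q (S n) * qpoch (b * f) q (S n)
    * qpoch_inf (a * b * d * e * f * b * q ^ (S n)) q
    / (qpoch q q n * qpoch (b / a * q) q n).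
Proof.
  intros Ha Hr.
  assert (Hq := regular_q).
  assert (H' := regular_mult_q _ Hr).
  induction n as [|n IH].
  - simpl. unfold saal_coef. simpl.
    rewrite (qpoch_inf_step (a * b * d * e * f * b * 1)).
    replace (a * b * (d * q) * e * f * b * 1) with (a * b * d * e * f * b * (q * 1)) by ring.
    replace (a * b * d * e * f * b * 1 * q) with (a * b * d * e * f * b * (q * 1)) by ring.
    field.
  - rewrite (psum_S _ (S n)), IH. clear IH.
    unfold saal_coef.
    set (Q := q ^ S n).
    assert (EQ : q ^ n * q = Q) by (unfold Q; simpl; ring).
    rewrite (qpoch_inf_step (a * b * d * e * f * b * Q)).
    replace (q ^ (S (S n))) with (Q * q) by (unfold Q; simpl; ring).
    replace (a * b * (d * q) * e * f * b * Q) with (a * b * d * e * f * b * (Q * q)) by ring.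
    replace (a * b * d * e * f * b * Q * q) with (a * b * d * e * f * b * (Q * q)) by ring.
    set (G := qpoch_inf (a * b * d * e * f * b * (Q * q)) q).
    rewrite (qpoch_succ_l (b * d) n).
    replace (b * d * q) with (b * (d * q)) by ring.
    change (qpoch (b * (d * q)) q (S n))
      with (qpoch (b * (d * q)) q n * (1 - b * (d * q) * q ^ n)).
    replace (b * (d * q) * q ^ n) with (b * d * Q) by (rewrite <- EQ; ring).
    change (qpoch q q (S n)) with (qpoch q q n * (1 - q * q ^ n)).
    replace (q * q ^ n) with Q by (rewrite <- EQ; ring).
    change (qpoch (b / a * q) q (S n))
      with (qpoch (b / a * q) q n * (1 - b / a * q * q ^ n)).
    replace (b / a * q * q ^ n) with (b / a * Q) by (rewrite <- EQ; ring).
    change (qpoch (b * e) q (S (S n))) with (qpoch (b * e) q (S n) * (1 - b * e * Q)).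
    change (qpoch (b * f) q (S (S n))) with (qpoch (b * f) q (S n) * (1 - b * f * Q)).
    assert (N1 := qpoch_neq_0 _ n Hq). assert (N2 := qpoch_neq_0 _ n H').
    assert (N3 : 1 - Q <> 0).
    { intros E. apply (Hq n). symmetry. apply Ceq_minus. rewrite <- E.
      unfold Q. simpl. ring. }
    assert (N4 : a - b * Q <> 0).
    { intros E. apply (Hr (S n)). fold Q.
      assert (E' : b * Q = a) by (symmetry; apply Ceq_minus; exact E).
      replace (b / a * Q) with (b * Q / a) by (field; exact Ha).
      rewrite E'. field. exact Ha. }
    field. repeat split; auto.
Qed.

Lemma saal_sum_step (a b d e f : C) :
  a <> 0 -> regular (b / a) ->
  (1 - a * b * d * f) * (1 - a * b * d * e) * saal_sum a b (d * q) e f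
  - (1 - a * d) * saal_sum a b d e f
  = a * d * qpoch_inf (b * (d * q)) q * qpoch_inf (b * e) q * qpoch_inf (b * f) q
    / (qpoch_inf q q * qpoch_inf (b / a * q) q).
Proof.
  intros Ha Hr.
  assert (Hq := regular_q).
  assert (H' := regular_mult_q _ Hr).
  destruct (bdd_dominated1 (fun k => saal_coef a b d e f k)) as [M1 H1].
  { apply (saal_coef_bdd a b e f (fun _ => d) (fun k => k)); [exact Hr | apply bdd_const]. }
  destruct (bdd_dominated1 (fun k => saal_coef a b (d * q) e f k)) as [M2 H2].
  { apply (saal_coef_bdd a b e f (fun _ => d * q) (fun k => k)); [exact Hr | apply bdd_const]. }
  apply dominated_csum in H1. apply dominated_csum in H2.
  apply (csum_scal ((1 - a * b * d * f) * (1 - a * b * d * e))) in H2.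
  apply (csum_scal (- (1 - a * d))) in H1.
  assert (H3 := csum_plus _ _ _ _ H2 H1).
  apply clim_unique with (psum (fun k => (1 - a * b * d * f) * (1 - a * b * d * e)
                   * (saal_coef a b (d * q) e f k * q ^ k)
                 - (1 - a * d) * (saal_coef a b d e f k * q ^ k))).
  - replace (_ - (1 - a * d) * saal_sum a b d e f) with
      ((1 - a * b * d * f) * (1 - a * b * d * e) * saal_sum a b (d * q) e f
       + - (1 - a * d) * saal_sum a b d e f) by ring.
    apply csum_ext with (2 := H3). intros; ring.
  - apply clim_shift.
    apply clim_ext with (fun n => a * d * qpoch (b * (d * q)) q n
      * qpoch (b * e) q (S n) * qpoch (b * f) q (S n)
      * qpoch_inf (a * b * d * e * f * b * q * q ^ n) q
      * / (qpoch q q n * qpoch (b / a * q) q n)).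
    { intros n. rewrite (saal_psum a b d e f n Ha Hr).
      replace (a * b * d * e * f * b * q * q ^ n)
        with (a * b * d * e * f * b * q ^ S n) by (simpl; ring). reflexivity. }
    replace (a * d * qpoch_inf (b * (d * q)) q * qpoch_inf (b * e) q * qpoch_inf (b * f) q
      / (qpoch_inf q q * qpoch_inf (b / a * q) q))
      with (a * d * qpoch_inf (b * (d * q)) q * qpoch_inf (b * e) q * qpoch_inf (b * f) q
       * qpoch_inf 0 q * / (qpoch_inf q q * qpoch_inf (b / a * q) q))
      by (rewrite qpoch_inf_0; unfold Cdiv; ring).
    repeat apply clim_mult; try apply clim_const.
    + apply qpoch_lim.
    + apply (clim_shift (qpoch (b * e) q)), qpoch_lim.
    + apply (clim_shift (qpoch (b * f) q)), qpoch_lim.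
    + apply qpoch_inf_clim, q_pow_clim.
    + apply clim_inv.
      * apply Cmult_neq_0; apply qpoch_inf_neq_0; assumption.
      * intros n. apply Cmult_neq_0; apply qpoch_neq_0; assumption.
      * apply clim_mult; apply qpoch_lim.
Qed.

Lemma ratio_neq_1 (a b : C) : regular (a / b) -> b <> 0 -> b - a <> 0.
Proof.
  intros H Hb E. apply (H O). simpl.
  assert (E' : b = a) by (apply Ceq_minus; exact E). rewrite <- E'. field. exact Hb.
Qed.

(** The boundary terms at infinity left by the two telescoping series are
    proportional to [a / ((a/b)_oo (q b/a)_oo)] and [b / ((b/a)_oo (q a/b)_oo)];
    their sum is zero. *)
Lemma saal_step (a b d e f : C) :
  a <> 0 -> b <> 0 -> regular (b / a) -> regular (a / b) ->
  saal a b d e f = (1 - a * b * d * f) * (1 - a * b * d * e) * saal a b (d * q) e f.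
Proof.
  intros Ha Hb Hr Hr'.
  assert (S1 := saal_sum_step a b d e f Ha Hr).
  assert (S2 := saal_sum_step b a d e f Hb Hr').
  unfold saal, saal_side.
  rewrite (qpoch_inf_step (a * d)), (qpoch_inf_step (b * d)).
  rewrite (qpoch_inf_step (a / b)), (qpoch_inf_step (b / a)).
  replace (a * (d * q)) with (a * d * q) in * by ring.
  replace (b * (d * q)) with (b * d * q) in * by ring.
  assert (N1 := qpoch_inf_neq_0 _ (regular_mult_q _ Hr)).
  assert (N2 := qpoch_inf_neq_0 _ (regular_mult_q _ Hr')).
  assert (N3 := qpoch_inf_neq_0 _ regular_q).
  assert (N4 := ratio_neq_1 _ _ Hr' Hb).
  assert (N5 := ratio_neq_1 _ _ Hr Ha).
  set (Ad := qpoch_inf (a * d * q) q) in *. set (Ae := qpoch_inf (a * e) q) in *.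
  set (Af := qpoch_inf (a * f) q) in *.
  set (Bd := qpoch_inf (b * d * q) q) in *. set (Be := qpoch_inf (b * e) q) in *.
  set (Bf := qpoch_inf (b * f) q) in *.
  set (AB := qpoch_inf (a / b * q) q) in *. set (BA := qpoch_inf (b / a * q) q) in *.
  set (K := (1 - a * b * d * f) * (1 - a * b * d * e)) in *.
  replace ((1 - b * a * d * f) * (1 - b * a * d * e)) with K in S2 by (unfold K; ring).
  assert (E1 : (1 - a * d) * saal_sum a b d e f
     = K * saal_sum a b (d * q) e f - a * d * Bd * Be * Bf / (qpoch_inf q q * BA)).
  { rewrite <- S1. ring. }
  assert (E2 : (1 - b * d) * saal_sum b a d e f
     = K * saal_sum b a (d * q) e f - b * d * Ad * Ae * Af / (qpoch_inf q q * AB)).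
  { rewrite <- S2. ring. }
  transitivity (Ad * Ae * Af / ((1 - a / b) * AB) * ((1 - a * d) * saal_sum a b d e f)
    + Bd * Be * Bf / ((1 - b / a) * BA) * ((1 - b * d) * saal_sum b a d e f)).
  { field. repeat split; auto. }
  rewrite E1, E2. field. repeat split; auto.
Qed.

Lemma saal_iter (a b d e f : C) (n : nat) :
  a <> 0 -> b <> 0 -> regular (b / a) -> regular (a / b) ->
  saal a b d e f
  = qpoch (a * b * d * f) q n * qpoch (a * b * d * e) q n * saal a b (d * q ^ n) e f.
Proof.
  intros Ha Hb Hr Hr'. induction n as [|n IH].
  - simpl. replace (d * 1) with d by ring. ring.
  - rewrite IH. rewrite (saal_step _ _ (d * q ^ n)) by assumption.
    simpl. replace (d * (q * q ^ n)) with (d * q ^ n * q) by ring. ring.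
Qed.

Lemma saal_coef_clim (a b e f d : C) (k : nat) (u : nat -> C) :
  clim u d -> clim (fun n => saal_coef a b (u n) e f k) (saal_coef a b d e f k).
Proof.
  intros H. unfold saal_coef, Cdiv.
  repeat apply clim_mult; try apply clim_const; try apply qpoch_clim.
  - apply qpoch_inf_clim. repeat apply clim_mult; try apply clim_const. exact H.
  - apply clim_mult; [apply clim_const | exact H].
Qed.

Lemma clim_bdd (u : nat -> C) (l : C) : clim u l -> bdd u.
Proof.
  intros H. destruct (clim_bounded u l H) as [N HN].
  assert (F : exists K, forall n, (n < N)%nat -> (Cmod (u n) <= K)%R).
  { clear HN. induction N as [|N [K IH]]; [exists 0%R; intros; lia|].
    exists (Rmax K (Cmod (u N))). intros n Hn.
    destruct (Nat.eq_dec n N) as [->|Hne]; [apply Rmax_r|].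
    eapply Rle_trans; [apply IH; lia | apply Rmax_l]. }
  destruct F as [K HK]. exists (Rmax K (Cmod l + 1)). intros n.
  destruct (Nat.lt_ge_cases n N) as [Hn|Hn].
  - eapply Rle_trans; [apply HK, Hn | apply Rmax_l].
  - specialize (HN (n - N)%nat). replace (n - N + N)%nat with n in HN by lia.
    eapply Rle_trans; [apply HN | apply Rmax_r].
Qed.

Lemma bdd_comp {I J : Type} (u : I -> C) (g : J -> I) : bdd u -> bdd (fun j => u (g j)).
Proof. intros [M H]. exists M. intros j; apply H. Qed.

Lemma saal_sum_clim (a b e f d : C) (u : nat -> C) :
  regular (b / a) -> clim u d ->
  clim (fun n => saal_sum a b (u n) e f) (saal_sum a b d e f).
Proof.
  intros Hr H. unfold saal_sum.
  destruct (bdd_dominated (fun n k => saal_coef a b (u n) e f k)) as [M HM].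
  { apply (saal_coef_bdd a b e f (fun p : nat * nat => u (fst p)) (fun p => snd p)); [exact Hr|].
    apply (bdd_comp u), clim_bdd with d, H. }
  apply Cseries_clim with M; [exact HM|].
  intros k. apply clim_mult; [apply saal_coef_clim, H | apply clim_const].
Qed.

Lemma saal_clim (a b e f d : C) (u : nat -> C) :
  regular (b / a) -> regular (a / b) -> clim u d ->
  clim (fun n => saal a b (u n) e f) (saal a b d e f).
Proof.
  intros Hr Hr' H. unfold saal, saal_side, Cdiv.
  apply clim_plus; (apply clim_mult; [|apply saal_sum_clim; assumption]);
    repeat apply clim_mult; try apply clim_const;
    apply qpoch_inf_clim, clim_scal, H.
Qed.

Lemma saal_reduce (a b d e f : C) :
  a <> 0 -> b <> 0 -> regular (b / a) -> regular (a / b) ->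
  saal a b d e f = qpoch_inf (a * b * d * f) q * qpoch_inf (a * b * d * e) q * saal a b 0 e f.
Proof.
  intros Ha Hb Hr Hr'.
  apply clim_unique with (fun _ : nat => saal a b d e f); [apply clim_const|].
  apply clim_ext with (fun n => qpoch (a * b * d * f) q n * qpoch (a * b * d * e) q n
     * saal a b (d * q ^ n) e f).
  { intros n. symmetry. apply saal_iter; assumption. }
  apply clim_mult; [apply clim_mult; apply qpoch_lim|].
  apply saal_clim; [assumption | assumption | apply q_pow_clim].
Qed.

Lemma saal_perm (a b d e f : C) : saal a b d e f = saal a b e f d.
Proof.
  unfold saal, saal_side, saal_sum. f_equal; f_equal.
  - f_equal. ring.
  - apply Cseries_ext. intros n. unfold saal_coef.
    replace (a * b * e * f * d) with (a * b * d * e * f) by ring. f_equal. f_equal. ring.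
  - f_equal. ring.
  - apply Cseries_ext. intros n. unfold saal_coef.
    replace (b * a * e * f * d) with (b * a * d * e * f) by ring. f_equal. f_equal. ring.
Qed.

(** As [(a f)_oo = 0], one side vanishes; as [(a f)_k = 0] for [k > 0], the other one
    is its first term. *)
Lemma saal_base (a b : C) :
  a <> 0 -> b <> 0 -> regular (b / a) -> regular (a / b) ->
  saal a b 0 0 (/ a) = 1.
Proof.
  intros Ha Hb Hr Hr'. unfold saal, saal_side.
  replace (a * / a) with (RtoC 1) by (field; exact Ha). rewrite qpoch_inf_1.
  assert (E : saal_sum b a 0 0 (/ a) = 1).
  { unfold saal_sum. apply Cseries_eq. unfold csum. apply clim_shift.
    apply clim_ext with (fun _ => 1); [|apply clim_const].
    intros n. induction n as [|n IH].
    - simpl. unfold saal_coef. simpl.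
      replace (b * a * 0 * 0 * / a * a * 1) with (RtoC 0) by ring.
      rewrite qpoch_inf_0. field.
    - rewrite (psum_S _ (S n)), <- IH.
      unfold saal_coef at 1. replace (a * / a) with (RtoC 1) by (field; exact Ha).
      rewrite qpoch_1. unfold Cdiv. ring. }
  rewrite E.
  replace (a * 0) with (RtoC 0) by ring. replace (b * 0) with (RtoC 0) by ring.
  rewrite qpoch_inf_0. change (b * / a) with (b / a).
  field. split; apply qpoch_inf_neq_0; assumption.
Qed.

(** The q-shifts [d -> d q], [e -> e q], [f -> f q] change both sides by the
    same factor, so both may be compared at [d = e = f = 0]; there the left
    side does not depend on [f], and [saal_base] evaluates it at [f = 1/a]. *)
Theorem q_saalschuetz (a b d e f : C) :
  a <> 0 -> b <> 0 -> regular (b / a) -> regular (a / b) ->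
  saal a b d e f
  = qpoch_inf (a * b * d * e) q * qpoch_inf (a * b * d * f) q * qpoch_inf (a * b * e * f) q.
Proof.
  intros Ha Hb Hr Hr'.
  assert (Z : forall x, qpoch_inf (a * b * 0 * x) q = 1).
  { intros x. replace (a * b * 0 * x) with (RtoC 0) by ring. apply qpoch_inf_0. }
  assert (Z' : forall x, qpoch_inf (a * b * x * 0) q = 1).
  { intros x. replace (a * b * x * 0) with (RtoC 0) by ring. apply qpoch_inf_0. }
  assert (F0 : forall g, saal a b 0 0 g = saal a b 0 0 0).
  { intros g. rewrite !(saal_perm a b 0 0), (saal_perm a b 0 g 0).
    rewrite saal_reduce by assumption. rewrite !Z'. ring. }
  rewrite saal_reduce by assumption. rewrite saal_perm.
  rewrite saal_reduce by assumption. rewrite <- (saal_perm a b 0 0 f).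
  rewrite Z', (F0 f), <- (F0 (/ a)), saal_base by assumption. ring.
Qed.

(** * Two-term balanced 4phi3 combinations *)

(** The general term of
    [4phi3(Z1/r, Z2/r, s w, s/w; s u, s v, q s/r; q, q)] times [(s u, s v)_oo]. The
    series is balanced when [Z1 Z2 = r s u v]. The numbers [Z1], [Z2], unlike the
    upper parameters [Z1/r], [Z2/r], are the same for all pairs [{r, s}]. *)
Definition side_coef (r s u v Z1 Z2 w : C) (j : nat) : C :=
  qpoch_inf (s * u * q ^ j) q * qpoch_inf (s * v * q ^ j) q
  * (qpoch (Z1 / r) q j * qpoch (Z2 / r) q j * qpoch (s * w) q j * qpoch (s / w) q j)
  * (/ qpoch q q j * / qpoch (s / r * q) q j).

Definition side_factor (r s Z1 Z2 w : C) : C :=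
  qpoch_inf (Z1 / s) q * qpoch_inf (Z2 / s) q * qpoch_inf (r * w) q * qpoch_inf (r / w) q
  / qpoch_inf (r / s) q.

Definition side (r s u v Z1 Z2 w : C) : C :=
  side_factor r s Z1 Z2 w * Cseries (fun j => side_coef r s u v Z1 Z2 w j * q ^ j).

Definition two_sides (r s u v Z1 Z2 w : C) : C :=
  side r s u v Z1 Z2 w + side s r u v Z1 Z2 w.

(** The general term of a series in the points [q^k/w], symmetric in
    [r, s, u, v]. *)
Definition omega_coef (r s u v Z1 Z2 w : C) (k : nat) : C :=
  qpoch (r / w) q k * qpoch (s / w) q k * qpoch (u / w) q k * qpoch (v / w) q k
  * (qpoch_inf (Z1 * (q ^ k / w)) q * qpoch_inf (Z2 * (q ^ k / w)) q)
  * (/ qpoch q q k * / qpoch (/ w / w * q) q k).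

Definition omega_factor (r s u v w : C) : C :=
  qpoch_inf (r * w) q * qpoch_inf (s * w) q * qpoch_inf (u * w) q * qpoch_inf (v * w) q
  / qpoch_inf (w / (/ w)) q.

Definition omega_side (r s u v Z1 Z2 w : C) : C :=
  omega_factor r s u v w * Cseries (fun k => omega_coef r s u v Z1 Z2 w k * q ^ k).

Definition omega (r s u v Z1 Z2 w : C) : C :=
  omega_side r s u v Z1 Z2 w + omega_side r s u v Z1 Z2 (/ w).

(** The factors of the general term of the double series that depend on [j]
    only; those that depend on [k] only are in [mixed_col]. *)
Definition mixed_row (r s Z1 Z2 w : C) (j : nat) : C :=
  side_factor r s Z1 Z2 w
  * (qpoch (Z1 / r) q j * qpoch (Z2 / r) q j * qpoch (s * w) q j * qpoch (s / w) q j)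
  * (/ qpoch q q j * / qpoch (s / r * q) q j).

Definition mixed_col (r s u v w : C) (k : nat) : C :=
  omega_factor r s u v w
  * (qpoch (r / w) q k * qpoch (s / w) q k * qpoch (u / w) q k * qpoch (v / w) q k)
  * (/ qpoch q q k * / qpoch (/ w / w * q) q k).

Lemma qpoch_exchange (x : C) (j k : nat) :
  qpoch x q j * qpoch (x * q ^ j) q k = qpoch x q k * qpoch (x * q ^ k) q j.
Proof. rewrite <- !qpoch_add, Nat.add_comm. reflexivity. Qed.

(** The general term of the double series: for fixed [j] it is a term of
    a q-Saalschuetz sum in [k], and for fixed [k] a term of one in [j]. *)
Lemma mixed_term (r s u v Z1 Z2 w : C) (j k : nat) :
  r <> 0 -> s <> 0 -> w <> 0 -> Z1 * Z2 = r * s * u * v ->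
  mixed_row r s Z1 Z2 w j
  * (qpoch_inf (w * (s * q ^ j)) q * qpoch_inf (w * u) q * qpoch_inf (w * v) q
     / qpoch_inf (w / (/ w)) q
     * saal_coef w (/ w) (s * q ^ j) u v k)
  = mixed_col r s u v w k
  * (qpoch_inf (r * (Z1 / (r * s))) q * qpoch_inf (r * (Z2 / (r * s))) q
     * qpoch_inf (r * (q ^ k / w)) q / qpoch_inf (r / s) q
     * saal_coef r s (Z1 / (r * s)) (Z2 / (r * s)) (q ^ k / w) j).
Proof.
  intros Hr Hs Hw HZ.
  unfold mixed_row, mixed_col, saal_coef, side_factor, omega_factor.
  replace (r * (Z1 / (r * s))) with (Z1 / s) by (field; auto).
  replace (r * (Z2 / (r * s))) with (Z2 / s) by (field; auto).
  replace (s * (Z1 / (r * s))) with (Z1 / r) by (field; auto).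
  replace (s * (Z2 / (r * s))) with (Z2 / r) by (field; auto).
  replace (w * / w * (s * q ^ j) * u * v * / w * q ^ k)
    with (s * u * v / w * q ^ j * q ^ k) by (field; auto).
  replace (r * s * (Z1 / (r * s)) * (Z2 / (r * s)) * (q ^ k / w) * s * q ^ j)
    with (Z1 * Z2 / (r * s) * s * (q ^ k / w) * q ^ j) by (field; auto).
  rewrite HZ.
  replace (r * s * u * v / (r * s) * s * (q ^ k / w) * q ^ j)
    with (s * u * v / w * q ^ j * q ^ k) by (field; auto).
  rewrite (qpoch_inf_split (r / w) k), (qpoch_inf_split (s * w) j).
  replace (s * w * q ^ j) with (w * (s * q ^ j)) by ring.
  replace (r * (q ^ k / w)) with (r / w * q ^ k) by (field; auto).
  replace (u * w) with (w * u) by ring. replace (v * w) with (w * v) by ring.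
  replace (/ w * u) with (u / w) by (field; auto).
  replace (/ w * v) with (v / w) by (field; auto).
  assert (X := qpoch_exchange (s / w) j k).
  replace (/ w * (s * q ^ j)) with (s / w * q ^ j) by (field; auto).
  replace (s * (q ^ k / w)) with (s / w * q ^ k) by (field; auto).
  unfold Cdiv in *.
  ring [X].
Qed.

Lemma mixed_bdd (r s u v Z1 Z2 w : C) :
  regular (s / r) -> regular (/ w / w) ->
  bdd (fun p : nat * nat => mixed_row r s Z1 Z2 w (fst p)
    * (qpoch_inf (w * (s * q ^ fst p)) q * qpoch_inf (w * u) q * qpoch_inf (w * v) q
       / qpoch_inf (w / (/ w)) q
       * saal_coef w (/ w) (s * q ^ fst p) u v (snd p))).
Proof.
  intros H1 H2. unfold mixed_row.
  assert (H' := regular_mult_q _ H1).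
  apply bdd_mult; [bdd|].
  apply bdd_mult; [bdd|].
  apply (saal_coef_bdd w (/ w) u v (fun p : nat * nat => s * q ^ fst p) (fun p => snd p)).
  - exact H2.
  - bdd.
Qed.

(** Both orders of summation in the double series of [mixed_term]. *)
Lemma side_omega_half (r s u v Z1 Z2 w : C) :
  r <> 0 -> s <> 0 -> w <> 0 -> Z1 * Z2 = r * s * u * v ->
  regular (s / r) -> regular (/ w / w) ->
  exists l,
    csum (fun j => mixed_row r s Z1 Z2 w j
                   * saal_side w (/ w) (s * q ^ j) u v * q ^ j) l
    /\ csum (fun k => mixed_col r s u v w k
                   * saal_side r s (Z1 / (r * s)) (Z2 / (r * s)) (q ^ k / w)
                   * q ^ k) l.
Proof.
  intros Hr Hs Hw HZ H1 H2.
  set (B := fun j k => mixed_row r s Z1 Z2 w j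
    * (qpoch_inf (w * (s * q ^ j)) q * qpoch_inf (w * u) q * qpoch_inf (w * v) q
       / qpoch_inf (w / (/ w)) q
       * saal_coef w (/ w) (s * q ^ j) u v k)).
  destruct (bdd_dominated2 B) as [M HM].
  { apply (mixed_bdd r s u v Z1 Z2 w); assumption. }
  destruct (csum_swap _ _ HM) as [l [L1 L2]].
  exists l. split.
  - apply csum_ext with (2 := L1). intros j. unfold B.
    unfold saal_side, saal_sum.
    destruct (bdd_dominated1 (fun k => saal_coef w (/ w) (s * q ^ j) u v k))
      as [M1 D1].
    { apply (saal_coef_bdd w (/ w) u v (fun _ => s * q ^ j) (fun k => k)); [exact H2|bdd]. }
    rewrite <- Cseries_scal with (1 := D1).
    apply (dominated_scal _ _ _ _ (Rle_refl (Cmod (qpoch_inf (w * (s * q ^ j)) q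
      * qpoch_inf (w * u) q * qpoch_inf (w * v) q / qpoch_inf (w / / w) q)))) in D1.
    rewrite <- Cseries_scal with (1 := D1).
    apply (dominated_scal _ _ _ _ (Rle_refl (Cmod (mixed_row r s Z1 Z2 w j)))) in D1.
    match goal with |- _ = ?X * ?Y => rewrite (Cmult_comm X Y) end. rewrite <- Cseries_scal with (1 := D1).
    apply Cseries_ext. intros k. ring.
  - apply csum_ext with (2 := L2). intros k.
    unfold saal_side, saal_sum.
    set (t := q ^ k / w).
    destruct (bdd_dominated1 (fun j => saal_coef r s (Z1 / (r * s)) (Z2 / (r * s)) t j))
      as [M1 D1].
    { apply (saal_coef_bdd r s (Z2 / (r * s)) t (fun _ => Z1 / (r * s)) (fun k => k));
        [exact H1 | bdd]. }
    rewrite <- Cseries_scal with (1 := D1).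
    apply (dominated_scal _ _ _ _ (Rle_refl (Cmod (qpoch_inf (r * (Z1 / (r * s))) q
      * qpoch_inf (r * (Z2 / (r * s))) q * qpoch_inf (r * t) q / qpoch_inf (r / s) q)))) in D1.
    rewrite <- Cseries_scal with (1 := D1).
    apply (dominated_scal _ _ _ _ (Rle_refl (Cmod (mixed_col r s u v w k)))) in D1.
    match goal with |- _ = ?X * ?Y => rewrite (Cmult_comm X Y) end. rewrite <- Cseries_scal with (1 := D1).
    apply Cseries_ext. intros j. unfold B.
    rewrite mixed_term by assumption. fold t. ring.
Qed.

Lemma side_coef_bdd {I : Type} (r s u v Z1 Z2 : C) (w w' : I -> C) (n : I -> nat) :
  regular (s / r) -> bdd w -> bdd w' ->
  bdd (fun i => qpoch_inf (s * u * q ^ n i) q * qpoch_inf (s * v * q ^ n i) q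
    * (qpoch (Z1 / r) q (n i) * qpoch (Z2 / r) q (n i) * qpoch (s * w i) q (n i)
       * qpoch (s * w' i) q (n i))
    * (/ qpoch q q (n i) * / qpoch (s / r * q) q (n i))).
Proof.
  intros H Hw Hw'. assert (H' := regular_mult_q _ H). bdd.
Qed.

Lemma side_dominated (r s u v Z1 Z2 w : C) : regular (s / r) ->
  exists M, dominated M (fun j => side_coef r s u v Z1 Z2 w j * q ^ j).
Proof.
  intros H. apply bdd_dominated1.
  apply (side_coef_bdd r s u v Z1 Z2 (fun _ => w) (fun _ => / w) (fun j => j)); [exact H | bdd..].
Qed.

(** The products [(s u q^j, s v q^j)_oo] in [side_coef], together with [(u v)_oo],
    are the value of the q-Saalschuetz sum over the points [w q^k] and [q^k/w]. *)
Lemma side_by_saalschuetz (r s u v Z1 Z2 w : C) :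
  w <> 0 -> regular (s / r) ->
  regular (/ w / w) -> regular (w / / w) ->
  csum (fun j => mixed_row r s Z1 Z2 w j
                   * saal_side w (/ w) (s * q ^ j) u v * q ^ j
                 + mixed_row r s Z1 Z2 (/ w) j
                   * saal_side (/ w) (/ / w) (s * q ^ j) u v * q ^ j)
    (qpoch_inf (u * v) q * side r s u v Z1 Z2 w).
Proof.
  intros Hw H1 H2 H3.
  destruct (side_dominated r s u v Z1 Z2 w H1) as [M HM].
  apply dominated_csum in HM.
  apply (csum_scal (qpoch_inf (u * v) q * side_factor r s Z1 Z2 w)) in HM.
  unfold side. rewrite Cmult_assoc.
  apply csum_ext with (2 := HM). intros j.
  assert (Hwi := Cinv_neq_0 w Hw).
  assert (Ei : / / w = w) by (field; auto). rewrite Ei.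
  assert (S := q_saalschuetz w (/ w) (s * q ^ j) u v Hw Hwi H2 H3).
  unfold saal in S.
  replace (mixed_row r s Z1 Z2 (/ w) j) with (mixed_row r s Z1 Z2 w j).
  2:{ unfold mixed_row, side_factor, Cdiv. rewrite Ei. ring. }
  transitivity (mixed_row r s Z1 Z2 w j * (saal_side w (/ w) (s * q ^ j) u v
     + saal_side (/ w) w (s * q ^ j) u v) * q ^ j); [|ring].
  rewrite S.
  replace (w * / w * (s * q ^ j) * u) with (s * u * q ^ j) by (field; auto).
  replace (w * / w * (s * q ^ j) * v) with (s * v * q ^ j) by (field; auto).
  replace (w * / w * u * v) with (u * v) by (field; auto).
  unfold side_coef, mixed_row. ring.
Qed.

(** The q-Saalschuetz sum over the points [r q^j] and [s q^j] has the value
    [(u v, Z1 q^k/w, Z2 q^k/w)_oo]. *)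
Lemma omega_side_by_saalschuetz (r s u v Z1 Z2 w l l' : C) :
  r <> 0 -> s <> 0 -> w <> 0 -> Z1 * Z2 = r * s * u * v ->
  regular (s / r) -> regular (r / s) -> regular (/ w / w) ->
  csum (fun k => mixed_col r s u v w k
     * saal_side r s (Z1 / (r * s)) (Z2 / (r * s)) (q ^ k / w) * q ^ k) l ->
  csum (fun k => mixed_col s r u v w k
     * saal_side s r (Z1 / (s * r)) (Z2 / (s * r)) (q ^ k / w) * q ^ k) l' ->
  l + l' = qpoch_inf (u * v) q * omega_side r s u v Z1 Z2 w.
Proof.
  intros Hr Hs Hw HZ H1 H2 H3 L L'.
  assert (S := csum_plus _ _ _ _ L L').
  apply clim_unique with (1 := S).
  assert (D : exists M, dominated M
    (fun k => omega_coef r s u v Z1 Z2 w k * q ^ k)).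
  { apply bdd_dominated1. unfold omega_coef.
    assert (H3' := regular_mult_q _ H3). bdd. }
  destruct D as [M D]. apply dominated_csum in D.
  apply (csum_scal (qpoch_inf (u * v) q * omega_factor r s u v w)) in D.
  unfold omega_side. rewrite Cmult_assoc.
  apply csum_ext with (2 := D). intros k.
  assert (E := q_saalschuetz r s (Z1 / (r * s)) (Z2 / (r * s)) (q ^ k / w) Hr Hs H1 H2).
  unfold saal in E.
  replace (mixed_col s r u v w k) with (mixed_col r s u v w k)
    by (unfold mixed_col, omega_factor, Cdiv; ring).
  replace (s * r) with (r * s) by ring.
  transitivity (mixed_col r s u v w k
    * (saal_side r s (Z1 / (r * s)) (Z2 / (r * s)) (q ^ k / w)
       + saal_side s r (Z1 / (r * s)) (Z2 / (r * s)) (q ^ k / w)) * q ^ k);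
    [|ring].
  rewrite E.
  replace (r * s * (Z1 / (r * s)) * (Z2 / (r * s))) with (Z1 * Z2 / (r * s)) by (field; auto).
  rewrite HZ. replace (r * s * u * v / (r * s)) with (u * v) by (field; auto).
  replace (r * s * (Z1 / (r * s)) * (q ^ k / w)) with (Z1 * (q ^ k / w))
    by (field; auto).
  replace (r * s * (Z2 / (r * s)) * (q ^ k / w)) with (Z2 * (q ^ k / w))
    by (field; auto).
  unfold omega_coef, mixed_col. ring.
Qed.

(** The two-term combination attached to the pair [{r, s}] depends only on
    the set [{r, s, u, v}], since [omega] is symmetric in these four. *)
Theorem two_sides_omega (r s u v Z1 Z2 w : C) :
  r <> 0 -> s <> 0 -> w <> 0 -> Z1 * Z2 = r * s * u * v ->
  regular (s / r) -> regular (r / s) ->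
  regular (/ w / w) -> regular (w / / w) ->
  regular (u * v) ->
  two_sides r s u v Z1 Z2 w = omega r s u v Z1 Z2 w.
Proof.
  intros Hr Hs Hw HZ H1 H2 H3 H4 H5.
  assert (Hwi := Cinv_neq_0 w Hw).
  assert (Ei : / / w = w) by (field; auto).
  assert (HZ' : Z1 * Z2 = s * r * u * v) by (rewrite HZ; ring).
  assert (H3' : regular (/ / w / / w)) by (rewrite Ei; exact H4).
  destruct (side_omega_half r s u v Z1 Z2 w Hr Hs Hw HZ H1 H3) as [l1 [A1 B1]].
  destruct (side_omega_half r s u v Z1 Z2 (/ w) Hr Hs Hwi HZ H1 H3') as [l2 [A2 B2]].
  destruct (side_omega_half s r u v Z1 Z2 w Hs Hr Hw HZ' H2 H3) as [l3 [A3 B3]].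
  destruct (side_omega_half s r u v Z1 Z2 (/ w) Hs Hr Hwi HZ' H2 H3') as [l4 [A4 B4]].
  assert (E1 := clim_unique _ _ _ (csum_plus _ _ _ _ A1 A2)
     (side_by_saalschuetz r s u v Z1 Z2 w Hw H1 H3 H4)).
  assert (E2 := clim_unique _ _ _ (csum_plus _ _ _ _ A3 A4)
     (side_by_saalschuetz s r u v Z1 Z2 w Hw H2 H3 H4)).
  assert (E3 := omega_side_by_saalschuetz r s u v Z1 Z2 w l1 l3 Hr Hs Hw HZ H1 H2 H3 B1 B3).
  assert (E4 := omega_side_by_saalschuetz r s u v Z1 Z2 (/ w) l2 l4 Hr Hs Hwi HZ H1 H2 H3' B2 B4).
  assert (N := qpoch_inf_neq_0 _ H5).
  assert (E : qpoch_inf (u * v) q * two_sides r s u v Z1 Z2 w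
    = qpoch_inf (u * v) q * omega r s u v Z1 Z2 w).
  { unfold two_sides, omega. rewrite !Cmult_plus_distr_l, <- E1, <- E2, <- E3, <- E4. ring. }
  transitivity (/ qpoch_inf (u * v) q * (qpoch_inf (u * v) q * two_sides r s u v Z1 Z2 w)).
  - field. exact N.
  - rewrite E. field. exact N.
Qed.

Lemma omega_sym12 (r s u v Z1 Z2 w : C) : omega r s u v Z1 Z2 w = omega s r u v Z1 Z2 w.
Proof.
  unfold omega, omega_side. f_equal; (f_equal; [unfold omega_factor, Cdiv; ring|];
    apply Cseries_ext; intros k; unfold omega_coef; ring).
Qed.

Lemma omega_sym23 (r s u v Z1 Z2 w : C) : omega r s u v Z1 Z2 w = omega r u s v Z1 Z2 w.
Proof.
  unfold omega, omega_side. f_equal; (f_equal; [unfold omega_factor, Cdiv; ring|];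
    apply Cseries_ext; intros k; unfold omega_coef; ring).
Qed.

Lemma omega_sym34 (r s u v Z1 Z2 w : C) : omega r s u v Z1 Z2 w = omega r s v u Z1 Z2 w.
Proof.
  unfold omega, omega_side. f_equal; (f_equal; [unfold omega_factor, Cdiv; ring|];
    apply Cseries_ext; intros k; unfold omega_coef; ring).
Qed.

(** * The function v as a symmetric function of a, b, c, q/d *)

Lemma Cexp_plus (x y : C) : Cexp (x + y) = Cexp x * Cexp y.
Proof.
  unfold Cexp. destruct x as [x1 x2], y as [y1 y2]. simpl.
  rewrite exp_plus, cos_plus, sin_plus. unfold Cmult. simpl. f_equal; ring.
Qed.

Lemma Cexp_0 : Cexp 0 = 1.
Proof. unfold Cexp. simpl. rewrite exp_0, cos_0, sin_0. unfold RtoC. f_equal; ring. Qed.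

Lemma Cexp_opp (x : C) : Cexp (- x) * Cexp x = 1.
Proof. rewrite <- Cexp_plus, <- Cexp_0. f_equal. ring. Qed.

Lemma Cexp_neq_0 (x : C) : Cexp x <> 0.
Proof. intros E. assert (H := Cexp_opp x). rewrite E in H. apply C1_nz. rewrite <- H. ring. Qed.

Lemma cpow_plus (x y : C) : cpow q (x + y) = cpow q x * cpow q y.
Proof. unfold cpow. rewrite <- Cexp_plus. f_equal. ring. Qed.

Lemma cpow_1 : cpow q 1 = q.
Proof.
  unfold cpow, Cexp. simpl. destruct hq.
  replace (1 * ln q - 0 * 0)%R with (ln q) by ring.
  replace (1 * 0 + 0 * ln q)%R with 0%R by ring.
  rewrite exp_ln, cos_0, sin_0 by assumption. unfold RtoC. f_equal; ring.
Qed.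

Lemma cpow_opp (x : C) : cpow q (- x) * cpow q x = 1.
Proof.
  rewrite <- cpow_plus. replace (- x + x) with (RtoC 0) by ring.
  unfold cpow. replace (0 * ln q) with (RtoC 0) by ring. apply Cexp_0.
Qed.

Lemma cpow_1_minus (nu : C) : cpow q (1 - nu) = q * cpow q (- nu).
Proof. unfold Cminus. rewrite cpow_plus, cpow_1. reflexivity. Qed.

Lemma cpow_minus_1 (nu : C) : cpow q (nu - 1) = cpow q nu / q.
Proof.
  assert (E : cpow q nu = q * cpow q (nu - 1)).
  { transitivity (cpow q (1 + (nu - 1))); [f_equal; ring | rewrite cpow_plus, cpow_1; reflexivity]. }
  rewrite E. field. apply q_neq_0.
Qed.

Lemma Cmod_cpow (s : C) : Cmod (cpow q s) = exp (Re s * ln q).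
Proof.
  unfold cpow, Cexp, Cmod. simpl.
  match goal with |- sqrt ?X = _ => replace X with (exp (Re s * ln q) * exp (Re s * ln q))%R end.
  - apply sqrt_square. left; apply exp_pos.
  - destruct s as [x y]. simpl.
    replace (x * ln q - y * 0)%R with (x * ln q)%R by ring.
    replace (x * 0 + y * ln q)%R with (y * ln q)%R by ring.
    assert (T := sin2_cos2 (y * ln q)). unfold Rsqr in T.
    set (E := exp (x * ln q)). set (c := cos (y * ln q)) in *. set (t := sin (y * ln q)) in *.
    replace (E * E)%R with (E * E * (t * t + c * c))%R by (rewrite T; ring). ring.
Qed.

Lemma not_q_power_regular (x : C) : ~ is_q_power q x -> regular x.
Proof.
  intros H k E. apply H. exists (- Z.of_nat k)%Z.
  destruct hq as [h0 h1].
  rewrite powerRZ_neg' , <- pow_powerRZ, RtoC_inv, RtoC_pow by (apply pow_nonzero; lra).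
  replace (/ q ^ k) with (/ q ^ k * (x * q ^ k)) by (rewrite E; ring).
  field. apply q_pow_neq_0.
Qed.

Lemma q_power_mult (x : C) (m : Z) :
  is_q_power q (x * RtoC (powerRZ q m)) -> is_q_power q x.
Proof.
  intros [n E]. exists (n - m)%Z. destruct hq as [h0 h1].
  assert (Hq : (q <> 0)%R) by lra.
  unfold Zminus. rewrite powerRZ_add, powerRZ_neg' by exact Hq.
  assert (N : (powerRZ q m <> 0)%R) by (apply powerRZ_NOR, Hq).
  rewrite RtoC_mult, <- E, RtoC_inv by exact N.
  field. intros E'. apply RtoC_inj in E'. contradiction.
Qed.

Lemma q_power_inv (x : C) : x <> 0 -> is_q_power q (/ x) -> is_q_power q x.
Proof.
  intros Hx [n E]. exists (- n)%Z. destruct hq as [h0 h1].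
  assert (Hq : (q <> 0)%R) by lra.
  rewrite powerRZ_neg', RtoC_inv, <- E by (apply powerRZ_NOR, Hq). field. exact Hx.
Qed.

Lemma qhyp_side (r s u v Z1 Z2 w : C) :
  regular (s / r) -> regular (s * u) -> regular (s * v) ->
  qhyp [Z1 / r; Z2 / r; s * w; s / w] [s * u; s * v; s / r * q] q q
  = / (qpoch_inf (s * u) q * qpoch_inf (s * v) q)
    * Cseries (fun j => side_coef r s u v Z1 Z2 w j * q ^ j).
Proof.
  intros H Hu Hv. destruct (side_dominated r s u v Z1 Z2 w H) as [M HM].
  rewrite <- Cseries_scal with (1 := HM).
  unfold qhyp. apply Cseries_ext. intros n.
  unfold qpochs, side_coef. simpl fold_right.
  rewrite (qpoch_inf_split (s * u) n), (qpoch_inf_split (s * v) n).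
  assert (N1 := qpoch_neq_0 _ n Hu). assert (N2 := qpoch_neq_0 _ n Hv).
  assert (N3 := qpoch_neq_0 _ n regular_q). assert (N4 := qpoch_neq_0 _ n (regular_mult_q _ H)).
  assert (N5 := qpoch_inf_neq_0 _ Hu). assert (N6 := qpoch_inf_neq_0 _ Hv).
  rewrite (qpoch_inf_split _ n) in N5. rewrite (qpoch_inf_split _ n) in N6.
  assert (N7 : qpoch_inf (s * u * q ^ n) q <> 0) by (intros E; apply N5; rewrite E; ring).
  assert (N8 : qpoch_inf (s * v * q ^ n) q <> 0) by (intros E; apply N6; rewrite E; ring).
  field. repeat split; assumption.
Qed.

(** With [Z1 = q^(1-nu)/d] and [Z2 = a b c q^nu], the upper parameters
    [q^(-nu), a b c d q^(nu-1)] are [Z1/e, Z2/e] for [e = q/d], and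
    [q^(1-nu)/(a d), b c q^nu] are [Z1/a, Z2/a]. *)
Lemma v_formula_two_sides (nu w a b c d : C) :
  a <> 0 -> d <> 0 ->
  (Cmod a < 1)%R -> (Cmod b < 1)%R -> (Cmod c < 1)%R -> (Cmod (q / d) < 1)%R ->
  regular (q / d / a) -> regular (a / (q / d)) ->
  v_formula q nu w a b c d
  = two_sides a (q / d) b c (q / d * cpow q (- nu)) (a * b * c * cpow q nu) w
    / (qpoch_inf (a * b) q * qpoch_inf (a * c) q * qpoch_inf (b * c) q).
Proof.
  intros Ha Hd Ma Mb Mc Me R1 R2.
  assert (Hq := q_neq_0).
  set (e := q / d) in *.
  assert (He : e <> 0).
  { unfold e. intros E. apply Hq. replace (RtoC q) with (q / d * d) by (field; exact Hd).
    rewrite E. ring. }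
  assert (Hde : d = q / e) by (unfold e; field; auto).
  assert (Rab : regular (a * b)) by (apply regular_mult; assumption).
  assert (Rac : regular (a * c)) by (apply regular_mult; assumption).
  assert (Rbc : regular (b * c)) by (apply regular_mult; assumption).
  assert (Reb : regular (e * b)) by (apply regular_mult; assumption).
  assert (Rec : regular (e * c)) by (apply regular_mult; assumption).
  unfold v_formula, two_sides, side, side_factor. rewrite cpow_1_minus, cpow_minus_1.
  set (y := cpow q (- nu)). set (y' := cpow q nu).
  set (Z1 := e * y). set (Z2 := a * b * c * y').
  replace (q * y / (a * d)) with (Z1 / a) by (unfold Z1; rewrite Hde; field; auto).
  replace (b * c * y') with (Z2 / a) by (unfold Z2; field; auto).
  replace (a * b * c * d * (y' / q)) with (Z2 / e) by (unfold Z2; rewrite Hde; field; auto).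
  replace y with (Z1 / e) by (unfold Z1; field; auto).
  replace (q * w / d) with (e * w) by (unfold e, Cdiv; ring).
  replace (q / w / d) with (e / w) by (unfold e, Cdiv; ring).
  replace (q * b / d) with (e * b) by (unfold e, Cdiv; ring).
  replace (q * c / d) with (e * c) by (unfold e, Cdiv; ring).
  replace (q ^ 2 / (a * d)) with (e / a * q) by (rewrite Hde; field; auto).
  replace (a * d / q) with (a / e) by (rewrite Hde; field; auto).
  replace (q / (a * d)) with (e / a) by (rewrite Hde; field; auto).
  replace (a * d) with (a / e * q) by (rewrite Hde; field; auto).
  rewrite (qhyp_side e a b c Z1 Z2 w R2 Rab Rac).
  rewrite (qhyp_side a e b c Z1 Z2 w R1 Reb Rec).
  unfold qpochs_inf. simpl fold_right.
  assert (N1 := qpoch_inf_neq_0 _ Rab). assert (N2 := qpoch_inf_neq_0 _ Rac).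
  assert (N3 := qpoch_inf_neq_0 _ Rbc). assert (N4 := qpoch_inf_neq_0 _ Reb).
  assert (N5 := qpoch_inf_neq_0 _ Rec). assert (N6 := qpoch_inf_neq_0 _ R1).
  assert (N7 := qpoch_inf_neq_0 _ R2).
  field. repeat split; assumption.
Qed.

Lemma omega_side_clim (r u v s Z1 Z2 w : C) (sn zn : nat -> C) :
  clim sn s -> clim zn Z1 -> regular (/ w / w) ->
  clim (fun n => omega_side r (sn n) u v (zn n) Z2 w)
    (omega_side r s u v Z1 Z2 w).
Proof.
  intros Hs Hz H. unfold omega_side.
  assert (Bs := clim_bdd _ _ Hs). assert (Bz := clim_bdd _ _ Hz).
  apply clim_mult.
  - unfold omega_factor, Cdiv. repeat apply clim_mult; try apply clim_const.
    apply qpoch_inf_clim, clim_mult; [exact Hs | apply clim_const].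
  - destruct (bdd_dominated (fun n k => omega_coef r (sn n) u v (zn n) Z2 w k)) as [M HM].
    { unfold omega_coef. assert (H' := regular_mult_q _ H).
      assert (Bs' : bdd (fun p : nat * nat => sn (fst p))) by (apply (bdd_comp sn), Bs).
      assert (Bz' : bdd (fun p : nat * nat => zn (fst p))) by (apply (bdd_comp zn), Bz).
      bdd. }
    apply Cseries_clim with M; [exact HM|]. intros k.
    apply clim_mult; [|apply clim_const].
    unfold omega_coef, Cdiv. repeat apply clim_mult; try apply clim_const.
    + apply qpoch_clim, clim_mult; [exact Hs | apply clim_const].
    + apply qpoch_inf_clim, clim_mult; [exact Hz | apply clim_const].
Qed.

Lemma omega_clim (r u v s Z1 Z2 w : C) (sn zn : nat -> C) :
  clim sn s -> clim zn Z1 -> w <> 0 ->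
  regular (/ w / w) -> regular (w / / w) ->
  clim (fun n => omega r (sn n) u v (zn n) Z2 w)
    (omega r s u v Z1 Z2 w).
Proof.
  intros Hs Hz Hw H H'.
  assert (E : / / w = w) by (field; auto).
  unfold omega. apply clim_plus; apply omega_side_clim; auto. rewrite E. exact H'.
Qed.

(** Used to see that a sequence converging to a power of [q] without taking
    this value contains, from some rank on, no power of [q]. *)
Lemma q_power_gap (m n : Z) : m <> n ->
  (powerRZ q m * (1 - q) <= Rabs (powerRZ q n - powerRZ q m))%R.
Proof.
  intros H. destruct hq as [h0 h1].
  assert (Hq : (q <> 0)%R) by lra.
  replace n with (m + (n - m))%Z by ring. set (k := (n - m)%Z).
  assert (Hk : k <> 0%Z) by (unfold k; lia).
  rewrite powerRZ_add by exact Hq.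
  assert (P := powerRZ_lt q m h0).
  replace (powerRZ q m * powerRZ q k - powerRZ q m)%R
    with (powerRZ q m * (powerRZ q k - 1))%R by ring.
  rewrite Rabs_mult, (Rabs_pos_eq (powerRZ q m)) by lra.
  apply Rmult_le_compat_l; [lra|].
  assert (G : forall j : nat, (q ^ S j <= q)%R).
  { intros j. simpl. assert (B := q_pow_le_1 j). assert (B' := q_pow_pos j). nra. }
  destruct (Z_lt_le_dec k 0) as [L|L].
  - replace k with (- Z.of_nat (S (Z.to_nat (- k - 1))))%Z by lia.
    rewrite powerRZ_neg', <- pow_powerRZ.
    assert (B := G (Z.to_nat (- k - 1))).
    assert (B' := q_pow_pos (S (Z.to_nat (- k - 1)))).
    set (t := (q ^ S (Z.to_nat (- k - 1)))%R) in *.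
    assert (I : (t * / t = 1)%R) by (apply Rinv_r; lra).
    assert (I' : (0 < / t)%R) by (apply Rinv_0_lt_compat; lra).
    rewrite Rabs_pos_eq; nra.
  - replace k with (Z.of_nat (S (Z.to_nat (k - 1))))%Z by lia.
    rewrite <- pow_powerRZ. assert (B := G (Z.to_nat (k - 1))).
    rewrite Rabs_minus_sym, Rabs_pos_eq; lra.
Qed.

Lemma v_formula_omega (nu w a b c d : C) :
  a <> 0 -> d <> 0 -> w <> 0 ->
  (Cmod a < 1)%R -> (Cmod b < 1)%R -> (Cmod c < 1)%R -> (Cmod (q / d) < 1)%R ->
  ~ is_q_power q (a * d) ->
  regular (/ w / w) -> regular (w / / w) ->
  v_formula q nu w a b c d
  = omega a (q / d) b c (q / d * cpow q (- nu)) (a * b * c * cpow q nu) w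
    / (qpoch_inf (a * b) q * qpoch_inf (a * c) q * qpoch_inf (b * c) q).
Proof.
  intros Ha Hd Hw Ma Mb Mc Me Had W1 W2.
  assert (Hq := q_neq_0).
  assert (He := q_div_neq_0 d Hd).
  assert (Had0 : a * d <> 0) by (apply Cmult_neq_0; assumption).
  assert (P1 : ~ is_q_power q (a / (q / d))).
  { intros H. apply Had. apply (q_power_mult _ (-1)%Z).
    replace (a * d * RtoC (powerRZ q (-1))) with (a / (q / d)); [exact H|].
    simpl. rewrite Rmult_1_r, RtoC_inv by (intros E; apply Hq; rewrite E; reflexivity).
    field. auto. }
  assert (R1 : regular (a / (q / d))) by (apply not_q_power_regular, P1).
  assert (R2 : regular (q / d / a)).
  { apply not_q_power_regular. intros H. apply P1. apply q_power_inv.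
    - intros E. apply Ha. replace a with (a / (q / d) * (q / d)) by (field; auto).
      rewrite E. ring.
    - replace (/ (a / (q / d))) with (q / d / a); [exact H | field; auto]. }
  rewrite v_formula_two_sides by assumption.
  rewrite two_sides_omega; try assumption; [reflexivity | |].
  - assert (E := cpow_opp nu).
    transitivity (q / d * (a * b * c) * (cpow q (- nu) * cpow q nu)); [ring|].
    rewrite E. ring.
  - apply regular_small, Cmod_mult_lt_1; assumption.
Qed.

(** On the unit circle, the conditions on [w] leave out [1] and [-1] only. At
    a removable singularity the limit is taken in [omega], which is continuous
    in [d]. *)
Lemma v_fun_omega (nu w a b c d : C) :
  a <> 0 -> d <> 0 -> w <> 0 ->
  (Cmod a < 1)%R -> (Cmod b < 1)%R -> (Cmod c < 1)%R -> (Cmod (q / d) < 1)%R ->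
  regular (/ w / w) -> regular (w / / w) ->
  v_fun q nu w a b c d
  = omega a (q / d) b c (q / d * cpow q (- nu)) (a * b * c * cpow q nu) w
    / (qpoch_inf (a * b) q * qpoch_inf (a * c) q * qpoch_inf (b * c) q).
Proof.
  intros Ha Hd Hw Ma Mb Mc Me W1 W2. unfold v_fun.
  destruct (excluded_middle_informative (is_q_power q (a * d))) as [Had|Had];
    [|apply v_formula_omega; assumption].
  (* [C_lim] is a limit along the sequence [d + 1/(n+1)]. *)
  set (dn := fun n : nat => ((Rbar_loc_seq (fst d) n : R, snd d) : C)).
  change (C_lim (fun d' => v_formula q nu w a b c d') d)
    with (Cseq_lim (fun n => v_formula q nu w a b c (dn n))).
  apply Cseq_lim_eq.
  assert (Ed : forall n, dn n = d + RtoC (/ (INR n + 1))).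
  { intros n. unfold dn. simpl. destruct d as [d1 d2].
    unfold RtoC, Cplus. simpl. f_equal. ring. }
  assert (Ln : is_lim_seq (fun n => / (INR n + 1))%R 0%R).
  { apply is_lim_seq_ext with (fun n => Rbar_loc_seq 0%R n); [intros n; simpl; ring|].
    apply is_lim_seq_Rbar_loc_seq. }
  assert (Pn : forall n, (0 < / (INR n + 1))%R).
  { intros n. apply Rinv_0_lt_compat. assert (P := pos_INR n). lra. }
  assert (Ld : clim dn d).
  { apply clim_squeeze with (fun n => / (INR n + 1))%R; [|exact Ln].
    intros n. rewrite Ed. replace (d + RtoC (/ (INR n + 1)) - d) with (RtoC (/ (INR n + 1))) by ring.
    rewrite Cmod_R, Rabs_pos_eq; [lra | left; apply Pn]. }
  assert (Hq0 : (0 < q)%R) by apply hq.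
  assert (Mq : Cmod q = q) by (rewrite Cmod_R, Rabs_pos_eq; lra).
  assert (Mdq : forall z : C, z <> 0 -> (Cmod (q / z) < 1 <-> q < Cmod z)%R).
  { intros z Hz. rewrite Cmod_div, Mq by exact Hz.
    assert (Pz : (0 < Cmod z)%R) by (apply Cmod_gt_0, Hz).
    assert (I : (Cmod z * / Cmod z = 1)%R) by (apply Rinv_r; lra).
    assert (I' : (0 < / Cmod z)%R) by (apply Rinv_0_lt_compat; lra).
    unfold Rdiv. split; intros H; nra. }
  assert (Me' : (q < Cmod d)%R) by (apply Mdq; assumption).
  assert (N1 : exists N, forall n, (N <= n)%nat -> (q < Cmod (dn n))%R).
  { assert (L := clim_Cmod _ _ Ld). apply is_lim_seq_spec in L.
    assert (Pe : (0 < Cmod d - q)%R) by lra.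
    destruct (L (mkposreal _ Pe)) as [N HN]. exists N. intros n Hn.
    specialize (HN n Hn). simpl in HN. apply Rabs_def2 in HN. lra. }
  assert (N2 : exists N, forall n, (N <= n)%nat -> ~ is_q_power q (a * dn n)).
  { destruct Had as [m Em].
    assert (Pm : (0 < powerRZ q m)%R) by (apply powerRZ_lt; exact Hq0).
    assert (L : is_lim_seq (fun n => Cmod a * / (INR n + 1))%R 0%R).
    { replace (Finite 0) with (Finite (Cmod a * 0)) by (f_equal; ring).
      apply is_lim_seq_mult'; [apply is_lim_seq_const | exact Ln]. }
    apply is_lim_seq_spec in L.
    assert (Pg : (0 < powerRZ q m * (1 - q))%R)
      by (apply Rmult_lt_0_compat; [exact Pm | destruct hq; lra]).
    destruct (L (mkposreal _ Pg)) as [N HN]. exists N. intros n Hn [m' Em'].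
    specialize (HN n Hn). simpl in HN. rewrite Rminus_0_r in HN.
    assert (Pa : (0 < Cmod a)%R) by (apply Cmod_gt_0, Ha).
    assert (Pan : (0 < Cmod a * / (INR n + 1))%R) by (apply Rmult_lt_0_compat; [exact Pa | apply Pn]).
    rewrite Rabs_pos_eq in HN by lra.
    assert (D : (Cmod a * / (INR n + 1) = Rabs (powerRZ q m' - powerRZ q m))%R).
    { rewrite <- Cmod_R, RtoC_minus, <- Em, <- Em', Ed.
      replace (a * (d + RtoC (/ (INR n + 1))) - a * d) with (a * RtoC (/ (INR n + 1))) by ring.
      rewrite Cmod_mult, Cmod_R, Rabs_pos_eq; [reflexivity | left; apply Pn]. }
    destruct (Z.eq_dec m m') as [->|Hm].
    - rewrite Rminus_diag, Rabs_R0 in D. lra.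
    - assert (G := q_power_gap m m' Hm). lra. }
  destruct N1 as [N1 H1]. destruct N2 as [N2 H2].
  apply clim_shift_n with (N1 + N2)%nat.
  set (en := fun n : nat => q / dn (n + (N1 + N2))%nat).
  assert (Dn0 : forall n, dn (n + (N1 + N2))%nat <> 0).
  { intros n E. assert (B := H1 (n + (N1 + N2))%nat ltac:(lia)). rewrite E, Cmod_0 in B. lra. }
  assert (Le : clim en (q / d)).
  { unfold en. apply clim_mult; [apply clim_const|].
    apply clim_inv; [exact Hd | exact Dn0 | apply (clim_shift_n_conv dn), Ld]. }
  apply clim_ext with (fun n => omega a (en n) b c (en n * cpow q (- nu))
     (a * b * c * cpow q nu) w
     / (qpoch_inf (a * b) q * qpoch_inf (a * c) q * qpoch_inf (b * c) q)).
  - intros n. symmetry. apply v_formula_omega; try assumption.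
    + apply Dn0.
    + apply Mdq; [apply Dn0 | apply H1; lia].
    + apply H2. lia.
  - apply clim_mult; [|apply clim_const].
    apply omega_clim; try assumption.
    apply clim_mult; [exact Le | apply clim_const].
Qed.

(** * Integrals of complex-valued functions *)

Definition cint (f : R -> C) (a b : R) (l : C) : Prop :=
  is_RInt (V := C_R_NormedModule) f a b l.

Lemma cint_plus (f g : R -> C) (a b : R) (l m : C) :
  cint f a b l -> cint g a b m -> cint (fun t => f t + g t) a b (l + m).
Proof. intros H K. apply (is_RInt_plus (V := C_R_NormedModule)); assumption. Qed.

Lemma cint_scal (c : C) (f : R -> C) (a b : R) (l : C) :
  cint f a b l -> cint (fun t => c * f t) a b (c * l).
Proof.
  intros H.
  assert (H1 := is_RInt_fct_extend_fst _ _ _ _ H).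
  assert (H2 := is_RInt_fct_extend_snd _ _ _ _ H).
  apply (is_RInt_fct_extend_pair (U := R_NormedModule) (V := R_NormedModule)).
  - simpl. apply (is_RInt_minus (V := R_NormedModule)); apply (is_RInt_scal (V := R_NormedModule));
      assumption.
  - simpl. apply (is_RInt_plus (V := R_NormedModule)); apply (is_RInt_scal (V := R_NormedModule));
      assumption.
Qed.

Lemma cint_ext (f g : R -> C) (a b : R) (l : C) :
  (forall t, Rmin a b < t < Rmax a b -> f t = g t)%R -> cint f a b l -> cint g a b l.
Proof. apply is_RInt_ext. Qed.

Lemma cint_unique (f : R -> C) (a b : R) (l m : C) : cint f a b l -> cint f a b m -> l = m.
Proof.
  intros H K.
  rewrite <- (is_RInt_unique (V := C_R_CompleteNormedModule) _ _ _ _ H).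
  apply (is_RInt_unique (V := C_R_CompleteNormedModule) _ _ _ _ K).
Qed.

Lemma cint_const (c : C) (a b : R) : cint (fun _ => c) a b ((b - a)%R * c).
Proof. unfold cint. rewrite <- scal_R_Cmult. apply (is_RInt_const (V := C_R_NormedModule)). Qed.

Lemma cint_uniform (f : nat -> R -> C) (g : R -> C) (a b : R) (l : nat -> C) :
  (forall n, cint (f n) a b (l n)) ->
  (forall eps, (0 < eps)%R -> exists N, forall n t, (N <= n)%nat -> (Cmod (f n t - g t) < eps)%R) ->
  exists m, clim l m /\ cint g a b m.
Proof.
  intros H U.
  destruct (filterlim_RInt (V := C_R_CompleteNormedModule) f a b eventually _ g l H) as [m [L I]].
  - intros P [eps HP]. destruct (U eps (cond_pos eps)) as [N HN].
    exists N. intros n Hn. apply HP. intros t.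
    specialize (HN n t Hn).
    assert (B := Rmax_Cmod (f n t - g t)).
    split.
    + apply Rle_lt_trans with (2 := HN). eapply Rle_trans; [apply Rmax_l | apply B].
    + apply Rle_lt_trans with (2 := HN). eapply Rle_trans; [apply Rmax_r | apply B].
  - exists m. split; [|exact I]. apply clim_parts. split.
    + apply is_lim_seq_spec. intros eps.
      destruct (L (ball m eps)) as [N HN]; [exists eps; auto|].
      exists N. intros n Hn. apply (HN n Hn).
    + apply is_lim_seq_spec. intros eps.
      destruct (L (ball m eps)) as [N HN]; [exists eps; auto|].
      exists N. intros n Hn. apply (HN n Hn).
Qed.

(** * The unit circle *)

Definition cis (t : R) : C := Cexp (Ci * t).

Lemma cis_eq (t : R) : cis t = (cos t, sin t).
Proof.
  unfold cis, Cexp. simpl.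
  replace (0 * t - 1 * 0)%R with 0%R by ring.
  replace (0 * 0 + 1 * t)%R with t by ring.
  rewrite exp_0. f_equal; ring.
Qed.

Lemma Cmod_cis (t : R) : Cmod (cis t) = 1%R.
Proof.
  rewrite cis_eq. unfold Cmod. simpl.
  assert (T := sin2_cos2 t). unfold Rsqr in T.
  replace (cos t * (cos t * 1) + sin t * (sin t * 1))%R with 1%R by lra.
  apply sqrt_1.
Qed.

Lemma cis_neq_0 (t : R) : cis t <> 0.
Proof. intros E. assert (H := Cmod_cis t). rewrite E, Cmod_0 in H. lra. Qed.

Lemma cis_plus (s t : R) : cis (s + t) = cis s * cis t.
Proof. rewrite !cis_eq, cos_plus, sin_plus. unfold Cmult. simpl. f_equal; ring. Qed.

Lemma cis_0 : cis 0 = 1.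
Proof. rewrite cis_eq, cos_0, sin_0. reflexivity. Qed.

Lemma cis_opp (t : R) : cis (- t) = / cis t.
Proof.
  assert (E : cis (- t) * cis t = 1) by (rewrite <- cis_plus, <- cis_0; f_equal; ring).
  replace (cis (- t)) with (cis (- t) * cis t * / cis t) by (field; apply cis_neq_0).
  rewrite E. ring.
Qed.

Lemma cis_2PI : cis (2 * PI) = 1.
Proof. rewrite cis_eq, cos_2PI, sin_2PI. reflexivity. Qed.

Lemma cis_INR (n : nat) (t : R) : cis t ^ n = cis (INR n * t).
Proof.
  induction n as [|n IH].
  - simpl. rewrite Rmult_0_l, cis_0. reflexivity.
  - rewrite S_INR. simpl Cpow. rewrite IH, <- cis_plus. f_equal. ring.
Qed.

Lemma cint_cis (m : R) : m <> 0%R -> cis (m * (2 * PI)) = 1 ->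
  cint (fun t => cis (m * t)) 0 (2 * PI) 0.
Proof.
  intros Hm E. rewrite cis_eq in E. injection E. intros Es Ec.
  unfold cint. apply (is_RInt_ext (V := C_R_NormedModule)) with (fun t => (cos (m * t), sin (m * t))).
  { intros. symmetry. apply cis_eq. }
  apply (is_RInt_fct_extend_pair (U := R_NormedModule) (V := R_NormedModule)); simpl.
  - replace 0%R with (minus (sin (m * (2 * PI)) / m) (sin (m * 0) / m))%R at 2.
    + apply (is_RInt_derive (V := R_CompleteNormedModule) (fun t => sin (m * t) / m)%R).
      * intros x _. auto_derive; [auto | field; exact Hm].
      * intros x _. apply (ex_derive_continuous (V := R_NormedModule)). auto_derive. auto.
    + rewrite Es, Rmult_0_r, sin_0. unfold minus, plus, opp; simpl. field. exact Hm.
  - replace 0%R with (minus (- cos (m * (2 * PI)) / m) (- cos (m * 0) / m))%R at 2.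
    + apply (is_RInt_derive (V := R_CompleteNormedModule) (fun t => - cos (m * t) / m)%R).
      * intros x _. auto_derive; [auto | field; exact Hm].
      * intros x _. apply (ex_derive_continuous (V := R_NormedModule)). auto_derive. auto.
    + rewrite Ec, Rmult_0_r, cos_0. unfold minus, plus, opp; simpl. field. exact Hm.
Qed.

(** * Uniform limits of Laurent polynomials *)

Inductive laurent : (C -> C) -> Prop :=
  | laurent_mono (c : C) (i j : nat) : laurent (fun w => c * w ^ i * (/ w) ^ j)
  | laurent_plus (f g : C -> C) : laurent f -> laurent g -> laurent (fun w => f w + g w)
  | laurent_ext (f g : C -> C) :
      (forall w : C, w <> 0 -> f w = g w) -> laurent f -> laurent g.

Lemma laurent_mult (f g : C -> C) : laurent f -> laurent g -> laurent (fun w => f w * g w).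
Proof.
  intros Hf Hg. induction Hf as [c i j | f1 f2 _ IH1 _ IH2 | f1 f2 E _ IH].
  - induction Hg as [c' i' j' | g1 g2 _ IH1 _ IH2 | g1 g2 E _ IH].
    + apply laurent_ext with (fun w => (c * c') * w ^ (i + i') * (/ w) ^ (j + j')).
      * intros w _. rewrite !Cpow_add_r. ring.
      * apply laurent_mono.
    + apply laurent_ext with
        (fun w => c * w ^ i * (/ w) ^ j * g1 w + c * w ^ i * (/ w) ^ j * g2 w).
      * intros w _. ring.
      * apply laurent_plus; assumption.
    + apply laurent_ext with (fun w => c * w ^ i * (/ w) ^ j * g1 w); [|exact IH].
      intros w Hw. rewrite (E w Hw). reflexivity.
  - apply laurent_ext with (fun w => f1 w * g w + f2 w * g w).
    + intros w _. ring.
    + apply laurent_plus; assumption.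
  - apply laurent_ext with (fun w => f1 w * g w); [|exact IH].
    intros w Hw. rewrite (E w Hw). reflexivity.
Qed.

Lemma laurent_const (c : C) : laurent (fun _ => c).
Proof.
  apply laurent_ext with (fun w => c * w ^ 0 * (/ w) ^ 0); [|apply laurent_mono].
  intros; simpl; ring.
Qed.

Lemma laurent_id : laurent (fun w => w).
Proof.
  apply laurent_ext with (fun w => 1 * w ^ 1 * (/ w) ^ 0); [|apply laurent_mono].
  intros; simpl; ring.
Qed.

Lemma laurent_inv : laurent (fun w => / w).
Proof.
  apply laurent_ext with (fun w => 1 * w ^ 0 * (/ w) ^ 1); [|apply laurent_mono].
  intros; simpl; ring.
Qed.

Lemma laurent_bounded (r0 : R) (f : C -> C) : (0 < r0)%R -> laurent f ->
  exists M, (0 <= M)%R /\ forall w, (r0 <= Cmod w <= 1)%R -> (Cmod (f w) <= M)%R.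
Proof.
  intros Hr H. induction H as [c i j | f g _ [M [HM IH]] _ [N [HN IK]] | f g E _ [M [HM IH]]].
  - exists (Cmod c * 1 * (/ r0) ^ j)%R. split.
    { apply Rmult_le_pos; [|apply pow_le; left; apply Rinv_0_lt_compat, Hr].
      rewrite Rmult_1_r. apply Cmod_ge_0. }
    intros w [H1 H2].
    assert (Hw : w <> 0) by (apply Cmod_gt_0; lra).
    rewrite !Cmod_mult, !Cmod_pow, Cmod_inv by exact Hw.
    apply Rmult_le_compat.
    + apply Rmult_le_pos; [apply Cmod_ge_0 | apply pow_le, Cmod_ge_0].
    + apply pow_le. left. apply Rinv_0_lt_compat. lra.
    + apply Rmult_le_compat_l; [apply Cmod_ge_0|].
      rewrite <- (pow1 i). apply pow_incr. split; [apply Cmod_ge_0 | exact H2].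
    + apply pow_incr. split; [left; apply Rinv_0_lt_compat; lra|].
      apply Rinv_le_contravar; assumption.
  - exists (M + N)%R. split; [lra|]. intros w Hw.
    eapply Rle_trans; [apply Cmod_triangle|]. apply Rplus_le_compat; auto.
  - exists M. split; [exact HM|]. intros w Hw.
    assert (Hw0 : w <> 0) by (apply Cmod_gt_0; lra).
    rewrite <- (E w Hw0). auto.
Qed.

(** Cauchy's theorem for Laurent polynomials: circle means do not depend on
    the radius, nor on the orientation. *)
Lemma laurent_mean (f : C -> C) : laurent f ->
  exists c, forall r t0, (0 < r)%R -> (t0 = 1 \/ t0 = -1)%R ->
    cint (fun t => f (r * cis (t0 * t))) 0 (2 * PI) c.
Proof.
  intros H. induction H as [c i j | f g _ [l IH] _ [m IK] | f g E _ [l IH]].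
  - destruct (Nat.eq_dec i j) as [->|Hij].
    + exists ((2 * PI - 0)%R * c). intros r t0 Hr _.
      apply cint_ext with (fun _ => c); [|apply cint_const].
      intros t _.
      assert (Hw : r * cis (t0 * t) <> 0).
      { apply Cmult_neq_0; [|apply cis_neq_0]. intros E. apply RtoC_inj in E. lra. }
      rewrite <- Cmult_assoc, <- Cpow_mult_l, Cinv_r, Cpow_1_l by exact Hw. ring.
    + exists 0. intros r t0 Hr Ht.
      assert (Hr0 : RtoC r <> 0) by (intros E; apply RtoC_inj in E; lra).
      set (m := ((INR i - INR j) * t0)%R).
      apply cint_ext with (fun t => c * r ^ i * (/ r) ^ j * cis (m * t)).
      { intros t _.
        replace (/ (r * cis (t0 * t))) with (/ r * / cis (t0 * t))
          by (field; split; [apply cis_neq_0 | exact Hr0]).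
        rewrite !Cpow_mult_l, <- cis_opp, !cis_INR.
        replace (m * t)%R with (INR i * (t0 * t) + INR j * - (t0 * t))%R by (unfold m; ring).
        rewrite cis_plus. ring. }
      replace (RtoC 0) with (c * r ^ i * (/ r) ^ j * 0) by ring.
      apply cint_scal, cint_cis.
      * unfold m. assert (Hn : (INR i - INR j <> 0)%R).
        { intros E. apply Hij, INR_eq. lra. }
        destruct Ht as [->| ->]; lra.
      * assert (P : forall n, cis (INR n * (2 * PI)) = 1).
        { intros n. rewrite <- cis_INR, cis_2PI. apply Cpow_1_l. }
        assert (P' : forall n, cis (- (INR n * (2 * PI))) = 1).
        { intros n. rewrite cis_opp, P. field. }
        unfold m. destruct Ht as [->| ->].
        -- replace ((INR i - INR j) * 1 * (2 * PI))%R
             with (INR i * (2 * PI) + - (INR j * (2 * PI)))%R by ring.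
           rewrite cis_plus, P, P'. ring.
        -- replace ((INR i - INR j) * -1 * (2 * PI))%R
             with (INR j * (2 * PI) + - (INR i * (2 * PI)))%R by ring.
           rewrite cis_plus, P, P'. ring.
  - exists (l + m). intros r t0 Hr Ht. apply cint_plus; auto.
  - exists l. intros r t0 Hr Ht. apply cint_ext with (2 := IH r t0 Hr Ht).
    intros t _. apply E. apply Cmult_neq_0; [|apply cis_neq_0].
    intros E'. apply RtoC_inj in E'. lra.
Qed.

Definition uniflim (r0 : R) (f : C -> C) : Prop :=
  forall eps, (0 < eps)%R -> exists p, laurent p /\
    forall w, (r0 <= Cmod w <= 1)%R -> (Cmod (p w - f w) <= eps)%R.

Lemma uniflim_laurent (r0 : R) (f : C -> C) : laurent f -> uniflim r0 f.
Proof.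
  intros H eps He. exists f. split; [exact H|]. intros w _.
  replace (f w - f w) with (RtoC 0) by ring. rewrite Cmod_0. lra.
Qed.

Lemma uniflim_ext (r0 : R) (f g : C -> C) :
  (forall w, (r0 <= Cmod w <= 1)%R -> f w = g w) -> uniflim r0 f -> uniflim r0 g.
Proof.
  intros E H eps He. destruct (H eps He) as [p [Hp K]]. exists p. split; [exact Hp|].
  intros w Hw. rewrite <- (E w Hw). auto.
Qed.

Lemma uniflim_closed (r0 : R) (g : C -> C) :
  (forall eps, (0 < eps)%R -> exists f, uniflim r0 f /\
    forall w, (r0 <= Cmod w <= 1)%R -> (Cmod (f w - g w) <= eps)%R) -> uniflim r0 g.
Proof.
  intros H eps He.
  assert (He2 : (0 < eps / 2)%R) by lra.
  destruct (H _ He2) as [f [Hf Kf]]. destruct (Hf _ He2) as [p [Hp Kp]].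
  exists p. split; [exact Hp|]. intros w Hw.
  replace (p w - g w) with ((p w - f w) + (f w - g w)) by ring.
  eapply Rle_trans; [apply Cmod_triangle|].
  assert (A := Kf w Hw). assert (B := Kp w Hw). lra.
Qed.

Lemma uniflim_bounded (r0 : R) (f : C -> C) : (0 < r0)%R -> uniflim r0 f ->
  exists M, (0 <= M)%R /\ forall w, (r0 <= Cmod w <= 1)%R -> (Cmod (f w) <= M)%R.
Proof.
  intros Hr H. destruct (H 1%R Rlt_0_1) as [p [Hp K]].
  destruct (laurent_bounded r0 p Hr Hp) as [M [HM KM]].
  exists (M + 1)%R. split; [lra|]. intros w Hw.
  replace (f w) with (p w + - (p w - f w)) by ring.
  eapply Rle_trans; [apply Cmod_triangle|]. rewrite Cmod_opp.
  assert (A := K w Hw). assert (B := KM w Hw). lra.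
Qed.

Lemma uniflim_plus (r0 : R) (f g : C -> C) :
  uniflim r0 f -> uniflim r0 g -> uniflim r0 (fun w => f w + g w).
Proof.
  intros Hf Hg eps He. assert (He2 : (0 < eps / 2)%R) by lra.
  destruct (Hf _ He2) as [p [Hp Kp]]. destruct (Hg _ He2) as [p' [Hp' Kp']].
  exists (fun w => p w + p' w). split; [apply laurent_plus; assumption|].
  intros w Hw. replace (p w + p' w - (f w + g w)) with ((p w - f w) + (p' w - g w)) by ring.
  eapply Rle_trans; [apply Cmod_triangle|].
  assert (A := Kp w Hw). assert (B := Kp' w Hw). lra.
Qed.

Lemma uniflim_mult (r0 : R) (f g : C -> C) : (0 < r0)%R ->
  uniflim r0 f -> uniflim r0 g -> uniflim r0 (fun w => f w * g w).
Proof.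
  intros Hr Hf Hg.
  destruct (uniflim_bounded r0 f Hr Hf) as [M [HM KM]].
  intros eps He.
  assert (He1 : (0 < eps / 2 / (M + 1))%R) by (apply Rdiv_lt_0_compat; lra).
  destruct (Hg _ He1) as [p' [Hp' Kp']].
  destruct (laurent_bounded r0 p' Hr Hp') as [N [HN KN]].
  assert (He2 : (0 < eps / 2 / (N + 1))%R) by (apply Rdiv_lt_0_compat; lra).
  destruct (Hf _ He2) as [p [Hp Kp]].
  exists (fun w => p w * p' w). split; [apply laurent_mult; assumption|].
  intros w Hw.
  replace (p w * p' w - f w * g w) with ((p w - f w) * p' w + f w * (p' w - g w)) by ring.
  eapply Rle_trans; [apply Cmod_triangle|]. rewrite !Cmod_mult.
  assert (A := Kp w Hw). assert (B := Kp' w Hw). assert (D := KM w Hw). assert (E := KN w Hw).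
  assert (P1 := Cmod_ge_0 (p w - f w)). assert (P2 := Cmod_ge_0 (p' w - g w)).
  assert (P3 := Cmod_ge_0 (p' w)). assert (P4 := Cmod_ge_0 (f w)).
  apply Rle_trans with (eps / 2 / (N + 1) * (N + 1) + (M + 1) * (eps / 2 / (M + 1)))%R.
  - apply Rplus_le_compat; apply Rmult_le_compat; lra.
  - right. field. lra.
Qed.

Lemma uniflim_const (r0 : R) (c : C) : uniflim r0 (fun _ => c).
Proof. apply uniflim_laurent, laurent_const. Qed.

Lemma uniflim_scal (r0 : R) (c : C) (f : C -> C) : (0 < r0)%R ->
  uniflim r0 f -> uniflim r0 (fun w => c * f w).
Proof. intros Hr H. apply uniflim_mult; [exact Hr | apply uniflim_const | exact H]. Qed.

Lemma pow_lim_0 (r M : R) : (0 <= r < 1)%R -> is_lim_seq (fun n => M * r ^ n)%R 0%R.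
Proof.
  intros Hr. replace (Finite 0) with (Finite (M * 0)) by (f_equal; ring).
  apply is_lim_seq_mult'; [apply is_lim_seq_const|].
  apply is_lim_seq_geom. rewrite Rabs_pos_eq; lra.
Qed.

Lemma lim_0_small (e : nat -> R) (eps : R) : is_lim_seq e 0%R -> (0 < eps)%R ->
  exists n, (e n <= eps)%R.
Proof.
  intros H He. apply is_lim_seq_spec in H. destruct (H (mkposreal eps He)) as [N HN].
  exists N. specialize (HN N (Nat.le_refl N)). simpl in HN. apply Rabs_def2 in HN. lra.
Qed.

(** The geometric series. *)
Lemma uniflim_inv_1_minus (r0 r : R) (h : C -> C) : (0 < r0)%R -> (r < 1)%R ->
  uniflim r0 h -> (forall w, (r0 <= Cmod w <= 1)%R -> (Cmod (h w) <= r)%R) ->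
  uniflim r0 (fun w => / (1 - h w)).
Proof.
  intros Hr0 Hr H B. apply uniflim_closed. intros eps He.
  set (r' := Rmax r 0).
  assert (Hr' : (0 <= r' < 1)%R).
  { split; [apply Rmax_r | apply Rmax_lub_lt; lra]. }
  destruct (lim_0_small _ eps (pow_lim_0 r' (/ (1 - r')) Hr') He) as [n Hn].
  exists (fun w => psum (fun k => h w ^ k) n). split.
  - clear Hn. induction n as [|n IH]; simpl; [apply uniflim_const|].
    apply uniflim_plus; [exact IH|].
    clear IH. induction n as [|n IH]; simpl; [apply uniflim_const|].
    apply uniflim_mult; assumption.
  - intros w Hw. assert (Bw := B w Hw).
    assert (Bw' : (Cmod (h w) <= r')%R) by (eapply Rle_trans; [exact Bw | apply Rmax_l]).
    assert (D : (1 - r' <= Cmod (1 - h w))%R).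
    { assert (T := Cmod_triangle (1 - h w) (h w)).
      replace (1 - h w + h w) with (RtoC 1) in T by ring. rewrite Cmod_1 in T. lra. }
    assert (N : 1 - h w <> 0) by (apply Cmod_gt_0; lra).
    assert (G : psum (fun k => h w ^ k) n - / (1 - h w) = - (h w ^ n) * / (1 - h w)).
    { clear Hn. induction n as [|n IH]; simpl; [field; exact N|].
      replace (psum (fun k => h w ^ k) n + h w ^ n - / (1 - h w))
        with (psum (fun k => h w ^ k) n - / (1 - h w) + h w ^ n) by ring.
      rewrite IH. field. exact N. }
    rewrite G, Cmod_mult, Cmod_opp, Cmod_pow, Cmod_inv by exact N.
    eapply Rle_trans; [|exact Hn]. rewrite Rmult_comm.
    apply Rmult_le_compat.
    + left. apply Rinv_0_lt_compat. lra.
    + apply pow_le, Cmod_ge_0.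
    + apply Rinv_le_contravar; lra.
    + apply pow_incr. split; [apply Cmod_ge_0 | exact Bw'].
Qed.

Lemma uniflim_qpoch_inf (r0 r : R) (h : C -> C) : (0 < r0)%R ->
  uniflim r0 h -> (forall w, (r0 <= Cmod w <= 1)%R -> (Cmod (h w) <= r)%R) ->
  uniflim r0 (fun w => qpoch_inf (h w) q).
Proof.
  intros Hr0 H B. apply uniflim_closed. intros eps He.
  destruct (lim_0_small _ eps (q_pow_lim
    (poch_bound r * (poch_lipschitz r * r))) He) as [n Hn].
  exists (fun w => qpoch (h w) q n). split.
  - clear Hn. induction n as [|n IH]; simpl; [apply uniflim_const|].
    apply uniflim_mult; [exact Hr0 | exact IH|].
    apply uniflim_ext with (fun w => 1 + (- (q ^ n)) * h w); [intros; ring|].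
    apply uniflim_plus; [apply uniflim_const | apply uniflim_scal; assumption].
  - intros w Hw. assert (Bw := B w Hw). rewrite (qpoch_inf_split (h w) n).
    replace (qpoch (h w) q n - qpoch (h w) q n * qpoch_inf (h w * q ^ n) q)
      with (- (qpoch (h w) q n * (qpoch_inf (h w * q ^ n) q - 1))) by ring.
    rewrite Cmod_opp, Cmod_mult. eapply Rle_trans; [|exact Hn].
    rewrite Rmult_assoc.
    apply Rmult_le_compat; auto using Cmod_ge_0.
    + apply Cmod_qpoch, Bw.
    + eapply Rle_trans; [apply qpoch_inf_near_1 with (r := r)|].
      * eapply Rle_trans; [apply Cmod_mult_q_pow_le | exact Bw].
      * rewrite Cmod_mult_q_pow, Rmult_assoc.
        apply Rmult_le_compat_l; [left; apply poch_lipschitz_pos|].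
        apply Rmult_le_compat_r; [left; apply q_pow_pos | exact Bw].
Qed.

Lemma uniflim_inv_qpoch_inf (r0 r : R) (h : C -> C) : (0 < r0)%R -> (r < 1)%R ->
  uniflim r0 h -> (forall w, (r0 <= Cmod w <= 1)%R -> (Cmod (h w) <= r)%R) ->
  uniflim r0 (fun w => / qpoch_inf (h w) q).
Proof.
  intros Hr0 Hr H B. apply uniflim_closed. intros eps He.
  destruct (lim_0_small _ eps (q_pow_lim
    (poch_inv_bound r * (poch_lipschitz r * r))) He) as [n Hn].
  assert (Reg : forall w, (r0 <= Cmod w <= 1)%R -> regular (h w)).
  { intros w Hw. apply regular_small. assert (Bw := B w Hw). lra. }
  exists (fun w => / qpoch (h w) q n). split.
  - clear Hn. induction n as [|n IH]; simpl.
    + apply uniflim_ext with (fun _ => 1); [intros; field | apply uniflim_const].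
    + apply uniflim_ext with (fun w => / qpoch (h w) q n * / (1 - h w * q ^ n)).
      { intros w Hw. assert (N := qpoch_neq_0 _ (S n) (Reg w Hw)). simpl in N.
        field. split.
        - intros E. apply N. rewrite E. ring.
        - intros E. apply N. rewrite E. ring. }
      apply uniflim_mult; [exact Hr0 | exact IH|].
      apply uniflim_inv_1_minus with r; [exact Hr0 | exact Hr | |].
      * apply uniflim_mult; [exact Hr0 | exact H | apply uniflim_const].
      * intros w Hw. eapply Rle_trans; [apply Cmod_mult_q_pow_le | apply B, Hw].
  - intros w Hw. assert (Bw := B w Hw).
    assert (N := qpoch_inf_neq_0 _ (Reg w Hw)).
    assert (N' := qpoch_neq_0 _ n (Reg w Hw)).
    replace (/ qpoch (h w) q n - / qpoch_inf (h w) q)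
      with (/ qpoch_inf (h w) q * (qpoch_inf (h w * q ^ n) q - 1)).
    2:{ rewrite (qpoch_inf_split (h w) n) in N |- *. field. split; [|exact N'].
        intros E; apply N; rewrite E; ring. }
    rewrite Cmod_mult. eapply Rle_trans; [|exact Hn].
    rewrite Rmult_assoc.
    apply Rmult_le_compat; auto using Cmod_ge_0.
    + apply Cmod_inv_qpoch_inf; assumption.
    + eapply Rle_trans; [apply qpoch_inf_near_1 with (r := r)|].
      * eapply Rle_trans; [apply Cmod_mult_q_pow_le | exact Bw].
      * rewrite Cmod_mult_q_pow, Rmult_assoc.
        apply Rmult_le_compat_l; [left; apply poch_lipschitz_pos|].
        apply Rmult_le_compat_r; [left; apply q_pow_pos | exact Bw].
Qed.

Lemma inv_INR_small (eps : R) : (0 < eps)%R ->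
  exists N, forall n, (N <= n)%nat -> (/ (INR n + 1) < eps)%R.
Proof.
  intros He.
  assert (L : is_lim_seq (fun n => Rbar_loc_seq 0%R n) 0%R) by apply is_lim_seq_Rbar_loc_seq.
  apply is_lim_seq_spec in L. destruct (L (mkposreal eps He)) as [N HN].
  exists N. intros n Hn. specialize (HN n Hn). simpl in HN. apply Rabs_def2 in HN. lra.
Qed.

(** Cauchy's theorem carries over to uniform limits. *)
Lemma uniflim_mean (r0 : R) (f : C -> C) : (0 < r0 <= 1)%R -> uniflim r0 f ->
  exists c, forall r t0, (r0 <= r <= 1)%R -> (t0 = 1 \/ t0 = -1)%R ->
    cint (fun t => f (r * cis (t0 * t))) 0 (2 * PI) c.
Proof.
  intros Hr0 H.
  assert (Pn : forall n, (0 < / (INR n + 1))%R).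
  { intros n. apply Rinv_0_lt_compat. assert (P := pos_INR n). lra. }
  set (p := fun n => proj1_sig (constructive_indefinite_description _ (H _ (Pn n)))).
  assert (Hp : forall n, laurent (p n) /\
    forall w, (r0 <= Cmod w <= 1)%R -> (Cmod (p n w - f w) <= / (INR n + 1))%R).
  { intros n. exact (proj2_sig (constructive_indefinite_description _ (H _ (Pn n)))). }
  set (l := fun n => proj1_sig (constructive_indefinite_description _
    (laurent_mean (p n) (proj1 (Hp n))))).
  assert (Hl : forall n r t0, (0 < r)%R -> (t0 = 1 \/ t0 = -1)%R ->
    cint (fun t => p n (r * cis (t0 * t))) 0 (2 * PI) (l n)).
  { intros n. exact (proj2_sig (constructive_indefinite_description _
      (laurent_mean (p n) (proj1 (Hp n))))). }
  assert (K : forall r t0, (r0 <= r <= 1)%R -> (t0 = 1 \/ t0 = -1)%R ->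
    exists c, clim l c /\ cint (fun t => f (r * cis (t0 * t))) 0 (2 * PI) c).
  { intros r t0 Hr Ht. apply cint_uniform with (fun n t => p n (r * cis (t0 * t))).
    - intros n. apply Hl; [lra | exact Ht].
    - intros eps He. destruct (inv_INR_small eps He) as [N HN].
      exists N. intros n t Hn. eapply Rle_lt_trans; [apply (Hp n) | apply HN, Hn].
      rewrite Cmod_mult, Cmod_cis, Cmod_R, Rabs_pos_eq; lra. }
  destruct (K r0 1%R) as [c [Lc _]]; [lra | left; reflexivity |].
  exists c. intros r t0 Hr Ht. destruct (K r t0 Hr Ht) as [c' [Lc' I]].
  rewrite (clim_unique _ _ _ Lc Lc'). exact I.
Qed.

(** * The Askey-Wilson integral *)

Definition aw_factor (a w : C) : C := / qpoch_inf (a * w) q * / qpoch_inf (a / w) q.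

Definition aw_weight (a b c d w : C) : C :=
  qpoch_inf (w * w) q * qpoch_inf (/ w / w) q
  * (aw_factor a w * aw_factor b w * aw_factor c w * aw_factor d w).

(** The factors [(s/w)_oo] of the weight can have zeros in the annulus
    [sqrt q <= |w| <= 1]; for [|s| < 1] the factors [(s q/w)_oo] have none. *)
Definition aw_half_factor (a w : C) : C := / qpoch_inf (a * w) q * / qpoch_inf (a * q / w) q.

Definition aw_half (a b c d w : C) : C :=
  w * (qpoch_inf (w * w) q * qpoch_inf (q / w / w) q)
  * (aw_half_factor a w * aw_half_factor b w * (aw_half_factor c w * aw_half_factor d w)).

Lemma sqrt_q_bounds : (0 < sqrt q < 1)%R /\ (sqrt q * sqrt q = q)%R.
Proof.
  destruct hq as [h0 h1]. split; [split|].
  - apply sqrt_lt_R0, h0.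
  - rewrite <- sqrt_1. apply sqrt_lt_1; lra.
  - apply sqrt_sqrt. lra.
Qed.

Lemma aw_half_factor_uniflim (a : C) : (Cmod a < 1)%R ->
  uniflim (sqrt q) (aw_half_factor a).
Proof.
  intros Ha. destruct sqrt_q_bounds as [[s0 s1] s2].
  assert (Pa := Cmod_ge_0 a).
  apply uniflim_mult; [exact s0 | |]; apply uniflim_inv_qpoch_inf with (Cmod a); auto.
  - apply uniflim_laurent, laurent_mult; [apply laurent_const | apply laurent_id].
  - intros w [_ Hw]. rewrite Cmod_mult. rewrite <- (Rmult_1_r (Cmod a)) at 2.
    apply Rmult_le_compat_l; assumption.
  - apply uniflim_laurent, laurent_mult; [apply laurent_const | apply laurent_inv].
  - intros w [Hw _]. assert (Hw0 : w <> 0) by (apply Cmod_gt_0; lra).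
    rewrite Cmod_div, Cmod_mult by exact Hw0.
    assert (Eq : Cmod q = q) by (rewrite Cmod_R, Rabs_pos_eq; destruct hq; lra).
    rewrite Eq. unfold Rdiv. rewrite Rmult_assoc.
    rewrite <- (Rmult_1_r (Cmod a)) at 2. apply Rmult_le_compat_l; [exact Pa|].
    apply Rle_div_l; [lra|]. rewrite <- s2. nra.
Qed.

Lemma aw_half_uniflim (a b c d : C) :
  (Cmod a < 1)%R -> (Cmod b < 1)%R -> (Cmod c < 1)%R -> (Cmod d < 1)%R ->
  uniflim (sqrt q) (aw_half a b c d).
Proof.
  intros Ha Hb Hc Hd. destruct sqrt_q_bounds as [[s0 s1] s2].
  assert (A := aw_half_factor_uniflim a Ha). assert (B := aw_half_factor_uniflim b Hb).
  assert (Cc := aw_half_factor_uniflim c Hc). assert (D := aw_half_factor_uniflim d Hd).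
  unfold aw_half.
  apply uniflim_mult; [exact s0 | |].
  - apply uniflim_mult; [exact s0 | apply uniflim_laurent, laurent_id |].
    assert (L1 : laurent (fun w => w * w)) by (apply laurent_mult; apply laurent_id).
    assert (L2 : laurent (fun w => q / w / w)).
    { unfold Cdiv. apply laurent_mult; [|apply laurent_inv].
      apply laurent_mult; [apply laurent_const | apply laurent_inv]. }
    destruct (laurent_bounded _ _ s0 L1) as [M1 [_ B1]].
    destruct (laurent_bounded _ _ s0 L2) as [M2 [_ B2]].
    apply uniflim_mult; [exact s0 | |].
    + apply (uniflim_qpoch_inf _ M1); auto using uniflim_laurent.
    + apply (uniflim_qpoch_inf _ M2); auto using uniflim_laurent.
  - apply uniflim_mult; [exact s0 | |]; apply uniflim_mult; assumption.
Qed.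

Lemma aw_half_reflect (a b c d w : C) : w <> 0 ->
  aw_half a b c d (q / w) = - aw_half a b c d w.
Proof.
  intros Hw. assert (Hq := q_neq_0).
  unfold aw_half, aw_half_factor.
  replace (q / w * (q / w)) with (q / w / w * q) by (field; exact Hw).
  replace (q / (q / w) / (q / w)) with (w * w / q) by (field; auto).
  rewrite (qpoch_inf_step (w * w / q)), (qpoch_inf_step (q / w / w)).
  replace (w * w / q * q) with (w * w) by (field; exact Hq).
  assert (E1 : forall x, x * (q / w) = x * q / w) by (intros; field; exact Hw).
  assert (E2 : forall x, x * q / (q / w) = x * w) by (intros; field; auto).
  rewrite !E1, !E2.
  replace (w * w / q) with (w * w * / q) by reflexivity.
  transitivity ((q / w * (1 - w * w * / q)) * qpoch_inf (q / w / w * q) q * qpoch_inf (w * w) q *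
   (/ qpoch_inf (a * w) q * / qpoch_inf (a * q / w) q *
   (/ qpoch_inf (b * w) q * / qpoch_inf (b * q / w) q) *
   (/ qpoch_inf (c * w) q * / qpoch_inf (c * q / w) q *
    (/ qpoch_inf (d * w) q * / qpoch_inf (d * q / w) q)))); [ring|].
  replace (q / w * (1 - w * w * / q)) with (- (w * (1 - q / w / w))) by (field; auto).
  ring.
Qed.

(** The contour [|w| = 1] may be moved to [|w| = sqrt q], on which
    [w -> q / w] is complex conjugation; there the mean is its own opposite. *)
Lemma aw_half_mean (a b c d : C) (e : R) :
  (Cmod a < 1)%R -> (Cmod b < 1)%R -> (Cmod c < 1)%R -> (Cmod d < 1)%R ->
  (e = 1 \/ e = -1)%R ->
  cint (fun t => aw_half a b c d (cis (e * t))) 0 (2 * PI) 0.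
Proof.
  intros Ha Hb Hc Hd He. destruct sqrt_q_bounds as [[s0 s1] s2].
  destruct (uniflim_mean (sqrt q) _ ltac:(lra) (aw_half_uniflim a b c d Ha Hb Hc Hd)) as [l Hl].
  assert (H1 := Hl (sqrt q) 1%R ltac:(lra) ltac:(auto)).
  assert (H2 := Hl (sqrt q) (-1)%R ltac:(lra) ltac:(auto)).
  assert (H3 := Hl 1%R e ltac:(lra) He).
  assert (Hs : RtoC (sqrt q) <> 0) by (intros E; apply RtoC_inj in E; lra).
  assert (E : l = - l).
  { apply (cint_unique _ _ _ _ _ H2).
    replace (- l) with (- (1) * l) by ring.
    apply cint_ext with (fun t => - (1) * aw_half a b c d (sqrt q * cis (1 * t))).
    - intros t _.
      replace (sqrt q * cis (-1 * t)) with (q / (sqrt q * cis (1 * t))).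
      + rewrite aw_half_reflect; [ring|]. apply Cmult_neq_0; [exact Hs | apply cis_neq_0].
      + replace (-1 * t)%R with (- (1 * t))%R by ring. rewrite cis_opp.
        replace (RtoC q) with (sqrt q * sqrt q) by (rewrite <- RtoC_mult, s2; reflexivity).
        field. split; [apply cis_neq_0 | exact Hs].
    - apply cint_scal, H1. }
  assert (E0 : l = 0).
  { replace l with ((l + l) / 2) by field. rewrite E at 2. field. }
  rewrite E0 in H3. apply cint_ext with (2 := H3).
  intros t _. f_equal. ring.
Qed.

(** Symmetrization under [w -> 1/w] leaves the weight times an affine function
    of [w + 1/w]; the vanishing of its mean gives the first moment. *)
Lemma aw_weight_moment (a b c d w : C) :
  Cmod w = 1%R ->
  (Cmod a < 1)%R -> (Cmod b < 1)%R -> (Cmod c < 1)%R -> (Cmod d < 1)%R ->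
  aw_half a b c d w + aw_half a b c d (/ w)
  = aw_weight a b c d w
    * ((1 - a * b * c * d) * (w + / w) - (a + b + c + d)
       + (a * b * c + a * b * d + a * c * d + b * c * d)).
Proof.
  intros Mw Ha Hb Hc Hd.
  assert (Hw : w <> 0) by (apply Cmod_gt_0; lra).
  assert (Ei : / / w = w) by (field; auto).
  assert (Mi : Cmod (/ w) = 1%R) by (rewrite Cmod_inv, Mw by exact Hw; field).
  assert (N1 : forall x, (Cmod x < 1)%R -> 1 - x * w <> 0).
  { intros x Hx E. assert (E' : RtoC 1 = x * w) by (apply Ceq_minus; exact E).
    assert (M := Cmod_1). rewrite E', Cmod_mult, Mw in M. lra. }
  assert (N2 : forall x, (Cmod x < 1)%R -> w - x <> 0).
  { intros x Hx E. assert (E' : w = x) by (apply Ceq_minus; exact E). rewrite <- E' in Hx. lra. }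
  assert (S1 : forall x, qpoch_inf (x * w) q = (1 - x * w) * qpoch_inf (x * q * w) q).
  { intros x. rewrite qpoch_inf_step. do 2 f_equal. ring. }
  assert (S2 : forall x, qpoch_inf (x / w) q = (1 - x / w) * qpoch_inf (x * q / w) q).
  { intros x. rewrite qpoch_inf_step. do 2 f_equal. unfold Cdiv. ring. }
  assert (F1 : forall x, (Cmod x < 1)%R -> qpoch_inf (x * q * w) q <> 0).
  { intros x Hx. apply qpoch_inf_neq_0, regular_small.
    rewrite !Cmod_mult, Mw, Cmod_R, Rabs_pos_eq by (destruct hq; lra).
    assert (P := Cmod_ge_0 x). destruct hq. nra. }
  assert (F2 : forall x, (Cmod x < 1)%R -> qpoch_inf (x * q / w) q <> 0).
  { intros x Hx. apply qpoch_inf_neq_0, regular_small. unfold Cdiv.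
    rewrite !Cmod_mult, Mi, Cmod_R, Rabs_pos_eq by (destruct hq; lra).
    assert (P := Cmod_ge_0 x). destruct hq. nra. }
  unfold aw_half, aw_weight, aw_half_factor, aw_factor.
  assert (D1 : forall x, x / / w = x * w) by (intros x; unfold Cdiv; rewrite Ei; reflexivity).
  rewrite !D1.
  assert (D2 : forall x, x * / w = x / w) by reflexivity. rewrite !D2.
  rewrite (S1 a), (S1 b), (S1 c), (S1 d), (S1 w).
  rewrite (S2 a), (S2 b), (S2 c), (S2 d), (S2 (/ w)).
  set (GW := qpoch_inf (w * q * w) q).
  replace (q * w * w) with (w * q * w) by ring. fold GW.
  replace (/ w * q / w) with (q / w / w) by (unfold Cdiv; ring).
  set (GV := qpoch_inf (q / w / w) q).
  assert (N1a := N1 a Ha). assert (N1b := N1 b Hb). assert (N1c := N1 c Hc). assert (N1d := N1 d Hd).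
  assert (N2a := N2 a Ha). assert (N2b := N2 b Hb). assert (N2c := N2 c Hc). assert (N2d := N2 d Hd).
  assert (F1a := F1 a Ha). assert (F1b := F1 b Hb). assert (F1c := F1 c Hc). assert (F1d := F1 d Hd).
  assert (F2a := F2 a Ha). assert (F2b := F2 b Hb). assert (F2c := F2 c Hc). assert (F2d := F2 d Hd).
  clear N1 N2 S1 S2 F1 F2 D1 D2.
  field. repeat split; assumption.
Qed.

Lemma aw_factor_uniflim (a : C) : (Cmod a < 1)%R -> uniflim 1 (aw_factor a).
Proof.
  intros Ha. assert (Pa := Cmod_ge_0 a).
  apply uniflim_mult; [lra | |]; apply uniflim_inv_qpoch_inf with (Cmod a); try lra.
  - apply uniflim_laurent, laurent_mult; [apply laurent_const | apply laurent_id].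
  - intros w [_ Hw]. rewrite Cmod_mult. nra.
  - apply uniflim_laurent, laurent_mult; [apply laurent_const | apply laurent_inv].
  - intros w [Hw _]. assert (Hw0 : w <> 0) by (apply Cmod_gt_0; lra).
    rewrite Cmod_div by exact Hw0. apply Rle_div_l; nra.
Qed.

Lemma aw_weight_uniflim (a b c d : C) :
  (Cmod a < 1)%R -> (Cmod b < 1)%R -> (Cmod c < 1)%R -> (Cmod d < 1)%R ->
  uniflim 1 (aw_weight a b c d).
Proof.
  intros Ha Hb Hc Hd. unfold aw_weight.
  assert (s0 : (0 < 1)%R) by lra.
  assert (L1 : laurent (fun w => w * w)) by (apply laurent_mult; apply laurent_id).
  assert (L2 : laurent (fun w => / w / w)) by (apply laurent_mult; apply laurent_inv).
  destruct (laurent_bounded _ _ s0 L1) as [M1 [_ B1]].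
  destruct (laurent_bounded _ _ s0 L2) as [M2 [_ B2]].
  apply uniflim_mult; [exact s0 | |].
  - apply uniflim_mult; [exact s0 | |].
    + apply (uniflim_qpoch_inf _ M1); auto using uniflim_laurent.
    + apply (uniflim_qpoch_inf _ M2); auto using uniflim_laurent.
  - apply uniflim_mult; [exact s0 | | apply aw_factor_uniflim, Hd].
    apply uniflim_mult; [exact s0 | | apply aw_factor_uniflim, Hc].
    apply uniflim_mult; [exact s0 | |]; apply aw_factor_uniflim; assumption.
Qed.

Lemma uniflim_circle (f : C -> C) : uniflim 1 f ->
  exists l, cint (fun t => f (cis t)) 0 (2 * PI) l.
Proof.
  intros H. destruct (uniflim_mean 1 f ltac:(lra) H) as [l Hl].
  exists l. apply cint_ext with (2 := Hl 1%R 1%R ltac:(lra) ltac:(auto)).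
  intros t _. rewrite Cmult_1_l, Rmult_1_l. reflexivity.
Qed.

Definition aw_integral (a b c d : C) : C :=
  RInt (V := C_R_CompleteNormedModule) (fun t => aw_weight a b c d (cis t)) 0 (2 * PI).

Lemma aw_integral_correct (a b c d : C) :
  (Cmod a < 1)%R -> (Cmod b < 1)%R -> (Cmod c < 1)%R -> (Cmod d < 1)%R ->
  cint (fun t => aw_weight a b c d (cis t)) 0 (2 * PI) (aw_integral a b c d).
Proof.
  intros Ha Hb Hc Hd. apply (RInt_correct (V := C_R_CompleteNormedModule)).
  destruct (uniflim_circle _ (aw_weight_uniflim a b c d Ha Hb Hc Hd)) as [l Hl].
  exists l. exact Hl.
Qed.

Lemma aw_integral_perm (a b c d a' b' c' d' : C) :
  (forall w, aw_weight a b c d w = aw_weight a' b' c' d' w) ->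
  aw_integral a b c d = aw_integral a' b' c' d'.
Proof.
  intros H. apply (RInt_ext (V := C_R_CompleteNormedModule)). intros t _. apply H.
Qed.

Lemma aw_factor_shift (a w : C) : w <> 0 -> Cmod w = 1%R -> (Cmod a < 1)%R ->
  aw_factor (a * q) w = aw_factor a w * (1 + a * a - a * (w + / w)).
Proof.
  intros Hw Mw Ha. unfold aw_factor.
  assert (Mi : Cmod (/ w) = 1%R) by (rewrite Cmod_inv, Mw by exact Hw; field).
  assert (N1 : qpoch_inf (a * w) q <> 0).
  { apply qpoch_inf_neq_0, regular_small. rewrite Cmod_mult, Mw. lra. }
  assert (N2 : qpoch_inf (a / w) q <> 0).
  { apply qpoch_inf_neq_0, regular_small. unfold Cdiv. rewrite Cmod_mult, Mi. lra. }
  rewrite (qpoch_inf_step (a * w)) in N1 |- *. rewrite (qpoch_inf_step (a / w)) in N2 |- *.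
  replace (a * q * w) with (a * w * q) by ring.
  replace (a * q / w) with (a / w * q) by (unfold Cdiv; ring).
  set (X := qpoch_inf (a * w * q) q) in *. set (Y := qpoch_inf (a / w * q) q) in *.
  assert (X0 : X <> 0) by (intros E; apply N1; rewrite E; ring).
  assert (Y0 : Y <> 0) by (intros E; apply N2; rewrite E; ring).
  assert (P0 : 1 - a * w <> 0) by (intros E; apply N1; rewrite E; ring).
  assert (Q0 : w - a <> 0).
  { intros E. apply N2. replace (1 - a / w) with ((w - a) / w) by (field; exact Hw).
    rewrite E. unfold Cdiv. ring. }
  field. repeat split; assumption.
Qed.

(** The weight for [a q] is the weight for [a] times [1 + a^2 - a (w + 1/w)], whose
    mean is known from the first moment. *)
Lemma aw_integral_step (a b c d : C) :
  (Cmod a < 1)%R -> (Cmod b < 1)%R -> (Cmod c < 1)%R -> (Cmod d < 1)%R ->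
  (1 - a * b * c * d) * aw_integral (a * q) b c d
  = (1 - a * b) * (1 - a * c) * (1 - a * d) * aw_integral a b c d.
Proof.
  intros Ha Hb Hc Hd.
  assert (Haq : (Cmod (a * q) < 1)%R).
  { rewrite Cmod_mult, Cmod_R, Rabs_pos_eq by (destruct hq; lra).
    assert (P := Cmod_ge_0 a). destruct hq. nra. }
  assert (W := aw_integral_correct a b c d Ha Hb Hc Hd).
  assert (W' := aw_integral_correct (a * q) b c d Haq Hb Hc Hd).
  assert (H1 := aw_half_mean a b c d 1%R Ha Hb Hc Hd ltac:(auto)).
  assert (H2 := aw_half_mean a b c d (-1)%R Ha Hb Hc Hd ltac:(auto)).
  assert (HM := cint_plus _ _ _ _ _ _ H1 H2).
  set (e1 := a + b + c + d) in *.
  set (e3 := a * b * c + a * b * d + a * c * d + b * c * d) in *.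
  assert (L := cint_plus _ _ _ _ _ _
    (cint_scal ((1 - a * b * c * d) * (1 + a * a) - a * (e1 - e3)) _ _ _ _ W)
    (cint_scal (- a) _ _ _ _ HM)).
  assert (R := cint_scal (1 - a * b * c * d) _ _ _ _ W').
  transitivity (((1 - a * b * c * d) * (1 + a * a) - a * (e1 - e3)) * aw_integral a b c d
    + - a * (0 + 0)); [|unfold e1, e3; ring].
  apply (cint_unique _ _ _ _ _ R). apply cint_ext with (2 := L).
  intros t _. cbv beta.
  replace (-1 * t)%R with (- t)%R by ring. rewrite Rmult_1_l, cis_opp.
  rewrite aw_weight_moment by (try apply Cmod_cis; assumption). fold e1 e3.
  unfold aw_weight. rewrite aw_factor_shift by (try apply Cmod_cis; try apply cis_neq_0; assumption).
  ring.
Qed.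

Lemma aw_factor_bound (a w : C) (r : R) : Cmod w = 1%R -> (Cmod a <= r)%R -> (r < 1)%R ->
  (Cmod (aw_factor a w) <= poch_inv_bound r * poch_inv_bound r)%R.
Proof.
  intros Mw Ha Hr. assert (Hw : w <> 0) by (apply Cmod_gt_0; lra).
  unfold aw_factor. rewrite Cmod_mult.
  apply Rmult_le_compat; auto using Cmod_ge_0; apply Cmod_inv_qpoch_inf; try assumption.
  - rewrite Cmod_mult, Mw. lra.
  - rewrite Cmod_div, Mw by exact Hw. lra.
Qed.

Lemma inv_qpoch_inf_near_1 (x : C) (r : R) : (Cmod x <= r)%R -> (r < 1)%R ->
  (Cmod (/ qpoch_inf x q - 1)
   <= poch_inv_bound r * (poch_lipschitz r * Cmod x))%R.
Proof.
  intros Hx Hr.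
  assert (N : qpoch_inf x q <> 0) by (apply qpoch_inf_neq_0, regular_small; lra).
  replace (/ qpoch_inf x q - 1) with (- (/ qpoch_inf x q * (qpoch_inf x q - 1)))
    by (field; exact N).
  rewrite Cmod_opp, Cmod_mult. apply Rmult_le_compat; auto using Cmod_ge_0.
  - apply Cmod_inv_qpoch_inf; assumption.
  - apply qpoch_inf_near_1, Hx.
Qed.

Lemma aw_factor_near_1 (a w : C) (r : R) : Cmod w = 1%R -> (Cmod a <= r)%R -> (r < 1)%R ->
  (Cmod (aw_factor a w - 1)
   <= (poch_inv_bound r + 1)
      * (poch_inv_bound r * (poch_lipschitz r * Cmod a)))%R.
Proof.
  intros Mw Ha Hr. assert (Hw : w <> 0) by (apply Cmod_gt_0; lra).
  assert (Pa := Cmod_ge_0 a).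
  assert (M1 : Cmod (a * w) = Cmod a) by (rewrite Cmod_mult, Mw; ring).
  assert (M2 : Cmod (a / w) = Cmod a) by (rewrite Cmod_div, Mw by exact Hw; field).
  unfold aw_factor.
  set (X := / qpoch_inf (a * w) q). set (Y := / qpoch_inf (a / w) q).
  replace (X * Y - 1) with (X * (Y - 1) + (X - 1)) by ring.
  eapply Rle_trans; [apply Cmod_triangle|].
  assert (BX : (Cmod X <= poch_inv_bound r)%R)
    by (apply Cmod_inv_qpoch_inf; [rewrite M1; exact Ha | exact Hr]).
  assert (NX := inv_qpoch_inf_near_1 (a * w) r ltac:(rewrite M1; exact Ha) Hr).
  assert (NY := inv_qpoch_inf_near_1 (a / w) r ltac:(rewrite M2; exact Ha) Hr).
  rewrite M1 in NX. rewrite M2 in NY. fold X in NX. fold Y in NY.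
  rewrite Cmod_mult, Rmult_plus_distr_r, Rmult_1_l.
  apply Rplus_le_compat; [|exact NX].
  apply Rmult_le_compat; auto using Cmod_ge_0.
Qed.

Lemma aw_integral_clim (a b c d : C) :
  (Cmod a < 1)%R -> (Cmod b < 1)%R -> (Cmod c < 1)%R -> (Cmod d < 1)%R ->
  clim (fun n => aw_integral (a * q ^ n) b c d) (aw_integral 0 b c d).
Proof.
  intros Ha Hb Hc Hd.
  assert (Pa := Cmod_ge_0 a).
  assert (H0 : (Cmod 0 < 1)%R) by (rewrite Cmod_0; lra).
  assert (Hn : forall n, (Cmod (a * q ^ n) <= Cmod a)%R) by (intros; apply Cmod_mult_q_pow_le).
  destruct (uniflim_bounded 1 _ ltac:(lra) (aw_weight_uniflim 0 b c d H0 Hb Hc Hd)) as [M [HM BM]].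
  set (r := Cmod a) in *.
  set (K := ((poch_inv_bound r + 1)
      * (poch_inv_bound r * (poch_lipschitz r * r)))%R).
  destruct (cint_uniform (fun n t => aw_weight (a * q ^ n) b c d (cis t))
    (fun t => aw_weight 0 b c d (cis t)) 0 (2 * PI) (fun n => aw_integral (a * q ^ n) b c d))
    as [m [Lm Im]].
  - intros n. apply aw_integral_correct; auto. specialize (Hn n). lra.
  - intros eps He.
    assert (L := q_pow_lim (M * K)). apply is_lim_seq_spec in L.
    destruct (L (mkposreal eps He)) as [N HN]. simpl in HN.
    exists N. intros n t Hnt. specialize (HN n Hnt). rewrite Rminus_0_r in HN.
    eapply Rle_lt_trans; [|apply (Rle_lt_trans _ _ _ (Rle_abs _) HN)].
    assert (E : aw_factor 0 (cis t) = 1).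
    { unfold aw_factor, Cdiv. rewrite !Cmult_0_l, qpoch_inf_0. field. }
    replace (aw_weight (a * q ^ n) b c d (cis t) - aw_weight 0 b c d (cis t))
      with (aw_weight 0 b c d (cis t) * (aw_factor (a * q ^ n) (cis t) - 1))
      by (unfold aw_weight; rewrite E; ring).
    rewrite Cmod_mult, Rmult_assoc. apply Rmult_le_compat; auto using Cmod_ge_0.
    + apply BM. rewrite Cmod_cis. lra.
    + eapply Rle_trans; [apply (aw_factor_near_1 _ _ r (Cmod_cis t) (Hn n) Ha)|].
      rewrite Cmod_mult_q_pow. unfold K, r. right. ring.
  - rewrite (cint_unique _ _ _ _ _ (aw_integral_correct 0 b c d H0 Hb Hc Hd) Im). exact Lm.
Qed.

Lemma aw_integral_reduce (a b c d : C) :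
  (Cmod a < 1)%R -> (Cmod b < 1)%R -> (Cmod c < 1)%R -> (Cmod d < 1)%R ->
  qpoch_inf (a * b) q * qpoch_inf (a * c) q * qpoch_inf (a * d) q * aw_integral a b c d
  = qpoch_inf (a * b * c * d) q * aw_integral 0 b c d.
Proof.
  intros Ha Hb Hc Hd.
  assert (E : forall n, qpoch (a * b) q n * qpoch (a * c) q n * qpoch (a * d) q n
     * aw_integral a b c d
     = qpoch (a * b * c * d) q n * aw_integral (a * q ^ n) b c d).
  { induction n as [|n IH].
    - simpl. replace (a * 1) with a by ring. ring.
    - assert (Hn : (Cmod (a * q ^ n) < 1)%R)
        by (eapply Rle_lt_trans; [apply Cmod_mult_q_pow_le | exact Ha]).
      assert (S := aw_integral_step (a * q ^ n) b c d Hn Hb Hc Hd).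
      simpl. replace (a * (q * q ^ n)) with (a * q ^ n * q) by ring.
      replace (a * b * c * d * q ^ n) with (a * q ^ n * b * c * d) by ring.
      replace (a * b * q ^ n) with (a * q ^ n * b) by ring.
      replace (a * c * q ^ n) with (a * q ^ n * c) by ring.
      replace (a * d * q ^ n) with (a * q ^ n * d) by ring.
      rewrite <- (Cmult_assoc (qpoch (a * b * c * d) q n)), S.
      transitivity ((qpoch (a * b) q n * qpoch (a * c) q n * qpoch (a * d) q n
        * aw_integral a b c d) * ((1 - a * q ^ n * b) * (1 - a * q ^ n * c)
           * (1 - a * q ^ n * d))); [ring|].
      rewrite IH. ring. }
  apply clim_unique with (fun n => qpoch (a * b) q n * qpoch (a * c) q n * qpoch (a * d) q n
     * aw_integral a b c d).
  - apply clim_mult; [|apply clim_const]. repeat apply clim_mult; apply qpoch_lim.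
  - apply clim_ext with (fun n => qpoch (a * b * c * d) q n * aw_integral (a * q ^ n) b c d).
    { intros n. symmetry. apply E. }
    apply clim_mult; [apply qpoch_lim | apply aw_integral_clim; assumption].
Qed.

(** The parameters are sent to zero one after the other. *)
Lemma aw_integral_up_to_constant (a b c d : C) :
  (Cmod a < 1)%R -> (Cmod b < 1)%R -> (Cmod c < 1)%R -> (Cmod d < 1)%R ->
  qpoch_inf (a * b) q * qpoch_inf (a * c) q * qpoch_inf (a * d) q
  * (qpoch_inf (b * c) q * qpoch_inf (b * d) q * qpoch_inf (c * d) q) * aw_integral a b c d
  = qpoch_inf (a * b * c * d) q * aw_integral 0 0 0 0.
Proof.
  intros Ha Hb Hc Hd.
  assert (H0 : (Cmod 0 < 1)%R) by (rewrite Cmod_0; lra).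
  assert (Z : forall x, qpoch_inf (x * 0) q = 1).
  { intros x. rewrite Cmult_0_r. apply qpoch_inf_0. }
  assert (Z' : forall x, qpoch_inf (0 * x) q = 1).
  { intros x. rewrite Cmult_0_l. apply qpoch_inf_0. }
  assert (Zm : forall x y, qpoch_inf (x * 0 * y) q = 1).
  { intros x y. replace (x * 0 * y) with (RtoC 0) by ring. apply qpoch_inf_0. }
  assert (E1 := aw_integral_reduce a b c d Ha Hb Hc Hd).
  assert (E2 := aw_integral_reduce b 0 c d Hb H0 Hc Hd).
  assert (E3 := aw_integral_reduce c 0 0 d Hc H0 H0 Hd).
  assert (E4 := aw_integral_reduce d 0 0 0 Hd H0 H0 H0).
  assert (P2 : aw_integral 0 b c d = aw_integral b 0 c d)
    by (apply aw_integral_perm; intros; unfold aw_weight; ring).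
  assert (P3 : aw_integral 0 0 c d = aw_integral c 0 0 d)
    by (apply aw_integral_perm; intros; unfold aw_weight; ring).
  assert (P4 : aw_integral 0 0 0 d = aw_integral d 0 0 0)
    by (apply aw_integral_perm; intros; unfold aw_weight; ring).
  replace (b * 0 * c * d) with (b * 0 * (c * d)) in E2 by ring.
  replace (c * 0 * 0 * d) with (c * 0 * (0 * d)) in E3 by ring.
  rewrite ?Z, ?Zm, P3 in E2. rewrite ?Z, ?Zm, P4 in E3. rewrite ?Z, ?Zm in E4.
  rewrite P2 in E1.
  transitivity (qpoch_inf (b * c) q * qpoch_inf (b * d) q * qpoch_inf (c * d) q *
    (qpoch_inf (a * b) q * qpoch_inf (a * c) q * qpoch_inf (a * d) q * aw_integral a b c d));
    [ring|].
  rewrite E1.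
  transitivity (qpoch_inf (a * b * c * d) q * qpoch_inf (c * d) q *
    (1 * qpoch_inf (b * c) q * qpoch_inf (b * d) q * aw_integral b 0 c d)); [ring|].
  rewrite E2.
  transitivity (qpoch_inf (a * b * c * d) q * (1 * 1 * qpoch_inf (c * d) q * aw_integral c 0 0 d));
    [ring|].
  rewrite E3.
  transitivity (qpoch_inf (a * b * c * d) q * (1 * 1 * 1 * aw_integral d 0 0 0)); [ring|].
  rewrite E4. ring.
Qed.

Lemma qpoch_quadruple (s x : C) (n : nat) : s * s = q ->
  qpoch x q n * qpoch (- x) q n * qpoch (s * x) q n * qpoch (- (s * x)) q n
  = qpoch (x * x) q (2 * n).
Proof.
  intros Hs. induction n as [|n IH]; [simpl; ring|].
  replace (2 * S n)%nat with (S (S (2 * n))) by lia.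
  change (qpoch (x * x) q (S (S (2 * n)))) with
    (qpoch (x * x) q (2 * n) * (1 - x * x * q ^ (2 * n)) * (1 - x * x * q ^ (S (2 * n)))).
  rewrite <- IH. simpl qpoch.
  replace (q ^ (S (2 * n))) with (s * s * q ^ (2 * n)) by (rewrite Hs; reflexivity).
  replace (q ^ (2 * n)) with (q ^ n * q ^ n)
    by (rewrite <- Cpow_add_r; f_equal; lia).
  ring.
Qed.

Lemma qpoch_inf_quadruple (s x : C) : s * s = q ->
  qpoch_inf x q * qpoch_inf (- x) q * qpoch_inf (s * x) q * qpoch_inf (- (s * x)) q
  = qpoch_inf (x * x) q.
Proof.
  intros Hs.
  apply clim_unique with (fun n => qpoch (x * x) q (2 * n)).
  - apply clim_ext with (fun n => qpoch x q n * qpoch (- x) q n * qpoch (s * x) q n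
      * qpoch (- (s * x)) q n).
    { intros n. apply qpoch_quadruple, Hs. }
    repeat apply clim_mult; apply qpoch_lim.
  - assert (L := qpoch_lim (x * x)). unfold clim in *.
    apply (is_lim_seq_subseq (fun n => Cmod (qpoch (x * x) q n - qpoch_inf (x * x) q)) _
      (fun n => (2 * n)%nat)); [|exact L].
    apply eventually_subseq. intros n. lia.
Qed.

Lemma Cmod_small (x : R) : (0 <= x < 1)%R -> (Cmod x < 1)%R /\ (Cmod (- x) < 1)%R.
Proof. intros H. rewrite Cmod_opp. split; apply Cmod_real_lt_1, H. Qed.

(** At [q, -q, sqrt q, - sqrt q] the weight is [(1 - w^2) (1 - w^-2)]. *)
Lemma aw_integral_0 : qpoch_inf q q * aw_integral 0 0 0 0 = 4 * PI.
Proof.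
  destruct sqrt_q_bounds as [[s0 s1] s2]. destruct hq as [h0 h1].
  set (s := RtoC (sqrt q)).
  assert (Hs : s * s = q) by (unfold s; rewrite <- RtoC_mult, s2; reflexivity).
  destruct (Cmod_small q ltac:(lra)) as [Mq Mq'].
  destruct (Cmod_small (sqrt q) ltac:(lra)) as [Ms Ms']. fold s in Ms, Ms'.
  assert (I : aw_integral q (- q) s (- s) = 4 * PI).
  { assert (W := aw_integral_correct q (- q) s (- s) Mq Mq' Ms Ms').
    apply (cint_unique _ _ _ _ _ W).
    assert (P : forall m : R, m <> 0%R -> (m = 2 \/ m = -2)%R ->
      cint (fun t => cis (m * t)) 0 (2 * PI) 0).
    { intros m Hm Hm'. apply cint_cis; [exact Hm|].
      assert (E : cis (2 * (2 * PI)) = 1).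
      { replace (2 * (2 * PI))%R with (2 * PI + 2 * PI)%R by ring.
        rewrite cis_plus, cis_2PI. ring. }
      destruct Hm' as [->| ->]; [exact E|].
      replace (-2 * (2 * PI))%R with (- (2 * (2 * PI)))%R by ring. rewrite cis_opp, E. field. }
    assert (Q := cint_plus _ _ _ _ _ _ (cint_const 2 0 (2 * PI))
      (cint_plus _ _ _ _ _ _ (cint_scal (- (1)) _ _ _ _ (P 2%R ltac:(lra) ltac:(auto)))
                              (cint_scal (- (1)) _ _ _ _ (P (-2)%R ltac:(lra) ltac:(auto))))).
    replace (4 * PI) with ((2 * PI - 0)%R * 2 + (- (1) * 0 + - (1) * 0)).
    2:{ rewrite RtoC_minus, RtoC_mult. ring. }
    apply cint_ext with (2 := Q). intros t _. cbv beta.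
    assert (Hw := cis_neq_0 t). assert (Mw := Cmod_cis t).
    replace (2 * t)%R with (t + t)%R by ring. rewrite cis_plus.
    replace (-2 * t)%R with (- t + - t)%R by ring. rewrite cis_plus, cis_opp.
    set (w := cis t) in *.
    unfold aw_weight, aw_factor, Cdiv.
    rewrite <- (qpoch_inf_quadruple s w Hs), <- (qpoch_inf_quadruple s (/ w) Hs).
    replace (- q * w) with (- (q * w)) by ring. replace (- s * w) with (- (s * w)) by ring.
    replace (- q * / w) with (- (q * / w)) by ring. replace (- s * / w) with (- (s * / w)) by ring.
    rewrite (qpoch_inf_step w), (qpoch_inf_step (- w)), (qpoch_inf_step (/ w)),
      (qpoch_inf_step (- / w)).
    replace (w * q) with (q * w) by ring. replace (- w * q) with (- (q * w)) by ring.
    replace (/ w * q) with (q * / w) by ring. replace (- / w * q) with (- (q * / w)) by ring.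
    assert (F : forall x, (Cmod x < 1)%R -> qpoch_inf (x * w) q <> 0
      /\ qpoch_inf (- (x * w)) q <> 0 /\ qpoch_inf (x * / w) q <> 0
      /\ qpoch_inf (- (x * / w)) q <> 0).
    { intros x Hx. assert (Mi : Cmod (/ w) = 1%R) by (rewrite Cmod_inv, Mw by exact Hw; field).
      repeat split; apply qpoch_inf_neq_0, regular_small;
        rewrite ?Cmod_opp, Cmod_mult, ?Mw, ?Mi; lra. }
    destruct (F (RtoC q) Mq) as [A1 [A2 [A3 A4]]].
    destruct (F s Ms) as [B1 [B2 [B3 B4]]].
    field. repeat split; assumption. }
  assert (U := aw_integral_up_to_constant q (- q) s (- s) Mq Mq' Ms Ms').
  rewrite I in U.
  assert (N := qpoch_inf_neq_0 _ regular_q).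
  (* Euler's identity: the fourfold product formula at [x = s], divided by [(q)_oo]. *)
  assert (E0 : qpoch_inf s q * qpoch_inf (- s) q * qpoch_inf (- q) q = 1).
  { assert (Q := qpoch_inf_quadruple s s Hs). rewrite Hs in Q.
    transitivity (/ qpoch_inf q q *
      (qpoch_inf s q * qpoch_inf (- s) q * qpoch_inf q q * qpoch_inf (- q) q)).
    - field. exact N.
    - rewrite Q. field. exact N. }
  rewrite (qpoch_inf_step s), (qpoch_inf_step (- s)) in E0.
  assert (E1 : (1 - q) * (qpoch_inf (s * q) q * qpoch_inf (- s * q) q) * qpoch_inf (- q) q = 1).
  { etransitivity; [|exact E0].
    replace (1 - q) with ((1 - s) * (1 - - s)) by (rewrite <- Hs; ring). ring. }
  assert (E2 := E1). rewrite (qpoch_inf_step (- q)) in E2.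
  replace (q * - q) with (- q * q) in U by ring.
  replace (q * s) with (s * q) in U by ring. replace (q * - s) with (- s * q) in U by ring.
  replace (- q * s) with (- s * q) in U by ring. replace (- q * - s) with (s * q) in U by ring.
  replace (s * - s) with (- q) in U by (rewrite <- Hs; ring).
  replace (- q * q * s * - s) with (q * q * q) in U by (rewrite <- Hs at 3; ring).
  rewrite (qpoch_inf_step q), (qpoch_inf_step (q * q)).
  transitivity ((1 - q) * (1 - q * q) * (qpoch_inf (q * q * q) q * aw_integral 0 0 0 0)); [ring|].
  rewrite <- U.
  transitivity (((1 - q) * (qpoch_inf (s * q) q * qpoch_inf (- s * q) q)
      * ((1 - - q) * qpoch_inf (- q * q) q))
    * ((1 - q) * (qpoch_inf (s * q) q * qpoch_inf (- s * q) q) * qpoch_inf (- q) q)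
    * (4 * PI)); [ring|].
  rewrite E1, E2. ring.
Qed.

Lemma aw_integral_half_range (a b c d : C) :
  (Cmod a < 1)%R -> (Cmod b < 1)%R -> (Cmod c < 1)%R -> (Cmod d < 1)%R ->
  cint (fun t => aw_weight a b c d (cis t)) 0 PI (aw_integral a b c d / 2).
Proof.
  intros Ha Hb Hc Hd.
  assert (W := aw_integral_correct a b c d Ha Hb Hc Hd).
  assert (PP := PI_RGT_0).
  assert (X : exists l : C, cint (fun t => aw_weight a b c d (cis t)) 0 PI l).
  { apply (ex_RInt_Chasles_1 (V := C_R_CompleteNormedModule)
      (fun t => aw_weight a b c d (cis t)) 0 PI (2 * PI)); [lra | eexists; exact W]. }
  destruct X as [l Hl].
  assert (Hl' : cint (fun t => aw_weight a b c d (cis t)) PI (2 * PI) l).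
  { assert (S := is_RInt_swap (V := C_R_NormedModule) _ _ _ _ Hl).
    assert (S' := is_RInt_comp_lin (V := C_R_NormedModule)
      (fun t => aw_weight a b c d (cis t)) (-1) (2 * PI) PI (2 * PI) (opp l)).
    replace (-1 * PI + 2 * PI)%R with PI in S' by ring.
    replace (-1 * (2 * PI) + 2 * PI)%R with 0%R in S' by ring.
    specialize (S' S).
    assert (S2 := cint_scal (- (1)) _ _ _ _ S').
    replace (- (1) * opp l) with l in S2 by (change (opp l) with (- l); ring).
    apply cint_ext with (2 := S2). intros t _. cbv beta.
    rewrite scal_R_Cmult.
    replace (-1 * t + 2 * PI)%R with (- t + 2 * PI)%R by ring.
    rewrite cis_plus, cis_2PI, cis_opp, Cmult_1_r.
    assert (Hw := cis_neq_0 t). assert (Ei : / / cis t = cis t) by (field; auto).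
    unfold aw_weight, aw_factor, Cdiv. rewrite Ei. ring. }
  assert (E := cint_unique _ _ _ _ _ W
    (is_RInt_Chasles (V := C_R_NormedModule) _ _ _ _ _ _ Hl Hl')).
  rewrite E. change (plus l l) with (l + l). replace ((l + l) / 2) with l by field. exact Hl.
Qed.

(** For the product of two parameters equal to [q], the quotient
    [(a b c d)_oo / (a b)_oo] of the general formula is [1 / (1 - a b)]. *)
Theorem aw_integral_theta (a b al : C) : al <> 0 ->
  (Cmod a < 1)%R -> (Cmod b < 1)%R -> (Cmod al < 1)%R -> (Cmod (q / al) < 1)%R ->
  cint (fun t => aw_weight a b al (q / al) (cis t)) 0 PI
    (2 * PI / (qpoch_inf q q * qpoch_inf q q)
     * / (1 - a * b)
     * (/ qpoch_inf (al * a) q * / qpoch_inf (q * a / al) q)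
     * (/ qpoch_inf (al * b) q * / qpoch_inf (q * b / al) q)).
Proof.
  intros Hal Ha Hb Mal Mql.
  assert (H := aw_integral_half_range a b al (q / al) Ha Hb Mal Mql).
  assert (U := aw_integral_up_to_constant a b al (q / al) Ha Hb Mal Mql).
  assert (A0 := aw_integral_0).
  replace (al * (q / al)) with (RtoC q) in U by (field; exact Hal).
  replace (a * b * al * (q / al)) with (a * b * q) in U by (field; exact Hal).
  replace (a * (q / al)) with (q * a / al) in U by (field; exact Hal).
  replace (b * (q / al)) with (q * b / al) in U by (field; exact Hal).
  replace (a * al) with (al * a) in U by ring. replace (b * al) with (al * b) in U by ring.
  rewrite (qpoch_inf_step (a * b)) in U.
  assert (R1 : forall x y, (Cmod x < 1)%R -> (Cmod y < 1)%R -> qpoch_inf (x * y) q <> 0).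
  { intros x y Hx Hy. apply qpoch_inf_neq_0, regular_small. rewrite Cmod_mult.
    assert (P1 := Cmod_ge_0 x). assert (P2 := Cmod_ge_0 y). nra. }
  assert (N1 := R1 a b Ha Hb). rewrite (qpoch_inf_step (a * b)) in N1.
  assert (N1a : 1 - a * b <> 0) by (intros E; apply N1; rewrite E; ring).
  assert (N1b : qpoch_inf (a * b * q) q <> 0) by (intros E; apply N1; rewrite E; ring).
  assert (N2 := R1 al a Mal Ha). assert (N3 := R1 al b Mal Hb).
  assert (N4 : qpoch_inf (q * a / al) q <> 0).
  { replace (q * a / al) with (a * (q / al)) by (field; exact Hal). apply R1; assumption. }
  assert (N5 : qpoch_inf (q * b / al) q <> 0).
  { replace (q * b / al) with (b * (q / al)) by (field; exact Hal). apply R1; assumption. }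
  assert (N6 := qpoch_inf_neq_0 _ regular_q).
  assert (V : aw_integral a b al (q / al)
    = / ((1 - a * b) * qpoch_inf (al * a) q * qpoch_inf (q * a / al) q
         * qpoch_inf (al * b) q * qpoch_inf (q * b / al) q * qpoch_inf q q * qpoch_inf q q)
      * (4 * PI)).
  { rewrite <- A0.
    transitivity (/ ((1 - a * b) * qpoch_inf (a * b * q) q * qpoch_inf (al * a) q
         * qpoch_inf (q * a / al) q * qpoch_inf (al * b) q * qpoch_inf (q * b / al) q
         * qpoch_inf q q) * (qpoch_inf (a * b * q) q * aw_integral 0 0 0 0)).
    - rewrite <- U. field. repeat split; assumption.
    - field. repeat split; assumption. }
  replace (2 * PI / (qpoch_inf q q * qpoch_inf q q)
     * / (1 - a * b)
     * (/ qpoch_inf (al * a) q * / qpoch_inf (q * a / al) q)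
     * (/ qpoch_inf (al * b) q * / qpoch_inf (q * b / al) q))
    with (aw_integral a b al (q / al) / 2); [exact H|].
  rewrite V. field. repeat split; assumption.
Qed.

(** * Termwise integration of a product of two sides *)

Lemma cint_series (f : nat -> R -> C) (l : nat -> C) (a b M : R) :
  (forall n, cint (f n) a b (l n)) ->
  (forall n t, (Cmod (f n t) <= M * q ^ n)%R) ->
  exists m, csum l m /\ cint (fun t => Cseries (fun n => f n t)) a b m.
Proof.
  intros Hf HM. unfold csum.
  apply cint_uniform with (fun N t => psum (fun n => f n t) N).
  - intros N. induction N as [|N IH]; simpl.
    + assert (Z := cint_const 0 a b). rewrite Cmult_0_r in Z. exact Z.
    + apply cint_plus; [exact IH | apply Hf].
  - intros eps He.
    assert (L := q_pow_lim (M / (1 - q))). apply is_lim_seq_spec in L.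
    destruct (L (mkposreal eps He)) as [N HN]. simpl in HN.
    exists N. intros n t Hn. specialize (HN n Hn). rewrite Rminus_0_r in HN.
    rewrite Cmod_minus_sym.
    assert (D : dominated M (fun n => f n t)) by (intros k; apply HM).
    eapply Rle_lt_trans; [apply (dominated_tail M _ n D)|].
    eapply Rle_lt_trans; [|apply (Rle_lt_trans _ _ _ (Rle_abs _) HN)].
    right. field. destruct hq. lra.
Qed.

(** What does not depend on [w] in [side_coef s r u v]; likewise for [row_factor]
    and [side_factor]. *)
Definition row_coef (s r u v Z1 Z2 : C) (n : nat) : C :=
  qpoch_inf (r * u * q ^ n) q * qpoch_inf (r * v * q ^ n) q
  * (qpoch (Z1 / s) q n * qpoch (Z2 / s) q n)
  * (/ qpoch q q n * / qpoch (r / s * q) q n).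

Definition row_factor (s r Z1 Z2 : C) : C :=
  qpoch_inf (Z1 / r) q * qpoch_inf (Z2 / r) q / qpoch_inf (s / r) q.

Lemma row_coef_bdd {I : Type} (s r u v Z1 Z2 : C) (n : I -> nat) :
  regular (r / s) -> bdd (fun i => row_coef s r u v Z1 Z2 (n i)).
Proof. intros H. assert (H' := regular_mult_q _ H). unfold row_coef. bdd. Qed.

Lemma aw_factor_bdd {I : Type} (a : C) (n : I -> nat) (t : I -> R) : (Cmod a < 1)%R ->
  bdd (fun i => aw_factor (a * q ^ n i) (cis (t i))).
Proof.
  intros Ha. exists (poch_inv_bound (Cmod a) * poch_inv_bound (Cmod a))%R.
  intros i. apply aw_factor_bound.
  - apply Cmod_cis.
  - apply Cmod_mult_q_pow_le.
  - exact Ha.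
Qed.

Lemma aw_factor_bdd0 {I : Type} (a : C) (t : I -> R) : (Cmod a < 1)%R ->
  bdd (fun i => aw_factor a (cis (t i))).
Proof.
  intros Ha. destruct (aw_factor_bdd a (fun _ : I => O) t Ha) as [M HM].
  exists M. intros i. specialize (HM i). simpl in HM. rewrite Cmult_1_r in HM. exact HM.
Qed.

Lemma cis_bdd {I : Type} (t : I -> R) : bdd (fun i => cis (t i)).
Proof. exists 1%R. intros i. rewrite Cmod_cis. lra. Qed.

Lemma inv_cis_bdd {I : Type} (t : I -> R) : bdd (fun i => / cis (t i)).
Proof. exists 1%R. intros i. rewrite Cmod_inv, Cmod_cis by apply cis_neq_0. lra. Qed.

Lemma aw_weight_bdd {I : Type} (a b c d : C) (n k : I -> nat) (t : I -> R) :
  (Cmod a < 1)%R -> (Cmod b < 1)%R -> (Cmod c < 1)%R -> (Cmod d < 1)%R ->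
  bdd (fun i => aw_weight (a * q ^ n i) (b * q ^ k i) c d (cis (t i))).
Proof.
  intros Ha Hb Hc Hd. unfold aw_weight.
  assert (B1 := aw_factor_bdd a n t Ha). assert (B2 := aw_factor_bdd b k t Hb).
  assert (B3 := aw_factor_bdd0 c t Hc). assert (B4 := aw_factor_bdd0 d t Hd).
  assert (B5 := cis_bdd t). assert (B6 := inv_cis_bdd t).
  bdd.
Qed.

Lemma qpoch_inf_circle_neq_0 (a w : C) : Cmod w = 1%R -> (Cmod a < 1)%R ->
  qpoch_inf (a * w) q <> 0 /\ qpoch_inf (a / w) q <> 0.
Proof.
  intros Mw Ha. assert (Hw : w <> 0) by (apply Cmod_gt_0; lra).
  split; apply qpoch_inf_neq_0, regular_small.
  - rewrite Cmod_mult, Mw. lra.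
  - rewrite Cmod_div, Mw by exact Hw. lra.
Qed.

Lemma aw_factor_qpow (a w : C) (n : nat) : Cmod w = 1%R -> (Cmod a < 1)%R ->
  aw_factor (a * q ^ n) w
  = aw_factor a w * (qpoch (a * w) q n * qpoch (a / w) q n).
Proof.
  intros Mw Ha. destruct (qpoch_inf_circle_neq_0 a w Mw Ha) as [N1 N2].
  unfold aw_factor.
  rewrite (qpoch_inf_split (a * w) n) in N1 |- *. rewrite (qpoch_inf_split (a / w) n) in N2 |- *.
  replace (a * q ^ n * w) with (a * w * q ^ n) by ring.
  replace (a * q ^ n / w) with (a / w * q ^ n) by (unfold Cdiv; ring).
  field. repeat split; intros E; first [apply N1; rewrite E; ring | apply N2; rewrite E; ring].
Qed.

(** The prefactor [(s w, s/w)_oo] cancels the factor of [s] in the weight, and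
    [(r w, r/w)_n] changes the factor of [r] into that of [r q^n]. *)
Lemma side_times_factors (s r u v Z1 Z2 w : C) :
  Cmod w = 1%R -> (Cmod r < 1)%R -> (Cmod s < 1)%R -> regular (r / s) ->
  side s r u v Z1 Z2 w * (aw_factor r w * aw_factor s w)
  = row_factor s r Z1 Z2
    * Cseries (fun n => row_coef s r u v Z1 Z2 n * aw_factor (r * q ^ n) w
                        * q ^ n).
Proof.
  intros Mw Hr Hs H. destruct (side_dominated s r u v Z1 Z2 w H) as [M HM].
  destruct (qpoch_inf_circle_neq_0 s w Mw Hs) as [N1 N2].
  rewrite (Cseries_ext _ (fun n => aw_factor r w
    * (side_coef s r u v Z1 Z2 w n * q ^ n))).
  - rewrite (Cseries_scal _ _ _ HM). unfold side, side_factor, row_factor.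
    set (S := Cseries _).
    change (aw_factor s w) with (/ qpoch_inf (s * w) q * / qpoch_inf (s / w) q).
    unfold Cdiv in *.
    transitivity (qpoch_inf (Z1 * / r) q * qpoch_inf (Z2 * / r) q * / qpoch_inf (s * / r) q * S
      * aw_factor r w
      * (qpoch_inf (s * w) q * / qpoch_inf (s * w) q)
      * (qpoch_inf (s * / w) q * / qpoch_inf (s * / w) q)); [ring|].
    rewrite !Cinv_r by assumption. ring.
  - intros n. rewrite aw_factor_qpow by assumption. unfold side_coef, row_coef. ring.
Qed.

Definition theta_value (al A B : C) : C :=
  2 * PI / (qpoch_inf q q * qpoch_inf q q)
     * / (1 - A * B)
     * (/ qpoch_inf (al * A) q * / qpoch_inf (q * A / al) q)
     * (/ qpoch_inf (al * B) q * / qpoch_inf (q * B / al) q).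

Definition sides_product (s r s' r' Z1 Z2 al : C) (t : R) : C :=
  side s r r' s' Z1 Z2 (cis t) * side s' r' r s Z1 Z2 (cis t)
  * (qpoch_inf (cis t * cis t) q * qpoch_inf (/ cis t / cis t) q
     * (aw_factor r (cis t) * aw_factor s (cis t)
        * (aw_factor r' (cis t) * aw_factor s' (cis t)))
     * (aw_factor al (cis t) * aw_factor (q / al) (cis t))).

Lemma sides_series (s r s' r' Z1 Z2 al : C) (t : R) :
  (Cmod r < 1)%R -> (Cmod s < 1)%R -> (Cmod r' < 1)%R -> (Cmod s' < 1)%R ->
  regular (r / s) -> regular (r' / s') ->
  sides_product s r s' r' Z1 Z2 al t
  = row_factor s r Z1 Z2 * row_factor s' r' Z1 Z2
    * Cseries (fun n => Cseries (fun k => row_coef s r r' s' Z1 Z2 n * row_coef s' r' r s Z1 Z2 k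
         * aw_weight (r * q ^ n) (r' * q ^ k) al (q / al) (cis t) * q ^ k) * q ^ n).
Proof.
  intros Hr Hs Hr' Hs' H H'. unfold sides_product.
  assert (Mw := Cmod_cis t).
  set (G := qpoch_inf (cis t * cis t) q * qpoch_inf (/ cis t / cis t) q
     * (aw_factor al (cis t) * aw_factor (q / al) (cis t))).
  transitivity ((side s r r' s' Z1 Z2 (cis t) * (aw_factor r (cis t) * aw_factor s (cis t)))
    * (side s' r' r s Z1 Z2 (cis t) * (aw_factor r' (cis t) * aw_factor s' (cis t))) * G).
  { unfold G. ring. }
  rewrite !side_times_factors by assumption.
  assert (D : forall s r u v, (Cmod r < 1)%R -> regular (r / s) ->
    exists M, dominated M (fun n => row_coef s r u v Z1 Z2 n
      * aw_factor (r * q ^ n) (cis t) * q ^ n)).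
  { intros s0 r0 u0 v0 Hr0 H0. apply bdd_dominated1. apply bdd_mult.
    - apply (row_coef_bdd s0 r0 u0 v0 Z1 Z2 (fun n => n)), H0.
    - apply (aw_factor_bdd r0 (fun n => n) (fun _ => t)), Hr0. }
  destruct (D s r r' s' Hr H) as [M HM]. destruct (D s' r' r s Hr' H') as [M' HM'].
  set (S' := Cseries (fun n => row_coef s' r' r s Z1 Z2 n
    * aw_factor (r' * q ^ n) (cis t) * q ^ n)) in *.
  rewrite (Cseries_ext (fun n => Cseries _ * q ^ n) (fun n => (G * S') *
    (row_coef s r r' s' Z1 Z2 n * aw_factor (r * q ^ n) (cis t) * q ^ n))).
  - rewrite (Cseries_scal _ _ _ HM). ring.
  - intros n.
    rewrite (Cseries_ext _ (fun k => (row_coef s r r' s' Z1 Z2 n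
      * aw_factor (r * q ^ n) (cis t) * G) * (row_coef s' r' r s Z1 Z2 k
      * aw_factor (r' * q ^ k) (cis t) * q ^ k))).
    + rewrite (Cseries_scal _ _ _ HM'). fold S'. ring.
    + intros k. unfold aw_weight, G. ring.
Qed.

Lemma Cmod_mult_q_pow_lt (a : C) (n : nat) : (Cmod a < 1)%R -> (Cmod (a * q ^ n) < 1)%R.
Proof. intros H. eapply Rle_lt_trans; [apply Cmod_mult_q_pow_le | exact H]. Qed.

(** Summation and integration commute, because the double series is dominated
    uniformly on the circle. *)
Lemma sides_integral (s r s' r' Z1 Z2 al : C) : al <> 0 ->
  (Cmod r < 1)%R -> (Cmod s < 1)%R -> (Cmod r' < 1)%R -> (Cmod s' < 1)%R ->
  (Cmod al < 1)%R -> (Cmod (q / al) < 1)%R ->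
  regular (r / s) -> regular (r' / s') ->
  exists (m : nat -> C) (l : C),
    (forall n, csum (fun k => row_coef s r r' s' Z1 Z2 n * row_coef s' r' r s Z1 Z2 k
         * theta_value al (r * q ^ n) (r' * q ^ k) * q ^ k) (m n))
    /\ csum (fun n => m n * q ^ n) l
    /\ cint (sides_product s r s' r' Z1 Z2 al) 0 PI
       (row_factor s r Z1 Z2 * row_factor s' r' Z1 Z2 * l).
Proof.
  intros Hal Hr Hs Hr' Hs' Mal Mql H H'.
  set (D := fun n k t => row_coef s r r' s' Z1 Z2 n * row_coef s' r' r s Z1 Z2 k
         * aw_weight (r * q ^ n) (r' * q ^ k) al (q / al) (cis t)).
  assert (B : exists M, forall n k t, (Cmod (D n k t) <= M)%R).
  { assert (B : bdd (fun p : nat * nat * R => D (fst (fst p)) (snd (fst p)) (snd p))).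
    { unfold D. apply bdd_mult; [apply bdd_mult|].
      - apply (row_coef_bdd s r r' s' Z1 Z2 (fun p : nat * nat * R => fst (fst p))), H.
      - apply (row_coef_bdd s' r' r s Z1 Z2 (fun p : nat * nat * R => snd (fst p))), H'.
      - apply (aw_weight_bdd r r' al (q / al) (fun p : nat * nat * R => fst (fst p))
          (fun p => snd (fst p)) (fun p => snd p)); assumption. }
    destruct B as [M HM]. exists M. intros n k t. apply (HM (n, k, t)). }
  destruct B as [M HM].
  assert (Inner : forall n, exists m,
    csum (fun k => row_coef s r r' s' Z1 Z2 n * row_coef s' r' r s Z1 Z2 k
         * theta_value al (r * q ^ n) (r' * q ^ k) * q ^ k) m
    /\ cint (fun t => Cseries (fun k => D n k t * q ^ k)) 0 PI m).
  { intros n. apply cint_series with M.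
    - intros k.
      apply cint_ext with (fun t => (row_coef s r r' s' Z1 Z2 n * row_coef s' r' r s Z1 Z2 k
        * q ^ k)
        * aw_weight (r * q ^ n) (r' * q ^ k) al (q / al) (cis t)).
      { intros t _. unfold D. ring. }
      match goal with |- cint _ _ _ ?x => replace x with
        ((row_coef s r r' s' Z1 Z2 n * row_coef s' r' r s Z1 Z2 k * q ^ k)
         * theta_value al (r * q ^ n) (r' * q ^ k)) by ring end.
      apply cint_scal, aw_integral_theta; auto using Cmod_mult_q_pow_lt.
    - intros k t. rewrite Cmod_mult_q_pow.
      apply Rmult_le_compat_r; [left; apply q_pow_pos | apply HM]. }
  set (m := fun n => proj1_sig (constructive_indefinite_description _ (Inner n))).
  assert (Hm : forall n, csum (fun k => row_coef s r r' s' Z1 Z2 n * row_coef s' r' r s Z1 Z2 k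
         * theta_value al (r * q ^ n) (r' * q ^ k) * q ^ k) (m n)
    /\ cint (fun t => Cseries (fun k => D n k t * q ^ k)) 0 PI (m n)).
  { intros n. exact (proj2_sig (constructive_indefinite_description _ (Inner n))). }
  destruct (cint_series (fun n t => Cseries (fun k => D n k t * q ^ k) * q ^ n)
    (fun n => m n * q ^ n) 0 PI (M / (1 - q))) as [l [L1 L2]].
  - intros n.
    apply cint_ext with (fun t => q ^ n * Cseries (fun k => D n k t * q ^ k)).
    { intros t _. ring. }
    replace (m n * q ^ n) with (q ^ n * m n) by ring.
    apply cint_scal, Hm.
  - intros n t. rewrite Cmod_mult_q_pow.
    apply Rmult_le_compat_r; [left; apply q_pow_pos|].
    apply Cseries_bound. intros k. rewrite Cmod_mult_q_pow.
    apply Rmult_le_compat_r; [left; apply q_pow_pos | apply HM].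
  - exists m, l. split; [intros n; apply Hm | split; [exact L1|]].
    apply cint_ext with (2 := cint_scal (row_factor s r Z1 Z2 * row_factor s' r' Z1 Z2) _ _ _ _ L2).
    intros t _. symmetry. apply sides_series; auto.
Qed.

Lemma qpochs_bdd {I : Type} (l : list C) (n : I -> nat) : bdd (fun i => qpochs l q (n i)).
Proof.
  induction l as [|x l IH]; simpl; [apply bdd_const|].
  apply bdd_mult; [apply bdd_qpoch, bdd_const | exact IH].
Qed.

Lemma qpochs_neq_0 (l : list C) (n : nat) :
  List.Forall regular l -> qpochs l q n <> 0.
Proof.
  intros H. induction H as [|x l Hx _ IH]; simpl; [apply C1_nz|].
  apply Cmult_neq_0; [apply qpoch_neq_0, Hx | exact IH].
Qed.

Lemma inv_qpochs_bdd {I : Type} (l : list C) (n : I -> nat) :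
  List.Forall regular l -> bdd (fun i => / qpochs l q (n i)).
Proof.
  intros H. induction H as [|x l Hx Hl IH]; simpl.
  - apply (bdd_const (/ 1)).
  - destruct (bdd_mult _ _ (bdd_inv_qpoch x n Hx) IH) as [M HM].
    exists M. intros i.
    replace (/ (qpoch x q (n i) * qpochs l q (n i)))
      with (/ qpoch x q (n i) * / qpochs l q (n i)); [apply HM|].
    field. split; [apply qpochs_neq_0, Hl | apply qpoch_neq_0, Hx].
Qed.

Lemma qhyp_csum (num den : list C) : List.Forall regular den ->
  csum (fun n => qpochs num q n / qpochs (RtoC q :: den) q n * q ^ n) (qhyp num den q q).
Proof.
  intros H.
  destruct (bdd_dominated1 (fun n => qpochs num q n / qpochs (RtoC q :: den) q n)) as [M HM].
  - apply bdd_mult; [apply (qpochs_bdd num (fun n => n))|].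
    apply (inv_qpochs_bdd (RtoC q :: den) (fun n => n)). constructor; [apply regular_q | exact H].
  - apply dominated_csum with M, HM.
Qed.

Lemma qpoch_ratio (x : C) (n : nat) : regular x ->
  qpoch x q n = (1 - x) * qpoch (x * q) q n / (1 - x * q ^ n).
Proof.
  intros H. rewrite <- qpoch_succ_l. simpl. field.
  intros E. apply (H n). symmetry. apply Ceq_minus. exact E.
Qed.

Lemma regular_q_pow (x : C) (n : nat) : regular x -> regular (x * q ^ n).
Proof. intros H k E. apply (H (n + k)%nat). rewrite Cpow_add_r, <- E. ring. Qed.

Lemma regular_1_minus (x : C) : regular x -> 1 - x <> 0.
Proof.
  intros H E. apply (H O). simpl. rewrite Cmult_1_r. symmetry. apply Ceq_minus. exact E.
Qed.

Lemma qpoch_inf_tail_neq_0 (x : C) (n : nat) : regular x ->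
  qpoch_inf (x * q ^ n) q <> 0.
Proof. intros H. apply qpoch_inf_neq_0, regular_q_pow, H. Qed.

Definition theta_product (al A : C) : C := qpoch_inf (al * A) q * qpoch_inf (q * A / al) q.

Definition double_factor (s r s' r' al : C) : C :=
  2 * PI / (qpoch_inf q q * qpoch_inf q q)
  * (qpoch_inf (r * r') q * qpoch_inf (r * r') q
     * (qpoch_inf (r * s') q * qpoch_inf (r' * s) q))
  / ((1 - r * r') * (theta_product al r * theta_product al r')).

Definition double_hyp (s r s' r' Z1 Z2 al : C) (n : nat) : C :=
  qhyp [r * r' * q ^ n; Z2 / s'; Z1 / s'; al * r'; q * r' / al]
       [r * r' * q ^ n * q; r * r'; r' / s' * q; r' * s] q q.

Definition double_term (s r s' r' Z1 Z2 al : C) (n : nat) : C :=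
  q ^ n
  * (qpochs [Z1 / s; Z2 / s; al * r; q * r / al] q n
     / qpochs [RtoC q; r * r' * q; r * s'; r / s * q] q n)
  * double_hyp s r s' r' Z1 Z2 al n.

(** The coupling factor is a quotient of shifted factorials in [k]: for
    [x = r r' q^n], [(x)_k / (q x)_k = (1 - x) / (1 - x q^k)]. *)
Lemma inner_term (s r s' r' Z1 Z2 al : C) (n k : nat) : al <> 0 ->
  regular (r * r') -> regular (r' * s) -> regular (r' / s') ->
  regular (al * r) -> regular (q * r / al) ->
  regular (al * r') -> regular (q * r' / al) ->
  row_coef s' r' r s Z1 Z2 k * theta_value al (r * q ^ n) (r' * q ^ k)
  = 2 * PI / (qpoch_inf q q * qpoch_inf q q)
    * (qpoch_inf (r * r') q * qpoch_inf (r' * s) q)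
    / ((1 - r * r' * q ^ n) * theta_product al (r * q ^ n) * theta_product al r')
    * (qpochs [r * r' * q ^ n; Z2 / s'; Z1 / s'; al * r'; q * r' / al] q k
       / qpochs [RtoC q; r * r' * q ^ n * q; r * r'; r' / s' * q; r' * s] q k).
Proof.
  intros Hal R1 R2 R3 R4 R5 R6 R7.
  assert (Rn := regular_q_pow _ n R1).
  assert (R3' := regular_mult_q _ R3). assert (Rn' := regular_mult_q _ Rn).
  assert (Rq := regular_q).
  unfold row_coef, theta_value, theta_product, qpochs. simpl fold_right.
  rewrite (qpoch_ratio _ k Rn).
  rewrite (qpoch_inf_split (r * r') k), (qpoch_inf_split (r' * s) k).
  rewrite (qpoch_inf_split (al * r') k), (qpoch_inf_split (q * r' / al) k).
  replace (r' * r * q ^ k) with (r * r' * q ^ k) by ring.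
  replace (al * (r' * q ^ k)) with (al * r' * q ^ k) by ring.
  replace (q * (r' * q ^ k) / al) with (q * r' / al * q ^ k) by (unfold Cdiv; ring).
  replace (al * (r * q ^ n)) with (al * r * q ^ n) by ring.
  replace (q * (r * q ^ n) / al) with (q * r / al * q ^ n) by (unfold Cdiv; ring).
  replace (r * q ^ n * (r' * q ^ k)) with (r * r' * q ^ n * q ^ k) by ring.
  assert (N1 := regular_1_minus _ Rn). assert (N2 := regular_1_minus _ (regular_q_pow _ k Rn)).
  assert (M1 := qpoch_inf_tail_neq_0 _ k R1). assert (M2 := qpoch_inf_tail_neq_0 _ k R2).
  assert (M4 := qpoch_inf_tail_neq_0 _ n R4). assert (M5 := qpoch_inf_tail_neq_0 _ n R5).
  assert (M6 := qpoch_inf_tail_neq_0 _ k R6). assert (M7 := qpoch_inf_tail_neq_0 _ k R7).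
  assert (Mq := qpoch_inf_neq_0 _ Rq).
  assert (K1 := qpoch_neq_0 _ k R1). assert (K2 := qpoch_neq_0 _ k R2).
  assert (K3 := qpoch_neq_0 _ k R3'). assert (K6 := qpoch_neq_0 _ k R6).
  assert (K7 := qpoch_neq_0 _ k R7). assert (Kq := qpoch_neq_0 _ k Rq).
  assert (Kn := qpoch_neq_0 _ k Rn').
  field. repeat split; assumption.
Qed.

Lemma outer_term (s r s' r' Z1 Z2 al : C) (n : nat) : al <> 0 ->
  regular (r * r') -> regular (r * s') -> regular (r / s) ->
  regular (al * r) -> regular (q * r / al) ->
  regular (al * r') -> regular (q * r' / al) ->
  row_coef s r r' s' Z1 Z2 n
  * (2 * PI / (qpoch_inf q q * qpoch_inf q q)
    * (qpoch_inf (r * r') q * qpoch_inf (r' * s) q)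
    / ((1 - r * r' * q ^ n) * theta_product al (r * q ^ n) * theta_product al r'))
  = double_factor s r s' r' al
    * (qpochs [Z1 / s; Z2 / s; al * r; q * r / al] q n
       / qpochs [RtoC q; r * r' * q; r * s'; r / s * q] q n).
Proof.
  intros Hal R1 R2 R3 R4 R5 R6 R7.
  assert (Rn := regular_q_pow _ n R1).
  assert (R3' := regular_mult_q _ R3). assert (R1' := regular_mult_q _ R1).
  assert (Rq := regular_q).
  unfold row_coef, double_factor, theta_product, qpochs. simpl fold_right.
  assert (X := qpoch_ratio _ n R1).
  assert (S1 := qpoch_inf_split (r * r') n). rewrite X in S1.
  rewrite S1 at 2.
  rewrite (qpoch_inf_split (r * s') n).
  rewrite (qpoch_inf_split (al * r) n), (qpoch_inf_split (q * r / al) n).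
  replace (al * (r * q ^ n)) with (al * r * q ^ n) by ring.
  replace (q * (r * q ^ n) / al) with (q * r / al * q ^ n) by (unfold Cdiv; ring).
  assert (N1 := regular_1_minus _ Rn). assert (N2 := regular_1_minus _ R1).
  assert (M4 := qpoch_inf_tail_neq_0 _ n R4). assert (M5 := qpoch_inf_tail_neq_0 _ n R5).
  assert (M6 := qpoch_inf_neq_0 _ R6). assert (M7 := qpoch_inf_neq_0 _ R7).
  assert (Mq := qpoch_inf_neq_0 _ Rq).
  assert (K1 := qpoch_neq_0 _ n R1'). assert (K2 := qpoch_neq_0 _ n R2).
  assert (K3 := qpoch_neq_0 _ n R3'). assert (K4 := qpoch_neq_0 _ n R4).
  assert (K5 := qpoch_neq_0 _ n R5). assert (Kq := qpoch_neq_0 _ n Rq).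
  field. repeat split; assumption.
Qed.

Definition double_value (s r s' r' Z1 Z2 al : C) : C :=
  row_factor s r Z1 Z2 * row_factor s' r' Z1 Z2 * double_factor s r s' r' al
  * Cseries (double_term s r s' r' Z1 Z2 al).

Theorem sides_integral_value (s r s' r' Z1 Z2 al : C) : al <> 0 ->
  (Cmod r < 1)%R -> (Cmod s < 1)%R -> (Cmod r' < 1)%R -> (Cmod s' < 1)%R ->
  (Cmod al < 1)%R -> (Cmod (q / al) < 1)%R ->
  regular (r / s) -> regular (r' / s') ->
  cint (sides_product s r s' r' Z1 Z2 al) 0 PI (double_value s r s' r' Z1 Z2 al).
Proof.
  intros Hal Hr Hs Hr' Hs' Mal Mql H H'.
  destruct (sides_integral s r s' r' Z1 Z2 al Hal Hr Hs Hr' Hs' Mal Mql H H')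
    as [m [l [Hm [Hl I]]]].
  assert (RR := regular_mult).
  assert (RT := fun x Hx => regular_mult_div x al Hx Mql).
  assert (Em : forall n, m n = row_coef s r r' s' Z1 Z2 n
    * (2 * PI / (qpoch_inf q q * qpoch_inf q q)
    * (qpoch_inf (r * r') q * qpoch_inf (r' * s) q)
    / ((1 - r * r' * q ^ n) * theta_product al (r * q ^ n) * theta_product al r'))
    * double_hyp s r s' r' Z1 Z2 al n).
  { intros n. apply (clim_unique _ _ _ (Hm n)).
    eapply csum_ext; [|apply csum_scal, qhyp_csum].
    - intros k. cbv beta.
      transitivity (row_coef s r r' s' Z1 Z2 n * (row_coef s' r' r s Z1 Z2 k
        * theta_value al (r * q ^ n) (r' * q ^ k)) * q ^ k); [|ring].
      rewrite (inner_term s r s' r' Z1 Z2 al n k) by auto. ring.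
    - repeat constructor; auto using regular_mult_q, regular_q_pow. }
  set (P := double_factor s r s' r' al).
  assert (Th : forall x, (Cmod x < 1)%R -> theta_product al x <> 0).
  { intros x Hx. apply Cmult_neq_0; apply qpoch_inf_neq_0; auto. }
  assert (HP : P <> 0).
  { unfold P, double_factor, Cdiv.
    assert (HPI : RtoC PI <> 0) by (intros E; apply RtoC_inj in E; assert (A := PI_RGT_0); lra).
    assert (H2 : RtoC 2 <> 0) by (intros E; apply RtoC_inj in E; lra).
    assert (Nq := qpoch_inf_neq_0 _ regular_q).
    repeat first [apply Th | apply Cmult_neq_0 | apply Cinv_neq_0 | assumption
      | apply qpoch_inf_neq_0 | apply regular_1_minus | apply RR]. }
  assert (El : l = P * Cseries (double_term s r s' r' Z1 Z2 al)).
  { rewrite (Cseries_eq _ (/ P * l)); [field; exact HP|].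
    apply csum_ext with (2 := csum_scal (/ P) _ _ Hl).
    intros n. rewrite Em, (outer_term s r s' r' Z1 Z2 al n) by auto. fold P. unfold double_term. field.
    split; [|exact HP].
    apply qpochs_neq_0.
    repeat constructor; auto using regular_mult_q, regular_q. }
  unfold double_value. fold P. rewrite <- Cmult_assoc, <- El. exact I.
Qed.

(** * The four terms *)

Lemma qhyp_perm (num : list C) (x1 x2 x3 x4 t : C) :
  qhyp num [x1; x2; x3; x4] q t = qhyp num [x1; x4; x3; x2] q t.
Proof.
  apply Cseries_ext. intros n. unfold qpochs. simpl fold_right.
  f_equal. f_equal. ring.
Qed.

(** Exchanging [a] and [b] gives the second term. *)
Lemma term_c (a b c d alpha nu : C) :
  a <> 0 -> b <> 0 -> c <> 0 -> d <> 0 -> alpha <> 0 ->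
  (Cmod a < 1)%R -> (Cmod b < 1)%R -> (Cmod c < 1)%R ->
  (Cmod alpha < 1)%R -> (Cmod (q / alpha) < 1)%R ->
  regular (b / a) -> regular (q / d / c) ->
  / (qpoch_inf (a * b) q * qpoch_inf (a * c) q * qpoch_inf (b * c) q
     * (qpoch_inf (a * b) q * qpoch_inf (a * c) q * qpoch_inf (b * c) q))
  * double_value (q / d) c b a (q / d * cpow q (- nu)) (a * b * c * cpow q nu) alpha
  = 2 * PI / ((1 - a * c) * (qpochs_inf [RtoC q; a * b] q) ^ 2)
    * (qpochs_inf [q * a / d; a * b * cpow q nu; b * c * cpow q nu;
                   cpow q (1 - nu) / (a * d); cpow q (1 - nu) / (c * d)] q
       / qpochs_inf [b * c; b / a; q / (c * d); alpha * a; q * a / alpha;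
                     alpha * c; q * c / alpha] q)
    * Cseries (fun n : nat =>
        q ^ n
        * (qpochs [cpow q (- nu); a * b * c * d * cpow q (nu - 1);
                   alpha * c; q * c / alpha] q n
           / qpochs [RtoC q; a * c * q; b * c; c * d] q n)
        * qhyp [a * c * q ^ n; a * c * cpow q nu; cpow q (1 - nu) / (b * d);
                alpha * a; q * a / alpha]
               [a * c * q ^ (n + 1); a * c; q * a / b; q * a / d] q q).
Proof.
  intros Ha Hb Hc Hd Hal Ma Mb Mc Mal Mql Rba Rec.
  assert (Hq := q_neq_0).
  rewrite cpow_1_minus, cpow_minus_1.
  set (y := cpow q (- nu)). set (y' := cpow q nu).
  unfold double_value, double_factor.
  match goal with |- _ * (_ * Cseries ?f) = _ * Cseries ?g =>
    assert (ES : Cseries f = Cseries g) end.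
  { apply Cseries_ext. intros n. unfold double_term, double_hyp.
    rewrite Cpow_add_r. simpl (q ^ 1).
    replace (q / d * y / (q / d)) with y by (field; auto).
    replace (a * b * c * y' / (q / d)) with (a * b * c * d * (y' / q)) by (field; auto).
    replace (c * a) with (a * c) by ring. replace (c * b) with (b * c) by ring.
    replace (c / (q / d) * q) with (c * d) by (field; auto).
    replace (a * b * c * y' / b) with (a * c * y') by (field; auto).
    replace (q / d * y / b) with (q * y / (b * d)) by (field; auto).
    replace (a * c * (q ^ n * (q * 1))) with (a * c * q ^ n * q) by ring.
    replace (a / b * q) with (q * a / b) by (field; auto).
    replace (a * (q / d)) with (q * a / d) by (field; auto).
    reflexivity. }
  rewrite ES. match goal with |- context [Cseries ?g] => set (S := Cseries g) end.
  unfold row_factor, theta_product, qpochs_inf. simpl fold_right.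
  replace (c * a) with (a * c) by ring. replace (c * b) with (b * c) by ring.
  replace (q / d * y / c) with (q * y / (c * d)) by (field; auto).
  replace (q / d * y / a) with (q * y / (a * d)) by (field; auto).
  replace (a * b * c * y' / c) with (a * b * y') by (field; auto).
  replace (a * b * c * y' / a) with (b * c * y') by (field; auto).
  replace (a * (q / d)) with (q * a / d) by (field; auto).
  replace (q / d / c) with (q / (c * d)) in * by (field; auto).
  assert (RR := regular_mult).
  assert (RT := fun x Hx => regular_mult_div x alpha Hx Mql).
  assert (N1 := qpoch_inf_neq_0 _ (RR a b Ma Mb)). assert (N2 := qpoch_inf_neq_0 _ (RR a c Ma Mc)).
  assert (N3 := qpoch_inf_neq_0 _ (RR b c Mb Mc)). assert (N4 := qpoch_inf_neq_0 _ Rba).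
  assert (N5 := qpoch_inf_neq_0 _ Rec).
  assert (N6 := qpoch_inf_neq_0 _ (RR alpha a Mal Ma)).
  assert (N7 := qpoch_inf_neq_0 _ (RR alpha c Mal Mc)).
  assert (N8 := qpoch_inf_neq_0 _ (RT a Ma)). assert (N9 := qpoch_inf_neq_0 _ (RT c Mc)).
  assert (N10 := qpoch_inf_neq_0 _ regular_q).
  assert (N11 := regular_1_minus _ (RR a c Ma Mc)).
  field. repeat split; assumption.
Qed.

(** Exchanging [a] and [b] gives the fourth term. *)
Lemma term_e (a b c d alpha nu : C) :
  a <> 0 -> b <> 0 -> c <> 0 -> d <> 0 -> alpha <> 0 ->
  (Cmod a < 1)%R -> (Cmod b < 1)%R -> (Cmod c < 1)%R -> (Cmod (q / d) < 1)%R ->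
  (Cmod alpha < 1)%R -> (Cmod (q / alpha) < 1)%R ->
  regular (b / a) -> regular (c / (q / d)) ->
  / (qpoch_inf (a * b) q * qpoch_inf (a * c) q * qpoch_inf (b * c) q
     * (qpoch_inf (a * b) q * qpoch_inf (a * c) q * qpoch_inf (b * c) q))
  * double_value c (q / d) b a (q / d * cpow q (- nu)) (a * b * c * cpow q nu) alpha
  = 2 * PI * (qpochs_inf [q * a / d] q) ^ 2
    / ((1 - q * a / d) * (qpochs_inf [RtoC q; a * b; b * c] q) ^ 2)
    * (qpochs_inf [cpow q (- nu); a * b * c * d * cpow q (nu - 1);
                   cpow q (1 - nu) / (a * d); b * c * cpow q nu; q * b / d] q
       / qpochs_inf [a * c; b / a; c * d / q; alpha * a; q * a / alpha;
                     q * alpha / d; q ^ 2 / (alpha * d)] q)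
    * Cseries (fun n : nat =>
        q ^ n
        * (qpochs [a * b * cpow q nu; cpow q (1 - nu) / (c * d);
                   q * alpha / d; q ^ 2 / (alpha * d)] q n
           / qpochs [RtoC q; q * b / d; q ^ 2 * a / d; q ^ 2 / (c * d)] q n)
        * qhyp [a * q ^ (n + 1) / d; a * c * cpow q nu;
                cpow q (1 - nu) / (b * d); alpha * a; q * a / alpha]
               [a * q ^ (n + 2) / d; a * c; q * a / b; q * a / d] q q).
Proof.
  intros Ha Hb Hc Hd Hal Ma Mb Mc Me Mal Mql Rba Rce.
  assert (Hq := q_neq_0).
  rewrite cpow_1_minus, cpow_minus_1.
  set (y := cpow q (- nu)). set (y' := cpow q nu).
  unfold double_value, double_factor.
  match goal with |- _ * (_ * Cseries ?f) = _ * Cseries ?g =>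
    assert (ES : Cseries f = Cseries g) end.
  { apply Cseries_ext. intros n. unfold double_term, double_hyp.
    rewrite !Cpow_add_r. simpl (q ^ 1). simpl (q ^ 2).
    rewrite qhyp_perm.
    replace (q / d * y / c) with (q * y / (c * d)) by (field; auto).
    replace (a * b * c * y' / c) with (a * b * y') by (field; auto).
    replace (alpha * (q / d)) with (q * alpha / d) by (field; auto).
    replace (q * (q / d) / alpha) with (q * (q * 1) / (alpha * d)) by (field; auto).
    replace (q / d * a * q ^ n * q) with (a * (q ^ n * (q * (q * 1))) / d) by (field; auto).
    replace (q / d * a * q ^ n) with (a * (q ^ n * (q * 1)) / d) by (field; auto).
    replace (q / d * a * q) with (q * (q * 1) * a / d) by (field; auto).
    replace (q / d * a) with (q * a / d) by (field; auto).
    replace (q / d * b) with (q * b / d) by (field; auto).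
    replace (q / d / c * q) with (q * (q * 1) / (c * d)) by (field; auto).
    replace (a * b * c * y' / b) with (a * c * y') by (field; auto).
    replace (q / d * y / b) with (q * y / (b * d)) by (field; auto).
    replace (a / b * q) with (q * a / b) by (field; auto).
    f_equal. f_equal. unfold qpochs. simpl fold_right. f_equal; [ring|].
    f_equal. ring. }
  rewrite ES. match goal with |- context [Cseries ?g] => set (S := Cseries g) end.
  unfold row_factor, theta_product, qpochs_inf. simpl fold_right.
  replace (q / d * y / (q / d)) with y by (field; auto).
  replace (a * b * c * y' / (q / d)) with (a * b * c * d * (y' / q)) by (field; auto).
  replace (c / (q / d)) with (c * d / q) in * by (field; auto).
  replace (q / d * y / a) with (q * y / (a * d)) by (field; auto).
  replace (a * b * c * y' / a) with (b * c * y') by (field; auto).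
  replace (alpha * (q / d)) with (q * alpha / d) by (field; auto).
  replace (q * (q / d) / alpha) with (q * (q * 1) / (alpha * d)) by (field; auto).
  replace (q / d * a) with (q * a / d) by (field; auto).
  replace (q / d * b) with (q * b / d) by (field; auto).
  assert (RR := regular_mult).
  assert (RT := fun x Hx => regular_mult_div x alpha Hx Mql).
  assert (N1 := qpoch_inf_neq_0 _ (RR a b Ma Mb)). assert (N2 := qpoch_inf_neq_0 _ (RR a c Ma Mc)).
  assert (N3 := qpoch_inf_neq_0 _ (RR b c Mb Mc)). assert (N4 := qpoch_inf_neq_0 _ Rba).
  assert (N5 := qpoch_inf_neq_0 _ Rce).
  assert (N6 := qpoch_inf_neq_0 _ (RR alpha a Mal Ma)).
  assert (N7 : qpoch_inf (q * alpha / d) q <> 0).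
  { replace (q * alpha / d) with (q / d * alpha) by (field; auto). apply qpoch_inf_neq_0; auto. }
  assert (N8 := qpoch_inf_neq_0 _ (RT a Ma)).
  assert (N9 : qpoch_inf (q * (q * 1) / (alpha * d)) q <> 0).
  { replace (q * (q * 1) / (alpha * d)) with (q * (q / d) / alpha) by (field; auto).
    apply qpoch_inf_neq_0; auto. }
  assert (N10 := qpoch_inf_neq_0 _ regular_q).
  assert (N11 : d - q * a <> 0).
  { intros E. apply (regular_1_minus _ (RR _ a Me Ma)).
    replace (1 - q / d * a) with ((d - q * a) / d) by (field; auto). rewrite E. unfold Cdiv. ring. }
  field. repeat split; assumption.
Qed.

(** * The integrand *)

Lemma cis_square_regular (t : R) : (0 < t < PI)%R ->
  regular (cis t / / cis t) /\ regular (/ cis t / cis t).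
Proof.
  intros Ht. assert (Hw := cis_neq_0 t). assert (Mw := Cmod_cis t).
  assert (Sq : cis t * cis t <> 1).
  { rewrite cis_eq. intros E. injection E. intros _ E1.
    assert (T := sin2_cos2 t). unfold Rsqr in T.
    assert (S := sin_gt_0 t (proj1 Ht) (proj2 Ht)). nra. }
  assert (Reg : forall z : C, Cmod z = 1%R -> z <> 1 -> regular z).
  { intros z Mz Nz k E. destruct k as [|k].
    - apply Nz. rewrite <- E. simpl. ring.
    - assert (M : Cmod (z * q ^ S k) = 1%R) by (rewrite E; apply Cmod_1).
      rewrite Cmod_mult_q_pow, Mz in M. simpl in M.
      assert (P := q_pow_le_1 k). assert (P' := q_pow_pos k).
      destruct hq. nra. }
  replace (cis t / / cis t) with (cis t * cis t) by (field; auto).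
  replace (/ cis t / cis t) with (/ (cis t * cis t)) by (field; auto).
  split; apply Reg.
  - rewrite Cmod_mult, Mw. ring.
  - exact Sq.
  - rewrite Cmod_inv, Cmod_mult, Mw by (apply Cmult_neq_0; assumption). field.
  - intros E. apply Sq. replace (cis t * cis t) with (/ / (cis t * cis t)) by (field; auto).
    rewrite E. field.
Qed.

Lemma side_swap (r s u v Z1 Z2 w : C) :
  side r s u v Z1 Z2 w = side r s v u Z1 Z2 w.
Proof.
  unfold side. f_equal. apply Cseries_ext. intros j. unfold side_coef. ring.
Qed.

(** One factor [v] is expanded along the pair [{c, q/d}], the other one along
    [{a, b}]; each of the four products of sides then cancels four of the eight
    parameter factors of the weight. *)
Lemma integrand_expansion (a b c d alpha nu : C) (t : R) :
  a <> 0 -> b <> 0 -> c <> 0 -> d <> 0 -> alpha <> 0 ->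
  (Cmod a < 1)%R -> (Cmod b < 1)%R -> (Cmod c < 1)%R -> (Cmod (q / d) < 1)%R ->
  (Cmod alpha < 1)%R -> (Cmod (q / alpha) < 1)%R ->
  regular (b / a) -> regular (a / b) ->
  regular (q / d / c) -> regular (c / (q / d)) ->
  (0 < t < PI)%R ->
  let Z1 := q / d * cpow q (- nu) in let Z2 := a * b * c * cpow q nu in
  integrand q nu alpha a b c d t
  = / (qpoch_inf (a * b) q * qpoch_inf (a * c) q * qpoch_inf (b * c) q
     * (qpoch_inf (a * b) q * qpoch_inf (a * c) q * qpoch_inf (b * c) q))
    * (sides_product (q / d) c b a Z1 Z2 alpha t + sides_product (q / d) c a b Z1 Z2 alpha t
       + sides_product c (q / d) b a Z1 Z2 alpha t + sides_product c (q / d) a b Z1 Z2 alpha t).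
Proof.
  intros Ha Hb Hc Hd Hal Ma Mb Mc Me Mal Mql Rba Rab Rec Rce Ht Z1 Z2.
  assert (Hq := q_neq_0).
  assert (He := q_div_neq_0 d Hd).
  destruct (cis_square_regular t Ht) as [W1 W2].
  assert (Hw := cis_neq_0 t). assert (Mw := Cmod_cis t).
  assert (RR := regular_mult).
  unfold integrand. fold (cis t).
  replace (Cexp (- (Ci * t))) with (/ cis t).
  2:{ rewrite <- cis_opp. unfold cis. f_equal. rewrite RtoC_opp. ring. }
  replace (Cexp (2 * Ci * t)) with (cis t * cis t).
  2:{ unfold cis. rewrite <- Cexp_plus. f_equal. ring. }
  replace (Cexp (- (2 * Ci * t))) with (/ cis t / cis t).
  2:{ unfold Cdiv. rewrite <- cis_opp. unfold cis. rewrite <- Cexp_plus. f_equal.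
      rewrite RtoC_opp. ring. }
  cbv zeta.
  rewrite (v_fun_omega nu (cis t) a b c d) by assumption. fold Z1 Z2.
  assert (HZ : Z1 * Z2 = a * b * c * (q / d)).
  { assert (E := cpow_opp nu). unfold Z1, Z2.
    transitivity (a * b * c * (q / d) * (cpow q (- nu) * cpow q nu)); [ring|]. rewrite E. ring. }
  assert (P1 : omega a (q / d) b c Z1 Z2 (cis t)
    = two_sides c (q / d) a b Z1 Z2 (cis t)).
  { rewrite two_sides_omega; auto.
    - rewrite (omega_sym34 a), (omega_sym23 a), (omega_sym12 a), (omega_sym23 c).
      reflexivity.
    - rewrite HZ. ring. }
  assert (P2 : omega a (q / d) b c Z1 Z2 (cis t)
    = two_sides a b c (q / d) Z1 Z2 (cis t)).
  { rewrite two_sides_omega; auto.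
    rewrite (omega_sym23 a), (omega_sym34 a). reflexivity. }
  set (N := qpoch_inf (a * b) q * qpoch_inf (a * c) q * qpoch_inf (b * c) q).
  assert (HN : N <> 0).
  { repeat apply Cmult_neq_0; apply qpoch_inf_neq_0; auto. }
  replace ((omega a (q / d) b c Z1 Z2 (cis t) / N) ^ 2)
    with (two_sides c (q / d) a b Z1 Z2 (cis t) * two_sides a b c (q / d) Z1 Z2 (cis t)
          / (N * N)) by (rewrite <- P1, <- P2; field; exact HN).
  unfold two_sides, sides_product.
  rewrite (side_swap (q / d) c b a), (side_swap a b (q / d) c), (side_swap b a (q / d) c),
    (side_swap c (q / d) b a).
  set (w := cis t) in *.
  set (A1 := side c (q / d) a b Z1 Z2 w). set (A2 := side (q / d) c a b Z1 Z2 w).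
  set (B1 := side a b c (q / d) Z1 Z2 w). set (B2 := side b a c (q / d) Z1 Z2 w).
  unfold aw_factor, qpochs_inf. simpl fold_right.
  assert (D1 : forall x, x * / w = x / w) by reflexivity. rewrite !D1.
  replace (q * w / d) with (q / d * w) by (unfold Cdiv; ring).
  replace (q / w / d) with (q / d / w) by (unfold Cdiv; ring).
  replace (q * / w / d) with (q / d / w) by (unfold Cdiv; ring).
  replace (q * w / alpha) with (q / alpha * w) by (unfold Cdiv; ring).
  replace (q * / w / alpha) with (q / alpha / w) by (unfold Cdiv; ring).
  replace (q / w / alpha) with (q / alpha / w) by (unfold Cdiv; ring).
  destruct (qpoch_inf_circle_neq_0 a w Mw Ma) as [Na Na'].
  destruct (qpoch_inf_circle_neq_0 b w Mw Mb) as [Nb Nb'].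
  destruct (qpoch_inf_circle_neq_0 c w Mw Mc) as [Nc Nc'].
  destruct (qpoch_inf_circle_neq_0 (q / d) w Mw Me) as [Ne Ne'].
  destruct (qpoch_inf_circle_neq_0 alpha w Mw Mal) as [Nal Nal'].
  destruct (qpoch_inf_circle_neq_0 (q / alpha) w Mw Mql) as [Nql Nql'].
  field. repeat split; assumption.
Qed.

End BasicHypergeometric.

(** * The theorem *)

Theorem mainTheorem2 (q : R) (a b c d alpha0 alpha nu : C)
  (hq : (0 < q < 1)%R)
  (ha0 : a <> 0) (hb0 : b <> 0) (hc0 : c <> 0) (hd0 : d <> 0)
  (hmax : (Rmax (Rmax (Cmod a) (Cmod b)) (Rmax (Cmod c) (Cmod (q / d))) < 1)%R)
  (halpha0 : (0 < Re alpha0 < 1 / 2)%R)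
  (halpha : alpha = cpow q alpha0)
  (hab : ~ is_q_power q (a / b))
  (hcd : ~ is_q_power q (c * d)) :
  let T1 :=
    2 * PI / ((1 - a * c) * (qpochs_inf [RtoC q; a * b] q) ^ 2)
    * (qpochs_inf [q * a / d; a * b * cpow q nu; b * c * cpow q nu;
                   cpow q (1 - nu) / (a * d); cpow q (1 - nu) / (c * d)] q
       / qpochs_inf [b * c; b / a; q / (c * d); alpha * a; q * a / alpha;
                     alpha * c; q * c / alpha] q)
    * Cseries (fun n : nat =>
        q ^ n
        * (qpochs [cpow q (- nu); a * b * c * d * cpow q (nu - 1);
                   alpha * c; q * c / alpha] q n
           / qpochs [RtoC q; a * c * q; b * c; c * d] q n)
        * qhyp [a * c * q ^ n; a * c * cpow q nu; cpow q (1 - nu) / (b * d);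
                alpha * a; q * a / alpha]
               [a * c * q ^ (n + 1); a * c; q * a / b; q * a / d] q q) in
  let T2 :=
    2 * PI / ((1 - b * c) * (qpochs_inf [RtoC q; a * b] q) ^ 2)
    * (qpochs_inf [q * b / d; a * b * cpow q nu; a * c * cpow q nu;
                   cpow q (1 - nu) / (b * d); cpow q (1 - nu) / (c * d)] q
       / qpochs_inf [a * c; a / b; q / (c * d); alpha * b; q * b / alpha;
                     alpha * c; q * c / alpha] q)
    * Cseries (fun n : nat =>
        q ^ n
        * (qpochs [cpow q (- nu); a * b * c * d * cpow q (nu - 1);
                   alpha * c; q * c / alpha] q n
           / qpochs [RtoC q; b * c * q; a * c; c * d] q n)
        * qhyp [b * c * q ^ n; b * c * cpow q nu; cpow q (1 - nu) / (a * d);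
                alpha * b; q * b / alpha]
               [b * c * q ^ (n + 1); b * c; q * b / a; q * b / d] q q) in
  let T3 :=
    2 * PI * (qpochs_inf [q * a / d] q) ^ 2
    / ((1 - q * a / d) * (qpochs_inf [RtoC q; a * b; b * c] q) ^ 2)
    * (qpochs_inf [cpow q (- nu); a * b * c * d * cpow q (nu - 1);
                   cpow q (1 - nu) / (a * d); b * c * cpow q nu; q * b / d] q
       / qpochs_inf [a * c; b / a; c * d / q; alpha * a; q * a / alpha;
                     q * alpha / d; q ^ 2 / (alpha * d)] q)
    * Cseries (fun n : nat =>
        q ^ n
        * (qpochs [a * b * cpow q nu; cpow q (1 - nu) / (c * d);
                   q * alpha / d; q ^ 2 / (alpha * d)] q n
           / qpochs [RtoC q; q * b / d; q ^ 2 * a / d; q ^ 2 / (c * d)] q n)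
        * qhyp [a * q ^ (n + 1) / d; a * c * cpow q nu;
                cpow q (1 - nu) / (b * d); alpha * a; q * a / alpha]
               [a * q ^ (n + 2) / d; a * c; q * a / b; q * a / d] q q) in
  let T4 :=
    2 * PI * (qpochs_inf [q * b / d] q) ^ 2
    / ((1 - q * b / d) * (qpochs_inf [RtoC q; a * b; a * c] q) ^ 2)
    * (qpochs_inf [cpow q (- nu); a * b * c * d * cpow q (nu - 1);
                   cpow q (1 - nu) / (b * d); a * c * cpow q nu; q * a / d] q
       / qpochs_inf [b * c; a / b; c * d / q; alpha * b; q * b / alpha;
                     q * alpha / d; q ^ 2 / (alpha * d)] q)
    * Cseries (fun n : nat =>
        q ^ n
        * (qpochs [a * b * cpow q nu; cpow q (1 - nu) / (c * d);
                   q * alpha / d; q ^ 2 / (alpha * d)] q n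
           / qpochs [RtoC q; q * a / d; q ^ 2 * b / d; q ^ 2 / (c * d)] q n)
        * qhyp [b * q ^ (n + 1) / d; b * c * cpow q nu;
                cpow q (1 - nu) / (a * d); alpha * b; q * b / alpha]
               [b * q ^ (n + 2) / d; b * c; q * b / a; q * b / d] q q) in
  is_RInt (V := C_R_NormedModule) (integrand q nu alpha a b c d) 0 PI
    (T1 + T2 + T3 + T4).
Proof.
  intros T1 T2 T3 T4.
  pose proof (hq : base q) as Hb.
  assert (Ma : (Cmod a < 1)%R /\ (Cmod b < 1)%R /\ (Cmod c < 1)%R /\ (Cmod (q / d) < 1)%R).
  { apply Rmax_Rlt in hmax. destruct hmax as [h1 h2].
    apply Rmax_Rlt in h1. apply Rmax_Rlt in h2. tauto. }
  clear hmax. destruct Ma as [Ma [Mb [Mc Me]]].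
  destruct hq as [q0 q1].
  assert (Hq := q_neq_0 (q := q)).
  assert (Hal : alpha <> 0) by (rewrite halpha; apply Cexp_neq_0).
  assert (Mq : Cmod q = q) by (rewrite Cmod_R, Rabs_pos_eq; lra).
  assert (Lq : (ln q < 0)%R) by (rewrite <- ln_1; apply ln_increasing; lra).
  assert (Mal' : Cmod alpha = exp (Re alpha0 * ln q)) by (rewrite halpha; apply Cmod_cpow).
  assert (Mal : (Cmod alpha < 1)%R).
  { rewrite Mal', <- exp_0. apply exp_increasing. nra. }
  assert (Mql : (Cmod (q / alpha) < 1)%R).
  { rewrite Cmod_div, Mq, Mal' by exact Hal. apply Rlt_div_l; [apply exp_pos|].
    rewrite Rmult_1_l. rewrite <- (exp_ln q q0) at 1. apply exp_increasing. nra. }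
  assert (Rab : regular (q := q) (a / b)) by (apply not_q_power_regular, hab).
  assert (Hab0 : a / b <> 0).
  { intros E. apply ha0. replace a with (a / b * b) by (field; exact hb0). rewrite E. ring. }
  assert (Rba : regular (q := q) (b / a)).
  { apply not_q_power_regular. intros H. apply hab, q_power_inv; [exact Hab0|].
    replace (/ (a / b)) with (b / a) by (field; auto). exact H. }
  assert (hce : ~ is_q_power q (c * d / q)).
  { intros H. apply hcd, (q_power_mult (q := q) _ (-1)%Z).
    replace (c * d * RtoC (powerRZ q (-1))) with (c * d / q); [exact H|].
    simpl. rewrite Rmult_1_r, RtoC_inv by lra. reflexivity. }
  assert (Rce : regular (q := q) (c / (q / d))).
  { replace (c / (q / d)) with (c * d / q) by (field; auto). apply not_q_power_regular, hce. }
  assert (Rec : regular (q := q) (q / d / c)).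
  { apply not_q_power_regular. intros H. apply hce, q_power_inv.
    - intros E. apply (Cmult_neq_0 c d hc0 hd0).
      replace (c * d) with (c * d / q * q) by (field; exact Hq). rewrite E. ring.
    - replace (/ (c * d / q)) with (q / d / c) by (field; auto). exact H. }
  set (Z1 := q / d * cpow q (- nu)). set (Z2 := a * b * c * cpow q nu).
  assert (I1 := sides_integral_value (q / d) c b a Z1 Z2 alpha Hal Mc Me Ma Mb Mal Mql Rce Rab).
  assert (I2 := sides_integral_value (q / d) c a b Z1 Z2 alpha Hal Mc Me Mb Ma Mal Mql Rce Rba).
  assert (I3 := sides_integral_value c (q / d) b a Z1 Z2 alpha Hal Me Mc Ma Mb Mal Mql Rec Rab).
  assert (I4 := sides_integral_value c (q / d) a b Z1 Z2 alpha Hal Me Mc Mb Ma Mal Mql Rec Rba).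
  set (N := qpoch_inf (a * b) q * qpoch_inf (a * c) q * qpoch_inf (b * c) q
     * (qpoch_inf (a * b) q * qpoch_inf (a * c) q * qpoch_inf (b * c) q)).
  assert (E1 : / N * double_value (q := q) (q / d) c b a Z1 Z2 alpha = T1)
    by (apply term_c; assumption).
  assert (E3 : / N * double_value (q := q) c (q / d) b a Z1 Z2 alpha = T3)
    by (apply term_e; assumption).
  assert (EN : N = qpoch_inf (a * b) q * qpoch_inf (b * c) q * qpoch_inf (a * c) q
     * (qpoch_inf (a * b) q * qpoch_inf (b * c) q * qpoch_inf (a * c) q))
    by (unfold N; ring).
  assert (E2 : / N * double_value (q := q) (q / d) c a b Z1 Z2 alpha = T2).
  { assert (T := term_c b a c d alpha nu hb0 ha0 hc0 hd0 Hal Mb Ma Mc Mal Mql Rab Rec).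
    rewrite (Cmult_comm b a) in T. rewrite EN. exact T. }
  assert (E4 : / N * double_value (q := q) c (q / d) a b Z1 Z2 alpha = T4).
  { assert (T := term_e b a c d alpha nu hb0 ha0 hc0 hd0 Hal Mb Ma Mc Me Mal Mql Rab Rce).
    rewrite (Cmult_comm b a) in T. rewrite EN. exact T. }
  rewrite <- E1, <- E2, <- E3, <- E4, <- !Cmult_plus_distr_l.
  apply cint_ext with (2 := cint_scal (/ N) _ _ _ _
    (cint_plus _ _ _ _ _ _ (cint_plus _ _ _ _ _ _ (cint_plus _ _ _ _ _ _ I1 I2) I3) I4)).
  assert (PP := PI_RGT_0).
  intros t Ht. rewrite Rmin_left, Rmax_right in Ht by lra.
  symmetry. apply integrand_expansion; assumption.
Qed.
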